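(* Let $k\in\mathbb R$, $K\in\mathbb Z$, and let $a_0,\dots,a_n$ be holomorphic functions on $\mathfrak H$; set $a_r=0$ for $r>n$ and $L=\sum_{r=0}^n a_r(\tau)D^r$. Then $L$ is a modular linear differential operator of type $(k,k+K)$ on $\Gamma_1=SL_2(\mathbb Z)$ if and only if for each $r=0,\dots,n$ the function $$d_r(\tau)=\sum_{j\ge0}\binom{r+j}{j}(k+r+j)_j\Bigl(\frac{E_2(\tau)}{12}\Bigr)^j a_{r+j}(\tau)$$ is a modular form of weight $K-2r$ on $\Gamma_1$; in this case $L=\sum_{r=0}^n d_r\,\vartheta_k^{[r]}$.
   Context: $(f|_k\gamma)(\tau)=(c\tau+d)^{-k}f(\gamma\tau)$ for $\gamma=\begin{pmatrix}a&b\\c&d\end{pmatrix}$; $D=\frac1{2\pi i}\frac d{d\tau}$; $q=e^{2\pi i\tau}$; $(x)_m=x(x+1)\cdots(x+m-1)$. A modular linear differential operator of type $(k,k+K)$ on $\Gamma_1$ is a linear differential operator of finite order with coefficients holomorphic on $\mathfrak H$ (and at the cusp) such that $L(f|_k\gamma)=L(f)|_{k+K}\gamma$ for all holomorphic $f$ on $\mathfrak H$ and all $\gamma\in\Gamma_1$. $E_2=1-24\sum\frac{nq^n}{1-q^n}$, $E_4=1+240\sum\frac{n^3q^n}{1-q^n}$. Serre derivative $\vartheta_j(g)=Dg-\frac j{12}E_2g$. Canonical higher Serre derivatives: $\vartheta_k^{[0]}=\mathrm{id}$, $\vartheta_k^{[1]}=\vartheta_k$, $\vartheta_k^{[m+1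]}(f)=\vartheta_{k+2m}(\vartheta_k^{[m]}f)-\frac{m(m+k-1)}{144}E_4\,\vartheta_k^{[m-1]}f$.
   Formalization: The factor (k+r+j)_j in d_r is corrected to (k+r)_j: as printed the claim fails, since for L = D − (k/12)E_2, of type (k,k+2), the printed formula gives d_0 = E_2/12, which is not modular. *)

(* Defs.v *)
(* Stdlib reals with Coquelicot's complex numbers. Functions on the upper
   half-plane are functions [C -> C] whose values off the half-plane are
   irrelevant. *)
From Stdlib Require Import Reals ZArith.
From Coquelicot Require Import Coquelicot.

Open Scope R_scope.

Definition HH (z : C) : Prop := 0 < Im z.

(* Complex differentiability: the scalars of the derivative are [C]. *)
Definition holomorphic_on (U : C -> Prop) (f : C -> C) : Prop :=
  forall z : C, U z -> @ex_derive C_AbsRing C_NormedModule f z.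

Definition Cexp (z : C) : C := (exp (Re z) * cos (Im z), exp (Re z) * sin (Im z)).

(* Principal argument, in (-PI, PI]; meaningful for z <> 0. *)
Definition Carg (z : C) : R :=
  if Rle_dec 0 (Im z) then acos (Re z / Cmod z) else - acos (Re z / Cmod z).

(* z ^ s for real s and z <> 0, principal branch. *)
Definition Cpower (z : C) (s : R) : C :=
  Cexp (RtoC s * (ln (Cmod z), Carg z))%C.

(* The sum of a convergent complex series, computed componentwise. *)
Definition CSeries (u : nat -> C) : C :=
  (Series (fun n => Re (u n)), Series (fun n => Im (u n))).

Definition qexp (tau : C) : C := Cexp (RtoC (2 * PI) * Ci * tau)%C.

Definition E2 (tau : C) : C :=
  (1 - 24 * CSeries (fun m => RtoC (INR (S m)) * qexp tau ^ S m
                              / (1 - qexp tau ^ S m)))%C.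

Definition E4 (tau : C) : C :=
  (1 + 240 * CSeries (fun m => RtoC (INR (S m) ^ 3) * qexp tau ^ S m
                               / (1 - qexp tau ^ S m)))%C.

Record SL2Z : Set := mkSL2Z {
  sla : Z; slb : Z; slc : Z; sld : Z;
  sl_det : (sla * sld - slb * slc = 1)%Z
}.

Definition autfactor (g : SL2Z) (tau : C) : C :=
  (RtoC (IZR (slc g)) * tau + RtoC (IZR (sld g)))%C.

Definition moebius (g : SL2Z) (tau : C) : C :=
  ((RtoC (IZR (sla g)) * tau + RtoC (IZR (slb g))) / autfactor g tau)%C.

(* f |_k g. For real k the power is the principal one, which is holomorphic in
   tau on the half-plane for every g; the branch is the same for all weights,
   so weights differing by an integer m differ by the factor
   (c tau + d) ^ (- m). *)
Definition slash (k : R) (g : SL2Z) (f : C -> C) (tau : C) : C :=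
  (Cpower (autfactor g tau) (- k) * f (moebius g tau))%C.

(* f is a holomorphic function of q = exp (2 pi i tau) on the whole open unit
   disc, q = 0 included. *)
Definition holomorphic_at_cusp (f : C -> C) : Prop :=
  exists F : C -> C,
    holomorphic_on (fun q => Cmod q < 1) F /\
    (forall tau : C, HH tau -> f tau = F (qexp tau)).

Definition modular_form (w : Z) (f : C -> C) : Prop :=
  holomorphic_on HH f /\
  (forall (g : SL2Z) (tau : C), HH tau -> slash (IZR w) g f tau = f tau) /\
  holomorphic_at_cusp f.

Definition D (f : C -> C) (tau : C) : C :=
  (C_derive f tau / (RtoC (2 * PI) * Ci))%C.

Definition diffop (n : nat) (a : nat -> C -> C) (f : C -> C) (tau : C) : C :=
  sum_n (fun r => (a r tau * Nat.iter r D f tau)%C) n.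

(* Operators act on functions holomorphic on the half-plane, and only the
   values on the half-plane matter. *)
Definition is_MLDO (k l : R) (L : (C -> C) -> C -> C) : Prop :=
  (exists (n : nat) (a : nat -> C -> C),
     (forall r : nat, (r <= n)%nat ->
        holomorphic_on HH (a r) /\ holomorphic_at_cusp (a r)) /\
     (forall (f : C -> C) (tau : C), holomorphic_on HH f -> HH tau ->
        L f tau = diffop n a f tau)) /\
  (forall (f : C -> C) (g : SL2Z) (tau : C), holomorphic_on HH f -> HH tau ->
     L (slash k g f) tau = slash l g (L f) tau).

Definition serre (j : R) (f : C -> C) (tau : C) : C :=
  (D f tau - RtoC (j / 12) * E2 tau * f tau)%C.

Fixpoint higher_serre (k : R) (m : nat) (f : C -> C) {struct m} : C -> C :=
  match m with
  | O => f
  | S m1 =>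
      match m1 with
      | O => serre k f
      | S m2 => fun tau =>
          (serre (k + 2 * INR m1) (higher_serre k m1 f) tau
           - RtoC (INR m1 * (INR m1 + k - 1) / 144) * E4 tau
             * higher_serre k m2 f tau)%C
      end
  end.

Fixpoint rising (x : R) (m : nat) : R :=
  match m with
  | O => 1
  | S m' => rising x m' * (x + INR m')
  end.

(* The Pochhammer symbol starts at k + r, not at k + r + j: with k + r + j the
   operator D - (k/12) E2 of type (k, k+2) would have d_0 = E2/12.
   The sum over j >= 0 is cut at n, as a vanishes beyond the index n. *)
Definition dcoef (k : R) (n : nat) (a : nat -> C -> C) (r : nat) (tau : C) : C :=
  sum_n (fun j => (RtoC (Binomial.C (r + j) j * rising (k + INR r) j)
                   * (E2 tau / 12) ^ j * a (r + j)%nat tau)%C) n.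

(* Main.v *)
(** The operators on both sides are compared through the identity
    [D^m f = sum_r C(m,r) (k+r)_(m-r) (E2/12)^(m-r) theta_k^[r] f], which rests on
    Ramanujan's equation [D E2 = (E2^2 - E4) / 12] and gives
    [L = sum_r d_r theta_k^[r]] unconditionally. Quasimodularity of [E2] makes
    [theta_k^[r]] equivariant from weight [k] to weight [k + 2r], so [L] is
    equivariant as soon as every [d_r] is modular; conversely the polynomials
    [(z - z0)^s] separate the [theta_k^[r]] at any point, so equivariance forces
    each [d_r] to be modular. The cusp conditions pass between the [a_r] and the
    [d_r] because the transition matrix is unitriangular over [C[E2]].

    Holomorphic functions are only assumed complex differentiable, so that their
    derivatives are holomorphic comes from Goursat's bisection on the image of a
    square, applied to a homotopy between two circles; this yields Cauchy's
    formula. The behaviour of [E2] under [tau -> -1/tau] is Eisenstein's double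
    sum over [m tau + n], evaluated in both orders with the expansions of
    [pi cot] and [pi^2 / sin^2]; these are limits of the duplication formulas.
    Ramanujan's equation is the sum over [a, b >= 1] of two addition formulas
    for the cotangent at [a theta], [b theta], [(a + b) theta]. *)
Require Import Defs.
From Stdlib Require Import Reals ZArith Lra Lia.
From Coquelicot Require Import Coquelicot.

(** * Complex derivatives *)

(** For real weight and principal powers, [slash k] need not be a group action, so equivariance
    cannot be reduced to generators: it is proved for each matrix separately, by differentiating
    [slash]. Only the law of [E2], which involves no power with real exponent, is reduced to the
    inversion and the translations. Since all weights share one logarithm, exponents add, and the
    shifts by 2r bring in only ordinary powers of c tau + d.

    In the expansion of D^m, differentiating a power of E2/12 produces a term in E4, and
    differentiating theta^[r] produces another. The constant r(r + k - 1)/144 in the definition of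
    the higher derivatives is the one for which these terms cancel; what remains is a Pascal
    recursion for the coefficients.

    No Taylor series is used. Cauchy's formula gives a quadratic remainder whose constant is linear
    in a bound of the function, and this is enough to differentiate a dominated series term by term,
    in the half-plane as well as at q = 0. *)

Definition cder (f : C -> C) (z l : C) : Prop :=
  forall eps : R, 0 < eps -> exists d : R, 0 < d /\
    forall w : C, Cmod (w - z) < d ->
      Cmod (f w - f z - l * (w - z))%C <= eps * Cmod (w - z).

Lemma cder_is_derive_AbsRing (f : C -> C) (z l : C) :
  cder f z l <->
  @is_derive C_AbsRing (AbsRing_NormedModule C_AbsRing) f z l.
Proof.
split.
- intros H; split; [apply is_linear_scal_l|].
  intros x Hx.
  assert (Ex : z = x).
  { apply (is_filter_lim_locally_unique (K:=C_AbsRing) (V:=AbsRing_NormedModule C_AbsRing)); exact Hx. }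
  subst x. intros eps.
  destruct (H eps (cond_pos eps)) as [d [Hd Hw]].
  exists (mkposreal d Hd). intros y Hy.
  change (Cmod (f y - f z - (y - z) * l)%C <= eps * Cmod (y - z)).
  rewrite (Cmult_comm (y - z) l). apply Hw, Hy.
- intros [_ H] eps He.
  destruct (H z (fun P HP => HP) (mkposreal eps He)) as [d Hd].
  exists d; split; [apply cond_pos|]. intros w Hw.
  specialize (Hd w Hw).
  change (Cmod (f w - f z - (w - z) * l)%C <= eps * Cmod (w - z)) in Hd.
  rewrite (Cmult_comm l). exact Hd.
Qed.

(** Holomorphy is defined with [C_NormedModule], while the product rule is available for
    [AbsRing_NormedModule C_AbsRing]. The two little-o conditions agree by conversion, so [cder]
    serves as a bridge. *)
Lemma cder_is_derive (f : C -> C) (z l : C) :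
  cder f z l <-> @is_derive C_AbsRing C_NormedModule f z l.
Proof.
split.
- intros H; split; [apply is_linear_scal_l|].
  apply cder_is_derive_AbsRing in H. exact (proj2 H).
- intros [_ H]. apply cder_is_derive_AbsRing. split; [apply is_linear_scal_l|].
  exact H.
Qed.

Lemma cder_unique f z l : cder f z l -> C_derive f z = l.
Proof. intros H. apply is_C_derive_unique, cder_is_derive, H. Qed.

Lemma cder_derive f z :
  @ex_derive C_AbsRing C_NormedModule f z <-> cder f z (C_derive f z).
Proof.
split.
- intros H. apply cder_is_derive, C_derive_correct; [exact z|exact H].
- intros H. eexists. apply cder_is_derive. exact H.
Qed.

Lemma cder_ext_loc f g z l :
  (exists d, 0 < d /\ forall w, Cmod (w - z) < d -> f w = g w) ->
  cder f z l -> cder g z l.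
Proof.
intros [d [Hd E]] H eps He.
destruct (H eps He) as [d' [Hd' Hw]].
exists (Rmin d d'); split; [now apply Rmin_pos|].
intros w Hw'.
assert (E0 : f z = g z).
{ apply E. replace (z - z)%C with (RtoC 0) by ring. now rewrite Cmod_0. }
rewrite <- E0, <- E.
- apply Hw. eapply Rlt_le_trans; [exact Hw'|apply Rmin_r].
- eapply Rlt_le_trans; [exact Hw'|apply Rmin_l].
Qed.

Lemma cder_ext f g z l : (forall w, f w = g w) -> cder f z l -> cder g z l.
Proof.
intros E. apply cder_ext_loc. exists 1; split; [lra|auto].
Qed.

Lemma cder_const c z : cder (fun _ => c) z 0.
Proof.
intros eps He. exists 1; split; [lra|]. intros w _.
replace (c - c - 0 * (w - z))%C with (RtoC 0) by ring.
rewrite Cmod_0. apply Rmult_le_pos; [lra|apply Cmod_ge_0].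
Qed.

Lemma cder_id z : cder (fun w => w) z 1.
Proof.
intros eps He. exists 1; split; [lra|]. intros w _.
replace (w - z - 1 * (w - z))%C with (RtoC 0) by ring.
rewrite Cmod_0. apply Rmult_le_pos; [lra|apply Cmod_ge_0].
Qed.

Lemma cder_plus f g z l m :
  cder f z l -> cder g z m -> cder (fun w => f w + g w)%C z (l + m)%C.
Proof.
rewrite !cder_is_derive_AbsRing. intros H1 H2.
exact (is_derive_plus (V:=AbsRing_NormedModule C_AbsRing) f g z l m H1 H2).
Qed.

Lemma cder_mult f g z l m :
  cder f z l -> cder g z m ->
  cder (fun w => f w * g w)%C z (l * g z + f z * m)%C.
Proof.
rewrite !cder_is_derive_AbsRing. intros H1 H2.
exact (is_derive_mult (K:=C_AbsRing) f g z l m H1 H2 Cmult_comm).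
Qed.

Lemma cder_scal c f z l : cder f z l -> cder (fun w => c * f w)%C z (c * l)%C.
Proof.
intros H. generalize (cder_mult _ _ _ _ _ (cder_const c z) H).
now replace (0 * f z + c * l)%C with (c * l)%C by ring.
Qed.

Lemma cder_opp f z l : cder f z l -> cder (fun w => - f w)%C z (- l)%C.
Proof.
intros H. replace (- l)%C with (- (1) * l)%C by ring.
apply cder_ext with (fun w => - (1) * f w)%C; [intros; ring|].
now apply cder_scal.
Qed.

Lemma cder_minus f g z l m :
  cder f z l -> cder g z m -> cder (fun w => f w - g w)%C z (l - m)%C.
Proof. intros H1 H2. apply cder_plus; [exact H1|now apply cder_opp]. Qed.

Lemma cder_comp f g z l m :
  cder f (g z) l -> cder g z m -> cder (fun w => f (g w)) z (m * l)%C.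
Proof.
rewrite !cder_is_derive_AbsRing. intros H1 H2.
exact (is_derive_comp (V:=AbsRing_NormedModule C_AbsRing) f g z l m H1 H2).
Qed.

Lemma cder_pow n z : cder (fun w => w ^ S n)%C z (RtoC (INR (S n)) * z ^ n)%C.
Proof.
induction n as [|n IH].
- eapply cder_ext; [|replace (RtoC (INR 1) * z ^ 0)%C with (RtoC 1) by (simpl; ring); apply cder_id].
  intros; simpl; ring.
- generalize (cder_mult _ _ _ _ _ (cder_id z) IH).
  replace (RtoC (INR (S (S n))) * z ^ S n)%C
    with (1 * z ^ S n + z * (RtoC (INR (S n)) * z ^ n))%C; [easy|].
  rewrite (S_INR (S n)), RtoC_plus. simpl Cpow. ring.
Qed.

(** Neighbourhoods given by the discs of [Cmod], not by the boxes of the product structure on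
    pairs. *)
Notation Clocally := (@locally (AbsRing_UniformSpace C_AbsRing)).

Lemma filterlim_Cmod {T : Type} (F : (T -> Prop) -> Prop) {FF : Filter F} (u : T -> C) (l : C) :
  filterlim u F (Clocally l) <->
  forall eps, 0 < eps -> F (fun x => Cmod (u x - l)%C < eps).
Proof.
rewrite (@filterlim_locally T (AbsRing_UniformSpace C_AbsRing) F FF u l).
split; [intros H eps He; exact (H (mkposreal eps He))|intros H eps; exact (H eps (cond_pos eps))].
Qed.

Lemma filterlim_C_plus {T : Type} (F : (T -> Prop) -> Prop) {FF : Filter F} (u v : T -> C) (l m : C) :
  filterlim u F (Clocally l) -> filterlim v F (Clocally m) ->
  filterlim (fun x => u x + v x)%C F (Clocally (l + m)%C).
Proof.
intros Hu Hv. exact (filterlim_comp_2 u v Cplus Hu Hv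
  (@filterlim_plus C_AbsRing (AbsRing_NormedModule C_AbsRing) l m)).
Qed.

Lemma filterlim_C_mult {T : Type} (F : (T -> Prop) -> Prop) {FF : Filter F} (u v : T -> C) (l m : C) :
  filterlim u F (Clocally l) -> filterlim v F (Clocally m) ->
  filterlim (fun x => u x * v x)%C F (Clocally (l * m)%C).
Proof.
intros Hu Hv. exact (filterlim_comp_2 u v Cmult Hu Hv (@filterlim_mult C_AbsRing l m)).
Qed.

Lemma filterlim_cder {T : Type} (F : (T -> Prop) -> Prop) f (u : T -> C) (z l : C) :
  cder f z l -> filterlim u F (Clocally z) -> filterlim (fun x => f (u x)) F (Clocally (f z)).
Proof.
intros Hf Hu. eapply filterlim_comp; [exact Hu|].
apply (@ex_derive_continuous C_AbsRing (AbsRing_NormedModule C_AbsRing)).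
exists l. now apply cder_is_derive_AbsRing.
Qed.

Lemma cder_continuous f z l : cder f z l ->
  forall eps, 0 < eps -> exists d, 0 < d /\
    forall w, Cmod (w - z) < d -> Cmod (f w - f z) < eps.
Proof.
intros H eps He.
assert (L := filterlim_cder (Clocally z) f (fun w => w) z l H (filterlim_id _ _)).
destruct (proj1 (filterlim_Cmod (Clocally z) f (f z)) L eps He) as [d Hd].
exists d. split; [apply cond_pos|exact Hd].
Qed.

Lemma cder_eq f z l m : cder f z l -> l = m -> cder f z m.
Proof. now intros H <-. Qed.

Lemma Cmod_triangle_rev x y : Cmod x - Cmod y <= Cmod (x - y)%C.
Proof.
generalize (Cmod_triangle (x - y) y).
replace (x - y + y)%C with x by ring. lra.
Qed.

Lemma cder_inv (z : C) : z <> 0 -> cder (fun w => / w)%C z (- / (z * z))%C.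
Proof.
intros Hz eps He.
assert (Hm : 0 < Cmod z) by (apply Cmod_gt_0; exact Hz).
set (m := Cmod z) in *.
(* The first bound keeps [Cmod w] above m/2; the second then makes |w - z| / (|w| m^2) at most
   [eps]. *)
exists (Rmin (m / 2) (eps * m ^ 3 / 2)); split.
{ apply Rmin_pos; [lra|]. assert (0 < m ^ 3) by now apply pow_lt. nra. }
intros w Hw.
assert (H1 : Cmod (w - z) < m / 2) by (eapply Rlt_le_trans; [exact Hw|apply Rmin_l]).
assert (H2 : Cmod (w - z) < eps * m ^ 3 / 2) by (eapply Rlt_le_trans; [exact Hw|apply Rmin_r]).
assert (H3 : m / 2 < Cmod w).
{ generalize (Cmod_triangle_rev z w).
  replace (z - w)%C with (- (w - z))%C by ring. rewrite Cmod_opp. fold m. lra. }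
assert (Hw0 : w <> 0) by (apply Cmod_gt_0; lra).
replace (/ w - / z - - / (z * z) * (w - z))%C
  with ((w - z) * (w - z) * / (w * (z * z)))%C by (field; auto).
assert (Hzz : (z * z)%C <> 0) by now apply Cmult_neq_0.
rewrite !Cmod_mult, Cmod_inv, !Cmod_mult by now apply Cmult_neq_0.
fold m.
assert (H4 := Cmod_ge_0 (w - z)). set (h := Cmod (w - z)) in *. set (p := Cmod w) in *.
assert (H5 : h * / (p * (m * m)) <= eps).
{ apply Rmult_le_reg_r with (p * (m * m)).
  - apply Rmult_lt_0_compat; nra.
  - rewrite Rmult_assoc, Rinv_l by (apply Rgt_not_eq; apply Rmult_lt_0_compat; nra).
    assert (eps * (m / 2 * (m * m)) <= eps * (p * (m * m))).
    { apply Rmult_le_compat_l; [lra|]. apply Rmult_le_compat_r; nra. }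
    simpl in H2. nra. }
rewrite Rmult_assoc, (Rmult_comm eps). now apply Rmult_le_compat_l.
Qed.

Lemma cder_div (f g : C -> C) (z l m : C) : g z <> 0 ->
  cder f z l -> cder g z m ->
  cder (fun w => f w / g w)%C z ((l * g z - f z * m) / (g z * g z))%C.
Proof.
intros Hg Hf Hm.
generalize (cder_mult _ _ _ _ _ Hf (cder_comp _ _ _ _ _ (cder_inv _ Hg) Hm)).
intros H. replace ((l * g z - f z * m) / (g z * g z))%C
 with (l * / g z + f z * (m * - / (g z * g z)))%C; [exact H|field; exact Hg].
Qed.

Lemma Cmod_le_abs (z : C) : Cmod z <= Rabs (Re z) + Rabs (Im z).
Proof.
destruct z as [x y]. unfold Re, Im; simpl.
replace (x, y) with (RtoC x + Ci * RtoC y)%C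
  by (apply injective_projections; simpl; ring).
eapply Rle_trans; [apply Cmod_triangle|].
rewrite Cmod_mult, Cmod_Ci, !Cmod_R. lra.
Qed.

Lemma im_le_Cmod (z : C) : Rabs (Im z) <= Cmod z.
Proof.
eapply Rle_trans; [apply Rmax_r|apply Rmax_Cmod].
Qed.

Lemma Ceq (z w : C) : Re z = Re w -> Im z = Im w -> z = w.
Proof. destruct z, w; unfold Re, Im; simpl; congruence. Qed.

(** * The complex exponential *)

Lemma Cexp_plus z w : Cexp (z + w) = (Cexp z * Cexp w)%C.
Proof.
unfold Cexp. rewrite re_plus, im_plus, exp_plus, cos_plus, sin_plus.
apply injective_projections; simpl; ring.
Qed.

Lemma Cexp_0 : Cexp 0 = 1.
Proof.
unfold Cexp; simpl. rewrite exp_0, cos_0, sin_0. apply injective_projections; simpl; ring.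
Qed.

Lemma Cexp_neq_0 z : Cexp z <> 0.
Proof.
intros E. assert (H := Cexp_plus z (- z)).
replace (z + - z)%C with (RtoC 0) in H by ring. rewrite E, Cexp_0, Cmult_0_l in H.
apply C1_nz. exact H.
Qed.

Lemma Cexp_opp z : Cexp (- z) = (/ Cexp z)%C.
Proof.
assert (H := Cexp_plus z (- z)).
replace (z + - z)%C with (RtoC 0) in H by ring. rewrite Cexp_0 in H.
assert (Hz := Cexp_neq_0 z).
replace (Cexp (- z)) with (/ Cexp z * (Cexp z * Cexp (- z)))%C by (field; auto).
rewrite <- H. ring.
Qed.

Lemma Cmod_Cexp z : Cmod (Cexp z) = exp (Re z).
Proof.
unfold Cexp, Cmod; simpl.
replace (_ + _) with (exp (Re z) * exp (Re z)).
- apply sqrt_square. left; apply exp_pos.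
- generalize (sin2_cos2 (Im z)); unfold Rsqr; intros H.
  replace (exp (Re z) * exp (Re z))
    with (exp (Re z) * exp (Re z) * (sin (Im z) * sin (Im z) + cos (Im z) * cos (Im z)))
    by (rewrite H; ring). ring.
Qed.

Lemma Rderiv_eps (f : R -> R) x l : is_derive f x l ->
  forall eps, 0 < eps -> exists d, 0 < d /\
   forall h, Rabs h < d -> Rabs (f (x + h) - f x - l * h) <= eps * Rabs h.
Proof.
intros [_ H] eps He.
destruct (H x (fun P HP => HP) (mkposreal eps He)) as [d Hd].
exists d; split; [apply cond_pos|]. intros h Hh.
assert (Hb : ball x d (x + h)).
{ change (Rabs (x + h - x) < d). now replace (x + h - x) with h by ring. }
specialize (Hd _ Hb).
change (Rabs (f (x + h) - f x - (x + h - x) * l) <= eps * Rabs (x + h - x)) in Hd.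
replace (x + h - x) with h in Hd by ring. now rewrite (Rmult_comm l).
Qed.

(** Only the point 0 needs an estimate, from the real derivatives of exp, cos and sin there; the
    functional equation carries it to every other point. *)
Lemma cder_Cexp_0 : cder Cexp 0 1.
Proof.
intros eps He.
assert (He8 : 0 < eps / 8) by lra.
destruct (Rderiv_eps exp 0 1) with (eps := eps / 8) as [d1 [Hd1 H1]]; [|exact He8|].
{ generalize (is_derive_exp 0). now rewrite exp_0. }
destruct (Rderiv_eps cos 0 0) with (eps := eps / 8) as [d2 [Hd2 H2]]; [|exact He8|].
{ generalize (is_derive_cos 0). now rewrite sin_0, Ropp_0. }
destruct (Rderiv_eps sin 0 1) with (eps := eps / 8) as [d3 [Hd3 H3]]; [|exact He8|].
{ generalize (is_derive_sin 0). now rewrite cos_0. }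
(* The bound 1 gives exp x <= 3, and then the four error terms take the shares 1/8, 3/8, 3/8 and 1/8
   of [eps]. The bounds 1/2 and eps/16 control the quadratic term (exp x - 1) y. *)
exists (Rmin (Rmin d1 d2) (Rmin d3 (Rmin (1/2) (Rmin (eps / 16) 1)))); split.
{ repeat apply Rmin_pos; lra. }
intros w Hw. replace (w - 0)%C with w in * by ring.
rewrite Cexp_0.
repeat match goal with H : _ < Rmin _ _ |- _ =>
  apply Rmin_Rgt_l in H; unfold Rgt in H; destruct H end.
assert (Hx := re_le_Cmod w). assert (Hy := im_le_Cmod w).
set (h := Cmod w) in *.
specialize (H1 (Re w)). specialize (H2 (Im w)). specialize (H3 (Im w)).
rewrite Rplus_0_l in *. rewrite exp_0 in H1. rewrite cos_0 in H2. rewrite sin_0 in H3.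
assert (H1' := H1 ltac:(lra)). assert (H2' := H2 ltac:(lra)). assert (H3' := H3 ltac:(lra)).
unfold Cexp. set (x := Re w) in *. set (y := Im w) in *.
replace (((exp x * cos y)%R, (exp x * sin y)%R) - 1 - 1 * w)%C
  with (((exp x - 1 - 1 * x) + exp x * (cos y - 1 - 0 * y),
         exp x * (sin y - 0 - 1 * y) + (exp x - 1) * y) : C).
2:{ unfold x, y; destruct w as [a b]; apply injective_projections; simpl; ring. }
assert (Hex : exp x <= 3).
{ eapply Rle_trans; [|apply exp_le_3]. left; apply exp_increasing.
  assert (Hx' := Rle_abs x). lra. }
assert (Hex0 := exp_pos x).
assert (Hex1 : Rabs (exp x - 1) <= (1 + eps / 8) * h).
{ replace (exp x - 1) with ((exp x - 1 - 1 * x) + x) by ring.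
  eapply Rle_trans; [apply Rabs_triang|]. nra. }
eapply Rle_trans; [apply Cmod_le_abs|]. unfold Re, Im; simpl fst; simpl snd.
eapply Rle_trans.
{ apply Rplus_le_compat; apply Rabs_triang. }
rewrite !Rabs_mult, (Rabs_pos_eq (exp x)) by lra.
assert (Hh := Cmod_ge_0 w). fold h in Hh.
set (A := Rabs (exp x - 1 - 1 * x)) in *.
set (B := Rabs (cos y - 1 - 0 * y)) in *.
set (D := Rabs (sin y - 0 - 1 * y)) in *.
assert (HA : A <= eps / 8 * h) by nra.
assert (HB : B <= eps / 8 * h) by nra.
assert (HD : D <= eps / 8 * h) by nra.
assert (B0 : 0 <= B) by apply Rabs_pos. assert (D0 : 0 <= D) by apply Rabs_pos.
assert (HE : Rabs (exp x - 1) * Rabs y <= ((1 + eps / 8) * h) * h)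
  by (apply Rmult_le_compat; auto using Rabs_pos; lra).
assert (HF : ((1 + eps / 8) * h) * h <= (eps / 16 + eps / 8 * (1 / 2)) * h).
{ apply Rmult_le_compat_r; [lra|]. nra. }
nra.
Qed.

Lemma cder_Cexp z : cder Cexp z (Cexp z).
Proof.
apply cder_ext with (fun w => Cexp z * Cexp (w - z))%C.
{ intros w. rewrite <- Cexp_plus. f_equal. ring. }
cut (cder (fun w => Cexp z * Cexp (w - z))%C z (Cexp z * (1 * 1))%C).
{ now replace (Cexp z * (1 * 1))%C with (Cexp z) by ring. }
apply (cder_scal (Cexp z) (fun w => Cexp (w - z))).
apply (cder_comp Cexp (fun w => w - z)%C).
- replace (z - z)%C with (RtoC 0) by ring. apply cder_Cexp_0.
- replace (RtoC 1) with (1 - 0)%C by ring.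
  apply cder_minus; [apply cder_id|apply cder_const].
Qed.

Lemma cder_linear a z : cder (fun w => a * w)%C z a.
Proof.
generalize (cder_scal a _ _ _ (cder_id z)). now rewrite Cmult_1_r.
Qed.

(** * Goursat's lemma *)

Definition rder (g : R -> C) (t : R) (l : C) : Prop :=
  forall eps : R, 0 < eps -> exists d : R, 0 < d /\
    forall u : R, Rabs (u - t) < d ->
      Cmod (g u - g t - l * RtoC (u - t))%C <= eps * Rabs (u - t).

(* Continuity for the norm of [C]; [rcont_continuous] relates it to the product
   uniform structure, which Coquelicot integrates with. *)
Definition rcont (g : R -> C) (t : R) : Prop := filterlim g (locally t) (Clocally (g t)).

Lemma rcont_eps g t : rcont g t <-> forall eps : R, 0 < eps -> exists d : R, 0 < d /\
  forall u : R, Rabs (u - t) < d -> Cmod (g u - g t)%C < eps.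
Proof.
assert (E := filterlim_Cmod (locally t) g (g t)). split; intros H.
- intros eps He. destruct (proj1 E H eps He) as [d Hd]. exists d. split; [apply cond_pos|exact Hd].
- apply E. intros eps He. destruct (H eps He) as [d [Hd Hu]]. exists (mkposreal d Hd). exact Hu.
Qed.

Lemma rder_is_derive g t l : rder g t l ->
  @is_derive R_AbsRing C_R_NormedModule g t l.
Proof.
intros H; split; [apply is_linear_scal_l|].
intros x Hx.
assert (Ex : t = x).
{ apply (is_filter_lim_locally_unique (K:=R_AbsRing) (V:=R_NormedModule)); exact Hx. }
subst x. intros eps.
destruct (H eps (cond_pos eps)) as [d [Hd Hw]].
exists (mkposreal d Hd). intros y Hy.
specialize (Hw y Hy). rewrite Cmod_norm in Hw.
refine (Rle_trans _ _ _ _ Hw). right. f_equal.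
change ((g y - g t - @scal R_AbsRing C_R_NormedModule (y - t)%R l)%C = (g y - g t - l * RtoC (y - t))%C).
rewrite scal_R_Cmult. ring.
Qed.

Lemma rcont_continuous g t : rcont g t <->
  @continuous R_UniformSpace C_R_NormedModule g t.
Proof. split; intros H P HP; apply H; now apply locally_C. Qed.

Lemma rder_rcont g t l : rder g t l -> rcont g t.
Proof.
intros H. apply rcont_continuous, (@ex_derive_continuous R_AbsRing C_R_NormedModule).
exists l. now apply rder_is_derive.
Qed.

Lemma rder_comp f g t l m :
  cder f (g t) l -> rder g t m -> rder (fun u => f (g u)) t (l * m)%C.
Proof.
intros Hf Hg eps He.
assert (Hl := Cmod_ge_0 l). assert (Hm := Cmod_ge_0 m).
assert (He1 : 0 < eps / (2 * (1 + Cmod m))) by (apply Rdiv_lt_0_compat; lra).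
assert (He2 : 0 < Rmin 1 (eps / (2 * (1 + Cmod l)))).
{ apply Rmin_pos; [lra|apply Rdiv_lt_0_compat; lra]. }
destruct (Hf _ He1) as [d1 [Hd1 H1]].
destruct (Hg _ He2) as [d2 [Hd2 H2]].
destruct (proj1 (rcont_eps _ _) (rder_rcont _ _ _ Hg) d1 Hd1) as [d3 [Hd3 H3]].
exists (Rmin d2 d3); split; [now apply Rmin_pos|].
intros u Hu.
assert (Hu2 : Rabs (u - t) < d2) by (eapply Rlt_le_trans; [exact Hu|apply Rmin_l]).
assert (Hu3 : Rabs (u - t) < d3) by (eapply Rlt_le_trans; [exact Hu|apply Rmin_r]).
specialize (H3 u Hu3). specialize (H1 (g u) H3). specialize (H2 u Hu2).
assert (Hm1 := Rmin_l 1 (eps / (2 * (1 + Cmod l)))).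
assert (Hm2 := Rmin_r 1 (eps / (2 * (1 + Cmod l)))).
set (e2 := Rmin 1 (eps / (2 * (1 + Cmod l)))) in *.
set (e1 := eps / (2 * (1 + Cmod m))) in *.
assert (E1 : e1 * (1 + Cmod m) = eps / 2) by (unfold e1; field; lra).
assert (E2 : (1 + Cmod l) * e2 <= eps / 2).
{ replace (eps / 2) with ((1 + Cmod l) * (eps / (2 * (1 + Cmod l)))) by (field; lra).
  apply Rmult_le_compat_l; lra. }
set (h := Rabs (u - t)) in *. assert (Hh : 0 <= h) by apply Rabs_pos.
assert (H4 : Cmod (g u - g t) <= (1 + Cmod m) * h).
{ replace (g u - g t)%C with ((g u - g t - m * RtoC (u - t)) + m * RtoC (u - t))%C by ring.
  eapply Rle_trans; [apply Cmod_triangle|]. rewrite Cmod_mult, Cmod_R. fold h. nra. }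
replace (f (g u) - f (g t) - l * m * RtoC (u - t))%C
  with ((f (g u) - f (g t) - l * (g u - g t)) + l * (g u - g t - m * RtoC (u - t)))%C by ring.
eapply Rle_trans; [apply Cmod_triangle|]. rewrite Cmod_mult.
assert (Cmod l * Cmod (g u - g t - m * RtoC (u - t)) <= eps / 2 * h).
{ apply Rle_trans with (Cmod l * (e2 * h)); [apply Rmult_le_compat_l; lra|]. nra. }
assert (e1 * Cmod (g u - g t) <= eps / 2 * h).
{ rewrite <- E1, Rmult_assoc. apply Rmult_le_compat_l; lra. }
lra.
Qed.

Lemma rder_affine a b t : rder (fun u => a + RtoC u * b)%C t b.
Proof.
intros eps He. exists 1; split; [lra|]. intros u _.
replace (a + RtoC u * b - (a + RtoC t * b) - b * RtoC (u - t))%C with (RtoC 0).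
- rewrite Cmod_0. apply Rmult_le_pos; [lra|apply Rabs_pos].
- rewrite RtoC_minus. ring.
Qed.

Lemma rcont_mult f g t : rcont f t -> rcont g t -> rcont (fun u => f u * g u)%C t.
Proof. apply (filterlim_C_mult (locally t)). Qed.

Lemma rcont_plus f g t : rcont f t -> rcont g t -> rcont (fun u => f u + g u)%C t.
Proof. apply (filterlim_C_plus (locally t)). Qed.

Lemma rcont_comp f g t l : cder f (g t) l -> rcont g t -> rcont (fun u => f (g u)) t.
Proof. apply filterlim_cder. Qed.

Lemma rcont_const c t : rcont (fun _ => c) t.
Proof. apply (@filterlim_const R (AbsRing_UniformSpace C_AbsRing) (locally t) _). Qed.

(** * Integrals along paths *)

Definition CInt (g : R -> C) (a b : R) : C :=
  @RInt C_R_CompleteNormedModule g a b.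

Lemma CInt_correct g a b : a <= b -> (forall t, a <= t <= b -> rcont g t) ->
  @is_RInt C_R_NormedModule g a b (CInt g a b).
Proof.
intros Hab H. apply (@RInt_correct C_R_CompleteNormedModule).
apply (@ex_RInt_continuous C_R_CompleteNormedModule).
rewrite Rmin_left, Rmax_right by exact Hab.
intros z Hz. apply rcont_continuous, H, Hz.
Qed.

Lemma is_CInt_unique g a b l : @is_RInt C_R_NormedModule g a b l -> CInt g a b = l.
Proof. intros H. exact (@is_RInt_unique C_R_CompleteNormedModule g a b l H). Qed.

Lemma CInt_Chasles g a b c : a <= b -> b <= c -> (forall t, a <= t <= c -> rcont g t) ->
  CInt g a c = (CInt g a b + CInt g b c)%C.
Proof.
intros Hab Hbc H. apply is_CInt_unique.
apply (@is_RInt_Chasles C_R_NormedModule g a b c).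
- apply CInt_correct; [exact Hab|]. intros; apply H; lra.
- apply CInt_correct; [exact Hbc|]. intros; apply H; lra.
Qed.

Lemma CInt_bound g a b l K : a <= b -> (forall t, a <= t <= b -> Cmod (g t) <= K) ->
  @is_RInt C_R_NormedModule g a b l -> Cmod l <= (b - a) * K.
Proof.
intros Hab H Hi. rewrite Cmod_norm.
apply (@norm_RInt_le_const C_R_NormedModule g a b l K Hab); [|exact Hi].
intros x Hx. generalize (H x Hx). now rewrite Cmod_norm.
Qed.

Lemma is_CInt_derive f df a b : a <= b ->
  (forall t, a <= t <= b -> rder f t (df t)) ->
  (forall t, a <= t <= b -> rcont df t) ->
  @is_RInt C_R_NormedModule df a b (f b - f a)%C.
Proof.
intros Hab H1 H2.
apply (@is_RInt_derive C_R_CompleteNormedModule f df a b);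
  rewrite Rmin_left, Rmax_right by exact Hab.
- intros; now apply rder_is_derive, H1.
- intros; now apply rcont_continuous, H2.
Qed.

Lemma path_Lipschitz g dg a b M : a <= b ->
  (forall t, a <= t <= b -> rder g t (dg t)) ->
  (forall t, a <= t <= b -> rcont dg t) ->
  (forall t, a <= t <= b -> Cmod (dg t) <= M) ->
  Cmod (g b - g a)%C <= (b - a) * M.
Proof.
intros Hab H1 H2 H3. apply (CInt_bound dg a b); [exact Hab|exact H3|].
now apply is_CInt_derive.
Qed.

(* The affine part of [F] has a primitive, so it contributes only its boundary
   values. *)
Lemma path_estimate (F : C -> C) (A B z0 : C) g dg a b K M : a <= b -> 0 <= M ->
  (forall t, a <= t <= b -> exists l, cder F (g t) l) ->
  (forall t, a <= t <= b -> rder g t (dg t)) ->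
  (forall t, a <= t <= b -> rcont dg t) ->
  (forall t, a <= t <= b -> Cmod (dg t) <= M) ->
  (forall t, a <= t <= b -> Cmod (F (g t) - A - B * (g t - z0))%C <= K) ->
  Cmod (CInt (fun t => F (g t) * dg t)%C a b
   - ((A * g b + B / 2 * ((g b - z0) * (g b - z0)))
      - (A * g a + B / 2 * ((g a - z0) * (g a - z0)))))%C <= (b - a) * (K * M).
Proof.
intros Hab HM HF H1 H2 H3 H4.
set (P := fun z => (A * z + B / 2 * ((z - z0) * (z - z0)))%C).
assert (HP : forall z, cder P z (A + B * (z - z0))%C).
{ intros z. unfold P.
  replace (A + B * (z - z0))%C with (A * 1 + B / 2 * ((1 - 0) * (z - z0) + (z - z0) * (1 - 0)))%C
    by (field; apply Cmod_gt_0; rewrite Cmod_R, Rabs_pos_eq; lra).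
  apply cder_plus; [apply cder_scal, cder_id|].
  apply cder_scal. apply (cder_mult (fun z => z - z0)%C (fun z => z - z0)%C);
  apply cder_minus; auto using cder_id, cder_const. }
assert (I1 : @is_RInt C_R_NormedModule (fun t => (A + B * (g t - z0)) * dg t)%C a b (P (g b) - P (g a))%C).
{ apply (is_CInt_derive (fun t => P (g t)) (fun t => (A + B * (g t - z0)) * dg t)%C); [exact Hab| |].
  - intros t Ht. apply rder_comp; auto.
  - intros t Ht. apply rcont_mult; [|auto].
    apply (rcont_comp (fun z => A + B * (z - z0))%C g t (0 + B * (1 - 0))%C).
    + apply cder_plus; [apply cder_const|]. apply cder_scal, cder_minus; auto using cder_id, cder_const.
    + eapply rder_rcont; auto. }
assert (I2 : @is_RInt C_R_NormedModule (fun t => F (g t) * dg t)%C a b (CInt (fun t => F (g t) * dg t)%C a b)).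
{ apply CInt_correct; [exact Hab|]. intros t Ht. apply rcont_mult; [|auto].
  destruct (HF t Ht) as [l Hl]. apply (rcont_comp F g t l Hl).
  eapply rder_rcont; auto. }
generalize (@is_RInt_minus C_R_NormedModule _ _ a b _ _ I2 I1). intros I3.
refine (CInt_bound _ a b _ _ Hab _ I3).
intros t Ht.
change (Cmod (F (g t) * dg t - (A + B * (g t - z0)) * dg t)%C <= K * M).
replace (F (g t) * dg t - (A + B * (g t - z0)) * dg t)%C
  with ((F (g t) - A - B * (g t - z0)) * dg t)%C by ring.
rewrite Cmod_mult. apply Rmult_le_compat; auto using Cmod_ge_0.
Qed.

(** * Bisection of squares *)

Section Bisection.

Variable I : R -> R -> R -> R -> C.
Hypothesis add1 : forall a m b c d, 0 <= a -> a <= m -> m <= b -> b <= 1 ->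
  0 <= c -> c <= d -> d <= 1 -> I a b c d = (I a m c d + I m b c d)%C.
Hypothesis add2 : forall a b c m d, 0 <= a -> a <= b -> b <= 1 ->
  0 <= c -> c <= m -> m <= d -> d <= 1 -> I a b c d = (I a b c m + I a b m d)%C.
Hypothesis small : forall x y eps, 0 <= x <= 1 -> 0 <= y <= 1 -> 0 < eps ->
  exists d, 0 < d /\ forall a c h, 0 < h < d -> a <= x <= a + h -> c <= y <= c + h ->
    0 <= a -> a + h <= 1 -> 0 <= c -> c + h <= 1 ->
    Cmod (I a (a + h) c (c + h)) <= eps * (h * h).

Let half (n : nat) : R := (/ 2) ^ n.

Let J (h : R) (p : R * R) : R := Cmod (I (fst p) (fst p + h) (snd p) (snd p + h)).

(** The last quarter is taken by default. It reaches [eta] when the three others fail, because the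
    four moduli add up to at least 4 [eta]. *)
Let next (h eta : R) (p : R * R) : R * R :=
  let (a, c) := p in
  if Rle_dec eta (J h (a, c)) then (a, c) else
  if Rle_dec eta (J h (a + h, c)) then (a + h, c) else
  if Rle_dec eta (J h (a, c + h)) then (a, c + h) else (a + h, c + h).

Let eta0 : R := Cmod (I 0 1 0 1).

Let sq : nat -> R * R := fix sq n := match n with
  | O => (0, 0)
  | S m => next (half (S m)) (eta0 * (half (S m) * half (S m))) (sq m) end.

Lemma half_pos n : 0 < half n.
Proof. unfold half. apply pow_lt. lra. Qed.

Lemma half_S n : half n = half (S n) + half (S n).
Proof. unfold half; simpl. lra. Qed.

Lemma sq_inv n : 0 <= fst (sq n) /\ fst (sq n) + half n <= 1 /\
  0 <= snd (sq n) /\ snd (sq n) + half n <= 1 /\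
  eta0 * (half n * half n) <= J (half n) (sq n).
Proof.
induction n as [|n IH].
- simpl. unfold J, half; simpl. rewrite !Rplus_0_l. unfold eta0. lra.
- destruct IH as [Ha [Ha' [Hc [Hc' HJ]]]].
  change (sq (S n)) with (next (half (S n)) (eta0 * (half (S n) * half (S n))) (sq n)).
  destruct (sq n) as [a c]; simpl fst in *; simpl snd in *.
  assert (Hp := half_pos (S n)). rewrite (half_S n) in *. set (h := half (S n)) in *.
  unfold next.
  destruct Rle_dec as [H1|H1]; [simpl; lra|].
  destruct Rle_dec as [H2|H2]; [simpl; lra|].
  destruct Rle_dec as [H3|H3]; [simpl; lra|].
  simpl. repeat split; try lra.
  assert (E : (I a (a + (h + h)) c (c + (h + h)) =
    (I a (a + h) c (c + h) + I a (a + h) (c + h) (c + h + h)) +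
    (I (a + h) (a + h + h) c (c + h) + I (a + h) (a + h + h) (c + h) (c + h + h)))%C).
  { rewrite (add1 a (a + h) (a + (h + h))) by lra.
    rewrite (add2 a (a + h) c (c + h) (c + (h + h))) by lra.
    rewrite (add2 (a + h) (a + (h + h)) c (c + h) (c + (h + h))) by lra.
    now rewrite <- !Rplus_assoc. }
  unfold J in *; simpl fst in *; simpl snd in *. rewrite E in HJ.
  assert (T := Cmod_triangle
   (I a (a + h) c (c + h) + I a (a + h) (c + h) (c + h + h))
   (I (a + h) (a + h + h) c (c + h) + I (a + h) (a + h + h) (c + h) (c + h + h))).
  assert (T1 := Cmod_triangle (I a (a + h) c (c + h)) (I a (a + h) (c + h) (c + h + h))).
  assert (T2 := Cmod_triangle (I (a + h) (a + h + h) c (c + h)) (I (a + h) (a + h + h) (c + h) (c + h + h))).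
  lra.
Qed.

Lemma sq_step n : (fst (sq n) <= fst (sq (S n)) /\ fst (sq (S n)) + half (S n) <= fst (sq n) + half n)
 /\ (snd (sq n) <= snd (sq (S n)) /\ snd (sq (S n)) + half (S n) <= snd (sq n) + half n).
Proof.
change (sq (S n)) with (next (half (S n)) (eta0 * (half (S n) * half (S n))) (sq n)).
assert (Hp := half_pos (S n)). rewrite (half_S n). set (h := half (S n)) in *.
destruct (sq n) as [a c]. unfold next.
repeat destruct Rle_dec; simpl; lra.
Qed.

Lemma nested_limit (u : nat -> R) :
  (forall n, u n <= u (S n) /\ u (S n) + half (S n) <= u n + half n) ->
  exists x, forall n, u n <= x <= u n + half n.
Proof.
intros H.
assert (Hm : forall n k, u n <= u (n + k)%nat /\ u (n + k)%nat + half (n + k) <= u n + half n).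
{ intros n k. induction k as [|k IH].
  - rewrite Nat.add_0_r. lra.
  - rewrite Nat.add_succ_r. specialize (H (n + k)%nat). lra. }
assert (Hb : forall m n, u m <= u n + half n).
{ intros m n. destruct (Nat.le_ge_cases m n) as [L|L].
  - destruct (Hm m (n - m)%nat) as [H1 _]. replace (m + (n - m))%nat with n in H1 by lia.
    assert (Hp := half_pos n). lra.
  - destruct (Hm n (m - n)%nat) as [_ H1]. replace (n + (m - n))%nat with m in H1 by lia.
    assert (Hp := half_pos m). lra. }
destruct (completeness (fun y => exists n, y = u n)) as [x [Hx1 Hx2]].
- exists (u 0%nat + half 0). intros y [n ->]. apply Hb.
- exists (u 0%nat), 0%nat. reflexivity.
- exists x. intros n; split.
  + apply Hx1. now exists n.
  + apply Hx2. intros y [m ->]. apply Hb.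
Qed.

(** Some quarter of a square keeps at least a quarter of the modulus, so the nested squares satisfy
    |I| >= [eta0] times the area. At their common point this contradicts [small] with [eta0 / 2]. *)
Lemma bisection : I 0 1 0 1 = RtoC 0.
Proof.
apply Cmod_eq_0. destruct (Rle_lt_or_eq_dec 0 eta0) as [Hpos|E]; [apply Cmod_ge_0| |symmetry; exact E].
exfalso.
destruct (nested_limit (fun n => fst (sq n))) as [x Hx]; [intros n; apply sq_step|].
destruct (nested_limit (fun n => snd (sq n))) as [y Hy]; [intros n; apply sq_step|].
assert (Hx0 := Hx 0%nat). assert (Hy0 := Hy 0%nat). simpl in Hx0, Hy0.
assert (half 0 = 1) by reflexivity.
destruct (small x y (eta0 / 2)) as [d [Hd H1]]; try lra.
assert (Hn : exists n, half n < d).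
{ assert (L := is_lim_seq_geom (/ 2)). rewrite Rabs_pos_eq in L by lra.
  specialize (L ltac:(lra)). apply is_lim_seq_spec in L.
  destruct (L (mkposreal d Hd)) as [N HN]. exists N. specialize (HN N (Nat.le_refl _)).
  simpl in HN. rewrite Rminus_0_r in HN. unfold half. apply Rabs_def2 in HN. lra. }
destruct Hn as [n Hn].
destruct (sq_inv n) as [Ha [Ha' [Hc [Hc' HJ]]]].
assert (Hp := half_pos n).
specialize (H1 (fst (sq n)) (snd (sq n)) (half n) (conj Hp Hn) (Hx n) (Hy n) Ha Ha' Hc Hc').
unfold J in HJ. assert (0 < half n * half n) by now apply Rmult_lt_0_compat. nra.
Qed.

End Bisection.

(** The boundary integral is additive under subdivision of the parameter square. On a small square,
    the affine part of [F] contributes values of a primitive at the four corners, which cancel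
    around the boundary; the remainder is small compared with the area. The map [G] only has to be
    differentiable along the sides, so it may be a homotopy between closed curves. *)
Lemma goursat (F : C -> C) (G Gs Gt : R -> R -> C) (M : R) :
  (forall s t, 0 <= s <= 1 -> 0 <= t <= 1 -> exists l, cder F (G s t) l) ->
  (forall s t, 0 <= s <= 1 -> 0 <= t <= 1 -> rder (fun u => G u t) s (Gs s t)) ->
  (forall s t, 0 <= s <= 1 -> 0 <= t <= 1 -> rder (fun u => G s u) t (Gt s t)) ->
  (forall s t, 0 <= s <= 1 -> 0 <= t <= 1 -> rcont (fun u => Gs u t) s) ->
  (forall s t, 0 <= s <= 1 -> 0 <= t <= 1 -> rcont (fun u => Gt s u) t) ->
  (forall s t, 0 <= s <= 1 -> 0 <= t <= 1 -> Cmod (Gs s t) <= M) ->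
  (forall s t, 0 <= s <= 1 -> 0 <= t <= 1 -> Cmod (Gt s t) <= M) ->
  (CInt (fun t => F (G 1 t) * Gt 1 t) 0 1 - CInt (fun t => F (G 0 t) * Gt 0 t) 0 1
   - (CInt (fun s => F (G s 1) * Gs s 1) 0 1 - CInt (fun s => F (G s 0) * Gs s 0) 0 1) = 0)%C.
Proof.
intros HF Hs Ht Cs Ct Bs Bt.
assert (HM : 0 <= M).
{ eapply Rle_trans; [apply Cmod_ge_0|apply (Bs 0 0); lra]. }
assert (C1 : forall s t, 0 <= s <= 1 -> 0 <= t <= 1 -> rcont (fun u => F (G u t) * Gs u t)%C s).
{ intros s t H1 H2. apply rcont_mult; [|auto]. destruct (HF s t H1 H2) as [l Hl].
  apply (rcont_comp F (fun u => G u t) s l Hl). eapply rder_rcont; auto. }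
assert (C2 : forall s t, 0 <= s <= 1 -> 0 <= t <= 1 -> rcont (fun u => F (G s u) * Gt s u)%C t).
{ intros s t H1 H2. apply rcont_mult; [|auto]. destruct (HF s t H1 H2) as [l Hl].
  apply (rcont_comp F (fun u => G s u) t l Hl). eapply rder_rcont; auto. }
set (I := fun a b c d : R =>
  (CInt (fun t => F (G b t) * Gt b t) c d - CInt (fun t => F (G a t) * Gt a t) c d
   - (CInt (fun s => F (G s d) * Gs s d) a b - CInt (fun s => F (G s c) * Gs s c) a b))%C).
change (I 0 1 0 1 = RtoC 0).
apply bisection.
- intros a m b c d Ha Ham Hmb Hb Hc Hcd Hd. unfold I.
  rewrite (CInt_Chasles (fun s => F (G s d) * Gs s d)%C a m b) by (auto; intros; apply C1; lra).
  rewrite (CInt_Chasles (fun s => F (G s c) * Gs s c)%C a m b) by (auto; intros; apply C1; lra).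
  ring.
- intros a b c m d Ha Hab Hb Hc Hcm Hmd Hd. unfold I.
  rewrite (CInt_Chasles (fun t => F (G b t) * Gt b t)%C c m d) by (auto; intros; apply C2; lra).
  rewrite (CInt_Chasles (fun t => F (G a t) * Gt a t)%C c m d) by (auto; intros; apply C2; lra).
  ring.
- intros x y eps Hx Hy He.
  destruct (HF x y Hx Hy) as [B HB].
  (* Each of the four sides has parameter length h, speed at most M and remainder at most 2 e h M,
     which gives 8 e h^2 M^2 in all. Using 1 + M instead of M avoids a division by zero. *)
  set (e := eps / (8 * (1 + M) * (1 + M))).
  assert (He' : 0 < e) by (unfold e; apply Rdiv_lt_0_compat; nra).
  destruct (HB e He') as [d0 [Hd0 Hd]].
  exists (d0 / (2 * (1 + M))). split; [apply Rdiv_lt_0_compat; lra|].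
  intros a c h [Hh Hhd] Hax Hcy Ha Ha' Hc Hc'.
  assert (Hhd' : h * (2 * (1 + M)) < d0).
  { apply Rmult_lt_compat_r with (r := 2 * (1 + M)) in Hhd; [|lra].
    now replace (d0 / (2 * (1 + M)) * (2 * (1 + M))) with d0 in Hhd by (field; lra). }
  assert (L1 : forall s s' t, a <= s -> s <= s' -> s' <= a + h -> 0 <= t <= 1 ->
    Cmod (G s' t - G s t) <= h * M).
  { intros s s' t H1 H2 H3 H4.
    eapply Rle_trans; [apply (path_Lipschitz (fun u => G u t) (fun u => Gs u t) s s' M); try assumption; intros; try (apply Hs); try apply Cs; try apply Bs; lra|].
    apply Rmult_le_compat_r; lra. }
  assert (L2 : forall s t t', c <= t -> t <= t' -> t' <= c + h -> 0 <= s <= 1 ->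
    Cmod (G s t' - G s t) <= h * M).
  { intros s t t' H1 H2 H3 H4.
    eapply Rle_trans; [apply (path_Lipschitz (fun u => G s u) (fun u => Gt s u) t t' M); try assumption; intros; try (apply Ht); try apply Ct; try apply Bt; lra|].
    apply Rmult_le_compat_r; lra. }
  assert (Sy : forall z w : C, Cmod (z - w) = Cmod (w - z)).
  { intros z w. rewrite <- Cmod_opp. f_equal. ring. }
  assert (L : forall s t, a <= s <= a + h -> c <= t <= c + h ->
    Cmod (G s t - G x y) <= 2 * (h * M)).
  { intros s t H1 H2.
    replace (G s t - G x y)%C with ((G s t - G x t) + (G x t - G x y))%C by ring.
    eapply Rle_trans; [apply Cmod_triangle|].
    assert (Cmod (G s t - G x t) <= h * M).
    { destruct (Rle_dec x s); [apply L1|rewrite Sy; apply L1]; lra. }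
    assert (Cmod (G x t - G x y) <= h * M).
    { destruct (Rle_dec y t); [apply L2|rewrite Sy; apply L2]; lra. }
    lra. }
  assert (K : forall s t, a <= s <= a + h -> c <= t <= c + h ->
    Cmod (F (G s t) - F (G x y) - B * (G s t - G x y)) <= e * (2 * (h * M))).
  { intros s t H1 H2. specialize (L s t H1 H2).
    eapply Rle_trans; [apply Hd; nra|]. apply Rmult_le_compat_l; lra. }
  pose proof (fun s (H1 : a <= s <= a + h) => (path_estimate F (F (G x y)) B (G x y) (fun u => G s u) (fun u => Gt s u) c (c + h)
     (e * (2 * (h * M))) M ltac:(lra) HM ltac:(intros; apply HF; lra) ltac:(intros; apply Ht; lra)
     ltac:(intros; apply Ct; lra) ltac:(intros; apply Bt; lra) ltac:(intros; apply K; lra))) as P1.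
  pose proof (fun t (H1 : c <= t <= c + h) => (path_estimate F (F (G x y)) B (G x y) (fun u => G u t) (fun u => Gs u t) a (a + h)
     (e * (2 * (h * M))) M ltac:(lra) HM ltac:(intros; apply HF; lra) ltac:(intros; apply Hs; lra)
     ltac:(intros; apply Cs; lra) ltac:(intros; apply Bs; lra) ltac:(intros; apply K; lra))) as P2.
  assert (Q1 := P1 (a + h) ltac:(lra)). assert (Q2 := P1 a ltac:(lra)).
  assert (Q3 := P2 (c + h) ltac:(lra)). assert (Q4 := P2 c ltac:(lra)).
  clear P1 P2. cbv beta in Q1, Q2, Q3, Q4. unfold I.
  set (i1 := CInt (fun t => F (G (a + h)%R t) * Gt (a + h)%R t)%C c (c + h)) in *.
  set (i2 := CInt (fun t => F (G a t) * Gt a t)%C c (c + h)) in *.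
  set (i3 := CInt (fun s => F (G s (c + h)%R) * Gs s (c + h)%R)%C a (a + h)) in *.
  set (i4 := CInt (fun s => F (G s c) * Gs s c)%C a (a + h)) in *.
  match type of Q1 with Cmod ?X <= _ => set (q1 := X) in * end.
  match type of Q2 with Cmod ?X <= _ => set (q2 := X) in * end.
  match type of Q3 with Cmod ?X <= _ => set (q3 := X) in * end.
  match type of Q4 with Cmod ?X <= _ => set (q4 := X) in * end.
  (* Each corner value of the primitive occurs twice with opposite signs, so [ring] eliminates all
     of them. *)
  replace (i1 - i2 - (i3 - i4))%C with ((q1 + (- q2)) + ((- q3) + q4))%C.
  2:{ unfold q1, q2, q3, q4; ring. }
  eapply Rle_trans; [apply Cmod_triangle|].
  assert (T1 := Cmod_triangle q1 (- q2)). assert (T2 := Cmod_triangle (- q3) q4).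
  rewrite Cmod_opp in T1, T2.
  assert (E : eps * (h * h) = 8 * (e * ((1 + M) * (1 + M))) * (h * h)).
  { unfold e. field. lra. }
  replace (c + h - c) with h in * by ring. replace (a + h - a) with h in * by ring.
  assert (e * (M * M) <= e * ((1 + M) * (1 + M))) by (apply Rmult_le_compat_l; nra).

  rewrite E. nra.
Qed.

(** * Cauchy's formula *)

Definition circ (t : R) : C := Cexp (RtoC (2 * PI) * Ci * RtoC t)%C.

Definition twopii : C := (RtoC (2 * PI) * Ci)%C.

Lemma twopii_neq_0 : twopii <> 0.
Proof.
unfold twopii. apply Cmult_neq_0; [|apply Ci_nz].
intros E. apply RtoC_inj in E. generalize PI_RGT_0. lra.
Qed.

Lemma Cmod_circ t : Cmod (circ t) = 1.
Proof.
unfold circ. rewrite Cmod_Cexp. rewrite <- exp_0. f_equal. simpl. ring.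
Qed.

Lemma circ_neq_0 t : circ t <> 0.
Proof. apply Cexp_neq_0. Qed.

Lemma circ_0 : circ 0 = 1.
Proof. unfold circ. rewrite Cmult_0_r. apply Cexp_0. Qed.

Lemma circ_1 : circ 1 = 1.
Proof.
unfold circ. replace (RtoC (2 * PI) * Ci * RtoC 1)%C with ((0, 2 * PI)%R : C).
2:{ apply injective_projections; simpl; ring. }
unfold Cexp; simpl. rewrite exp_0, cos_2PI, sin_2PI.
apply injective_projections; simpl; ring.
Qed.

Lemma rder_id t : rder RtoC t 1.
Proof.
intros eps He. exists 1; split; [lra|]. intros u _.
replace (RtoC u - RtoC t - 1 * RtoC (u - t))%C with (RtoC 0).
- rewrite Cmod_0. apply Rmult_le_pos; [lra|apply Rabs_pos].
- rewrite RtoC_minus. ring.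
Qed.

Lemma rder_of_cder f t l : cder f (RtoC t) l -> rder (fun u => f (RtoC u)) t l.
Proof.
intros H. replace l with (l * 1)%C by ring. apply (rder_comp f RtoC); [exact H|apply rder_id].
Qed.

Lemma rder_circ t : rder circ t (twopii * circ t)%C.
Proof.
apply (rder_of_cder (fun z => Cexp (RtoC (2 * PI) * Ci * z)%C)).
apply (cder_comp Cexp (fun z => RtoC (2 * PI) * Ci * z)%C); [apply cder_Cexp|].
apply cder_linear.
Qed.

Lemma rcont_circ t : rcont circ t.
Proof. eapply rder_rcont, rder_circ. Qed.

Lemma rder_plus_const a g t l : rder g t l -> rder (fun u => a + g u)%C t l.
Proof.
intros H eps He. destruct (H eps He) as [d [Hd Hw]]. exists d; split; [exact Hd|].
intros u Hu. specialize (Hw u Hu).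
now replace (a + g u - (a + g t))%C with (g u - g t)%C by ring.
Qed.

Lemma rder_scal a g t l : rder g t l -> rder (fun u => a * g u)%C t (a * l)%C.
Proof.
intros H.
apply (rder_comp (fun z => a * z)%C g t a l); [|exact H].
apply cder_linear.
Qed.

Lemma CInt_ext f g a b : a <= b -> (forall t, a <= t <= b -> f t = g t) -> CInt f a b = CInt g a b.
Proof.
intros Hab H. apply (@RInt_ext C_R_CompleteNormedModule).
rewrite Rmin_left, Rmax_right by exact Hab. intros; apply H; lra.
Qed.

(** The integral takes values in a real module, so a complex factor is treated by components. *)
Lemma is_CInt_scal c g a b I : @is_RInt C_R_NormedModule g a b I ->
  @is_RInt C_R_NormedModule (fun t => c * g t)%C a b (c * I)%C.
Proof.
intros X.
assert (A1 := is_RInt_fct_extend_fst g a b I X).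
assert (A2 := is_RInt_fct_extend_snd g a b I X).
refine (@is_RInt_fct_extend_pair R_NormedModule R_NormedModule _ a b _ _ _ _).
- apply (@is_RInt_minus R_NormedModule (fun t => fst c * fst (g t)) (fun t => snd c * snd (g t))).
  + exact (@is_RInt_scal R_NormedModule _ a b (fst c) _ A1).
  + exact (@is_RInt_scal R_NormedModule _ a b (snd c) _ A2).
- apply (@is_RInt_plus R_NormedModule (fun t => fst c * snd (g t)) (fun t => snd c * fst (g t))).
  + exact (@is_RInt_scal R_NormedModule _ a b (fst c) _ A2).
  + exact (@is_RInt_scal R_NormedModule _ a b (snd c) _ A1).
Qed.

Section Cauchy.

Variables (f : C -> C) (z0 : C) (R0 : R).
Hypothesis Hf : forall z, Cmod (z - z0) < R0 -> exists l, cder f z l.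

(** [goursat] for the homotopy that moves the centre from [w] to [z0] and the radius from [eps] to
    [r], both linearly. Every intermediate circle stays at distance at least rho(s) - s |w - z0| >=
    [eps] from the pole [w]. On the small circle the kernel cancels and only f dt is left. *)
Lemma circle_homotopy r eps w : 0 < r < R0 -> 0 < eps -> Cmod (w - z0) + eps <= r ->
  CInt (fun t => f (z0 + RtoC r * circ t) / (z0 + RtoC r * circ t - w)
                 * (RtoC r * circ t))%C 0 1
  = CInt (fun t => f (w + RtoC eps * circ t))%C 0 1.
Proof.
intros [Hr0 Hr] He Hw.
set (rho := fun s => (eps + (r - eps) * s)).
set (G := fun s t => (w + RtoC s * (z0 - w) + RtoC (rho s) * circ t)%C).
set (Gs := fun (s t : R) => ((z0 - w) + RtoC (r - eps) * circ t)%C).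
set (Gt := fun s t => (RtoC (rho s) * (twopii * circ t))%C).
set (F := fun z => (f z / (twopii * (z - w)))%C).
assert (Hwz := Cmod_ge_0 (w - z0)).
assert (Sy : Cmod (z0 - w) = Cmod (w - z0)).
{ rewrite <- Cmod_opp. f_equal. ring. }
assert (Hrho : forall s, 0 <= s <= 1 -> 0 <= rho s) by (intros; unfold rho; nra).
assert (Hin : forall s t, 0 <= s <= 1 -> Cmod (G s t - z0) < R0).
{ intros s t Hs. unfold G.
  replace (w + RtoC s * (z0 - w) + RtoC (rho s) * circ t - z0)%C
    with (RtoC (1 - s) * (w - z0) + RtoC (rho s) * circ t)%C
    by (rewrite RtoC_minus; ring).
  eapply Rle_lt_trans; [apply Cmod_triangle|].
  rewrite !Cmod_mult, !Cmod_R, Cmod_circ, !Rabs_pos_eq by (try apply Hrho; lra).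
  unfold rho. nra. }
assert (Hne : forall s t, 0 <= s <= 1 -> (G s t - w)%C <> 0).
{ intros s t Hs. apply Cmod_gt_0. unfold G.
  replace (w + RtoC s * (z0 - w) + RtoC (rho s) * circ t - w)%C
    with (RtoC (rho s) * circ t - (RtoC s * (w - z0)))%C by ring.
  eapply Rlt_le_trans; [|apply Cmod_triangle_rev].
  rewrite !Cmod_mult, !Cmod_R, Cmod_circ, !Rabs_pos_eq by (try apply Hrho; lra).
  unfold rho. nra. }
assert (HM1 : forall s t, 0 <= s <= 1 -> 0 <= t <= 1 -> Cmod (Gs s t) <= (r + 1) * (1 + 2 * PI) + r).
{ intros s t _ _. unfold Gs. eapply Rle_trans; [apply Cmod_triangle|].
  rewrite Sy, Cmod_mult, Cmod_R, Cmod_circ.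
  rewrite Rabs_pos_eq by lra. generalize PI_RGT_0. nra. }
assert (HM2 : forall s t, 0 <= s <= 1 -> 0 <= t <= 1 -> Cmod (Gt s t) <= (r + 1) * (1 + 2 * PI) + r).
{ intros s t Hs _. unfold Gt, twopii. rewrite !Cmod_mult, !Cmod_R, Cmod_circ, Cmod_Ci.
  generalize PI_RGT_0; intros HPI.
  rewrite !Rabs_pos_eq by (try apply Hrho; lra).
  assert (rho s <= r) by (unfold rho; nra). specialize (Hrho s Hs). nra. }
assert (Hg := goursat F G Gs Gt ((r + 1) * (1 + 2 * PI) + r)).
(* The circles are closed, so the sides t = 0 and t = 1 carry the same integral. *)
assert (E1 : CInt (fun s => F (G s 1) * Gs s 1)%C 0 1 = CInt (fun s => F (G s 0) * Gs s 0)%C 0 1).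
{ apply CInt_ext; [lra|]. intros s _. unfold G, Gs. now rewrite circ_1, circ_0. }
rewrite E1 in Hg.
assert (Hg' : (CInt (fun t => F (G 1 t) * Gt 1 t) 0 1 = CInt (fun t => F (G 0 t) * Gt 0 t) 0 1)%C).
{ apply Ceq_minus. rewrite <- Hg; auto.
  - ring.
  - intros s t Hs Ht. destruct (Hf _ (Hin s t Hs)) as [l Hl].
    eexists. unfold F. apply cder_div; [apply Cmult_neq_0; [apply twopii_neq_0|apply Hne, Hs]|exact Hl|].
    apply cder_scal, cder_minus; [apply cder_id|apply cder_const].
  - intros s t _ _. unfold G, Gs.
    assert (A := rder_affine (w + RtoC eps * circ t)%C ((z0 - w) + RtoC (r - eps) * circ t)%C s).
    intros e Ee. destruct (A e Ee) as [d [Hd Hd']]. exists d; split; [exact Hd|].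
    intros u Hu. eapply Rle_trans; [right|exact (Hd' u Hu)]. f_equal.
    unfold rho. rewrite !RtoC_plus, !RtoC_mult. ring.
  - intros s t _ _. unfold G, Gt. apply rder_plus_const, rder_scal, rder_circ.
  - intros s t _ _. unfold Gs. apply rcont_const.
  - intros s t _ _. unfold Gt. apply rcont_mult; [apply rcont_const|].
    apply rcont_mult; [apply rcont_const|apply rcont_circ]. }
assert (rho1 : rho 1 = r) by (unfold rho; ring).
assert (rho0 : rho 0 = eps) by (unfold rho; ring).
assert (Hre : RtoC eps <> 0) by (intros E; apply RtoC_inj in E; lra).
transitivity (CInt (fun t => F (G 1 t) * Gt 1 t)%C 0 1).
{ apply CInt_ext; [lra|]. intros t _. generalize (Hne 1 t ltac:(lra)).
  unfold F, G, Gt. rewrite rho1.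
  replace (w + 1 * (z0 - w) + RtoC r * circ t)%C with (z0 + RtoC r * circ t)%C by ring.
  intros Hn. field. split; [exact Hn|apply twopii_neq_0]. }
rewrite Hg'. apply CInt_ext; [lra|]. intros t _. unfold F, G, Gt. rewrite rho0.
replace (w + 0 * (z0 - w) + RtoC eps * circ t)%C with (w + RtoC eps * circ t)%C by ring.
replace (w + RtoC eps * circ t - w)%C with (RtoC eps * circ t)%C by ring.
field. repeat split; [apply circ_neq_0|exact Hre|apply twopii_neq_0].
Qed.

(** By homotopy the integral equals the mean of f over an arbitrarily small circle around [w], and
    continuity brings that mean within any [eta] of f(w). *)
Lemma cauchy_formula r w : 0 < r < R0 -> Cmod (w - z0) < r ->
  f w = CInt (fun t => f (z0 + RtoC r * circ t) / (z0 + RtoC r * circ t - w)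
                 * (RtoC r * circ t))%C 0 1.
Proof.
intros Hr Hw. symmetry. apply Ceq_minus, Cmod_eq_0, Rle_antisym; [|apply Cmod_ge_0].
apply le_epsilon. intros eta Heta. rewrite Rplus_0_l.
destruct (Hf w) as [l Hl]; [lra|].
destruct (cder_continuous f w l Hl eta Heta) as [d [Hd Hc]].
set (eps := Rmin (d / 2) (r - Cmod (w - z0))).
assert (He : 0 < eps) by (apply Rmin_pos; lra).
assert (He1 : eps <= d / 2) by apply Rmin_l.
assert (He2 : eps <= r - Cmod (w - z0)) by apply Rmin_r.
rewrite (circle_homotopy r eps w Hr He) by lra.
assert (B : forall t, Cmod (f (w + RtoC eps * circ t) - f w) <= eta).
{ intros t. left. apply Hc.
  replace (w + RtoC eps * circ t - w)%C with (RtoC eps * circ t)%C by ring.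
  rewrite Cmod_mult, Cmod_circ, Cmod_R, Rabs_pos_eq; lra. }
assert (I1 : @is_RInt C_R_NormedModule (fun t => f (w + RtoC eps * circ t))%C 0 1
   (CInt (fun t => f (w + RtoC eps * circ t))%C 0 1)).
{ apply CInt_correct; [lra|]. intros t _.
  destruct (Hf (w + RtoC eps * circ t)%C) as [m Hm].
  { replace (w + RtoC eps * circ t - z0)%C with ((w - z0) + RtoC eps * circ t)%C by ring.
    eapply Rle_lt_trans; [apply Cmod_triangle|].
    rewrite Cmod_mult, Cmod_circ, Cmod_R, Rabs_pos_eq; lra. }
  apply (rcont_comp f (fun t => w + RtoC eps * circ t)%C t m Hm).
  apply rcont_plus; [apply rcont_const|]. apply rcont_mult; [apply rcont_const|apply rcont_circ]. }
assert (I2 := @is_RInt_const C_R_NormedModule 0 1 (f w)).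
assert (I3 := @is_RInt_minus C_R_NormedModule _ _ 0 1 _ _ I1 I2).
rewrite scal_R_Cmult in I3.
replace (RtoC (1 - 0) * f w)%C with (f w) in I3 by (rewrite Rminus_0_r; ring).
replace eta with ((1 - 0) * eta) by ring.
exact (CInt_bound _ 0 1 _ eta ltac:(lra) (fun t _ => B t) I3).
Qed.


Lemma cder_of_quadratic (g : C -> C) w l d K : 0 < d -> 0 <= K ->
  (forall v, Cmod (v - w) < d -> Cmod (g v - g w - l * (v - w))%C <= K * (Cmod (v - w) * Cmod (v - w))) ->
  cder g w l.
Proof.
intros Hd HK H eps He.
exists (Rmin d (eps / (K + 1))); split.
{ apply Rmin_pos; [exact Hd|apply Rdiv_lt_0_compat; lra]. }
intros v Hv.
assert (H1 := H v (Rlt_le_trans _ _ _ Hv (Rmin_l _ _))).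
assert (H2 := Rlt_le_trans _ _ _ Hv (Rmin_r _ _)).
apply Rmult_lt_compat_r with (r := K + 1) in H2; [|lra].
replace (eps / (K + 1) * (K + 1)) with eps in H2 by (field; lra).
assert (H3 := Cmod_ge_0 (v - w)). nra.
Qed.

(** With zeta on a circle around z0 and G = f(zeta) (zeta - z0), the values n = 1, 2, 3 give f, f'
    and f''/2; the factor 2 pi i is absorbed by the parametrisation. *)
Definition cauchy_int (G zeta : R -> C) (n : nat) (w : C) : C :=
  CInt (fun t => G t / (zeta t - w) ^ n)%C 0 1.

Section CauchyIntegral.

Variables (G zeta : R -> C) (r MG : R).
Hypothesis zeta_circ : forall t, Cmod (zeta t - z0) = r.
Hypothesis HG : forall t, rcont G t.
Hypothesis Hzeta : forall t, rcont zeta t.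
Hypothesis HMG : forall t, 0 <= t <= 1 -> Cmod (G t) <= MG.

Lemma zeta_far w t : r - Cmod (w - z0) <= Cmod (zeta t - w).
Proof.
rewrite <- (zeta_circ t).
replace (zeta t - w)%C with ((zeta t - z0) - (w - z0))%C by ring.
apply Cmod_triangle_rev.
Qed.

Lemma zeta_neq w t : Cmod (w - z0) < r -> (zeta t - w)%C <> 0.
Proof.
intros Hw. apply Cmod_gt_0. generalize (zeta_far w t). lra.
Qed.

Lemma cauchy_int_cont n w t : Cmod (w - z0) < r ->
  rcont (fun t => G t / (zeta t - w) ^ n)%C t.
Proof.
intros Hw. apply rcont_mult; [apply HG|].
destruct n as [|n].
{ simpl. apply rcont_const. }
apply (rcont_comp (fun z => / (z - w) ^ S n)%C zeta t
  ((1 - 0) * (RtoC (INR (S n)) * (zeta t - w) ^ n) * - / ((zeta t - w) ^ S n * (zeta t - w) ^ S n))%C); [|apply Hzeta].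
apply (cder_comp (fun z => / z)%C (fun z => (z - w) ^ S n)%C).
- apply cder_inv. apply Cpow_nz, zeta_neq, Hw.
- apply (cder_comp (fun z => z ^ S n)%C (fun z => z - w)%C).
  + apply cder_pow.
  + apply cder_minus; [apply cder_id|apply cder_const].
Qed.

Lemma is_cauchy_int n w : Cmod (w - z0) < r ->
  @is_RInt C_R_NormedModule (fun t => G t / (zeta t - w) ^ n)%C 0 1 (cauchy_int G zeta n w).
Proof.
intros Hw. apply CInt_correct; [lra|]. intros t _. now apply cauchy_int_cont.
Qed.

Lemma cauchy_int_diff_bound n p (c : C) w v K : Cmod (w - z0) < r -> Cmod (v - z0) < r ->
  (forall t, Cmod (/ (zeta t - v) ^ n - / (zeta t - w) ^ n - c * / (zeta t - w) ^ p)%C <= K) ->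
  Cmod (cauchy_int G zeta n v - cauchy_int G zeta n w - c * cauchy_int G zeta p w)%C <= MG * K.
Proof.
intros Hw Hv HK.
assert (I1 := @is_RInt_minus C_R_NormedModule _ _ 0 1 _ _
  (@is_RInt_minus C_R_NormedModule _ _ 0 1 _ _ (is_cauchy_int n v Hv) (is_cauchy_int n w Hw))
  (is_CInt_scal c _ 0 1 _ (is_cauchy_int p w Hw))).
replace (MG * K) with ((1 - 0) * (MG * K)) by ring.
refine (CInt_bound _ 0 1 _ (MG * K) ltac:(lra) _ I1).
intros t Ht.
change (Cmod (G t / (zeta t - v) ^ n - G t / (zeta t - w) ^ n - c * (G t / (zeta t - w) ^ p))%C <= MG * K).
replace (G t / (zeta t - v) ^ n - G t / (zeta t - w) ^ n - c * (G t / (zeta t - w) ^ p))%C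
 with (G t * (/ (zeta t - v) ^ n - / (zeta t - w) ^ n - c * / (zeta t - w) ^ p))%C by (unfold Cdiv; ring).
rewrite Cmod_mult. apply Rmult_le_compat; auto using Cmod_ge_0.
Qed.

Lemma cauchy_int_geom w v m t : 0 < m -> Cmod (w - z0) + m <= r -> Cmod (v - w) < m / 2 ->
  Cmod (v - z0) < r /\ Cmod (w - z0) < r /\
  (zeta t - v)%C <> 0 /\ (zeta t - w)%C <> 0 /\
  / Cmod (zeta t - w) <= / m /\ / Cmod (zeta t - v) <= 2 * / m.
Proof.
intros Hm Hw Hv.
assert (Hv0 : Cmod (v - z0) <= Cmod (w - z0) + Cmod (v - w)).
{ replace (v - z0)%C with ((w - z0) + (v - w))%C by ring. apply Cmod_triangle. }
assert (H1 : Cmod (v - z0) < r) by lra.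
assert (H2 : Cmod (w - z0) < r) by lra.
assert (A1 := zeta_far w t). assert (A2 := zeta_far v t).
repeat split; auto using zeta_neq.
- apply Rinv_le_contravar; lra.
- replace (2 * / m) with (/ (m / 2)) by (field; lra). apply Rinv_le_contravar; lra.
Qed.

Lemma cauchy_int_1_bound w v m : 0 < m -> Cmod (w - z0) + m <= r ->
  Cmod (v - w) < m / 2 ->
  Cmod (cauchy_int G zeta 1 v - cauchy_int G zeta 1 w
        - (v - w) * cauchy_int G zeta 2 w)%C
  <= MG * (2 * (/ m) ^ 3 * (Cmod (v - w) * Cmod (v - w))).
Proof.
intros Hm Hw Hv.
apply cauchy_int_diff_bound; try apply (cauchy_int_geom w v m 0 Hm Hw Hv).
intros t.
destruct (cauchy_int_geom w v m t Hm Hw Hv) as [_ [_ [Nv [Nw [B1 B2]]]]].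
set (h := (v - w)%C) in *.
replace (/ (zeta t - v) ^ 1 - / (zeta t - w) ^ 1 - h * / (zeta t - w) ^ 2)%C
  with (h * h * (/ (zeta t - v) * (/ (zeta t - w) * / (zeta t - w))))%C.
2:{ unfold h. simpl Cpow. field. auto. }
rewrite !Cmod_mult, !Cmod_inv by assumption.
rewrite Rmult_comm. apply Rmult_le_compat_r; [assert (Q := Cmod_ge_0 h); nra|].
assert (Pv : 0 < / Cmod (zeta t - v)) by now apply Rinv_0_lt_compat, Cmod_gt_0.
assert (Pw : 0 < / Cmod (zeta t - w)) by now apply Rinv_0_lt_compat, Cmod_gt_0.
replace (2 * (/ m) ^ 3) with ((2 * / m) * (/ m * / m)) by ring.
apply Rmult_le_compat; try nra.
Qed.

Lemma cauchy_int_2_bound w v m : 0 < m -> Cmod (w - z0) + m <= r ->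
  Cmod (v - w) < m / 2 ->
  Cmod (cauchy_int G zeta 2 v - cauchy_int G zeta 2 w
        - (2 * (v - w)) * cauchy_int G zeta 3 w)%C
  <= MG * (16 * (/ m) ^ 4 * (Cmod (v - w) * Cmod (v - w))).
Proof.
intros Hm Hw Hv.
apply cauchy_int_diff_bound; try apply (cauchy_int_geom w v m 0 Hm Hw Hv).
intros t.
destruct (cauchy_int_geom w v m t Hm Hw Hv) as [_ [_ [Nv [Nw [B1 B2]]]]].
set (h := (v - w)%C) in *.
(* Exact second-order remainder. Since |h| < m/2, the last factor has modulus at most 4, and the two
   inverses of zeta - v contribute 2 · 2, whence the constant 16. *)
replace (/ (zeta t - v) ^ 2 - / (zeta t - w) ^ 2 - 2 * h * / (zeta t - w) ^ 3)%C
  with (h * h * (/ (zeta t - v) * / (zeta t - v) * (/ (zeta t - w) * / (zeta t - w)) * (3 + - (2 * (h * / (zeta t - w))))))%C.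
2:{ unfold h. simpl Cpow. field. auto. }
rewrite !(Cmod_mult (h * h)), (Cmod_mult h h).
rewrite Rmult_comm. apply Rmult_le_compat_r; [assert (Q := Cmod_ge_0 h); nra|].
rewrite (Cmod_mult _ (3 + _)).
assert (Pv : 0 < / Cmod (zeta t - v)) by now apply Rinv_0_lt_compat, Cmod_gt_0.
assert (Pw : 0 < / Cmod (zeta t - w)) by now apply Rinv_0_lt_compat, Cmod_gt_0.
replace (16 * (/ m) ^ 4) with (((2 * / m) * (2 * / m) * (/ m * / m)) * 4) by ring.
apply Rmult_le_compat; try apply Cmod_ge_0.
- rewrite !Cmod_mult, !Cmod_inv by assumption.
  apply Rmult_le_compat; try nra; apply Rmult_le_compat; nra.
- eapply Rle_trans; [apply Cmod_triangle|].
  rewrite Cmod_opp, !Cmod_mult, Cmod_inv, !Cmod_R, !Rabs_pos_eq by (assumption || lra).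
  assert (Cmod h * / Cmod (zeta t - w) <= (m / 2) * / m).
  { apply Rmult_le_compat; try lra. apply Cmod_ge_0. }
  replace (m / 2 * / m) with (/ 2) in H by (field; lra). lra.
Qed.

Lemma cder_cauchy_int_1 w : Cmod (w - z0) < r ->
  cder (cauchy_int G zeta 1) w (cauchy_int G zeta 2 w).
Proof.
intros Hw. set (m := r - Cmod (w - z0)).
assert (HM : 0 <= MG) by (eapply Rle_trans; [apply Cmod_ge_0|apply (HMG 0); lra]).
assert (Hm : 0 < m) by (unfold m; lra).
assert (Pm : 0 < / m) by now apply Rinv_0_lt_compat.
apply (cder_of_quadratic _ _ _ (m / 2) (MG * (2 * (/ m) ^ 3))); [lra|apply Rmult_le_pos; [lra|]|].
{ assert (0 < (/ m) ^ 3) by now apply pow_lt. lra. }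
intros v Hv. rewrite (Cmult_comm _ (v - w)), Rmult_assoc. apply cauchy_int_1_bound; unfold m in *; lra.
Qed.

Lemma cder_cauchy_int_2 w : Cmod (w - z0) < r ->
  cder (cauchy_int G zeta 2) w (2 * cauchy_int G zeta 3 w)%C.
Proof.
intros Hw. set (m := r - Cmod (w - z0)).
assert (HM : 0 <= MG) by (eapply Rle_trans; [apply Cmod_ge_0|apply (HMG 0); lra]).
assert (Hm : 0 < m) by (unfold m; lra).
assert (Pm : 0 < / m) by now apply Rinv_0_lt_compat.
apply (cder_of_quadratic _ _ _ (m / 2) (MG * (16 * (/ m) ^ 4))); [lra|apply Rmult_le_pos; [lra|]|].
{ assert (0 < (/ m) ^ 4) by now apply pow_lt. lra. }
intros v Hv.
replace (2 * cauchy_int G zeta 3 w * (v - w))%C with (2 * (v - w) * cauchy_int G zeta 3 w)%C by ring.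
rewrite Rmult_assoc. apply cauchy_int_2_bound; unfold m in *; lra.
Qed.

End CauchyIntegral.

Lemma cauchy_int_rep r : 0 < r < R0 ->
  (forall t, rcont (fun t => f (z0 + RtoC r * circ t) * (RtoC r * circ t))%C t) /\
  (forall t, rcont (fun t => z0 + RtoC r * circ t)%C t) /\
  (forall t, Cmod (z0 + RtoC r * circ t - z0) = r) /\
  (forall w, Cmod (w - z0) < r -> f w = cauchy_int (fun t => f (z0 + RtoC r * circ t) * (RtoC r * circ t))%C
     (fun t => z0 + RtoC r * circ t)%C 1 w).
Proof.
intros Hr.
assert (H2 : forall t, Cmod (z0 + RtoC r * circ t - z0) = r).
{ intros t. replace (z0 + RtoC r * circ t - z0)%C with (RtoC r * circ t)%C by ring.
  rewrite Cmod_mult, Cmod_circ, Cmod_R, Rabs_pos_eq; lra. }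
assert (H1 : forall t, rcont (fun t => z0 + RtoC r * circ t)%C t).
{ intros t. apply rcont_plus; [apply rcont_const|]. apply rcont_mult; [apply rcont_const|apply rcont_circ]. }
repeat split; auto.
- intros t. apply rcont_mult.
  + destruct (Hf (z0 + RtoC r * circ t)%C) as [l Hl]; [rewrite H2; lra|].
    apply (rcont_comp f _ t l Hl), H1.
  + apply rcont_mult; [apply rcont_const|apply rcont_circ].
- intros w Hw. rewrite (cauchy_formula r w Hr Hw). unfold cauchy_int.
  apply CInt_ext; [lra|]. intros t _. rewrite Cpow_1_r. unfold Cdiv. ring.
Qed.

Lemma rcont_bounded g : (forall t, rcont g t) -> exists M, forall t, 0 <= t <= 1 -> Cmod (g t) <= M.
Proof.
intros H.
destruct (@bounded_continuity R_AbsRing C_R_NormedModule g 0 1) as [M HM].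
- intros t _. apply rcont_continuous, H.
- exists M. intros t Ht. left. rewrite Cmod_norm. now apply HM.
Qed.

(** Near z0 the derivative coincides with the Cauchy integral with n = 2, whose own derivative is
    explicit. *)
Lemma cder_derive_ball : 0 < R0 -> exists l, cder (C_derive f) z0 l.
Proof.
intros HR.
destruct (cauchy_int_rep (R0 / 2)) as [H1 [H2 [H3 H4]]]; [lra|].
destruct (rcont_bounded _ H1) as [M HG].
set (r := R0 / 2) in *. assert (Hr : 0 < r) by (unfold r; lra).
set (G := fun t => (f (z0 + RtoC r * circ t) * (RtoC r * circ t))%C) in *.
set (zeta := fun t => (z0 + RtoC r * circ t)%C) in *.
exists (2 * cauchy_int G zeta 3 z0)%C.
apply cder_ext_loc with (cauchy_int G zeta 2).
- exists r; split; [exact Hr|]. intros w Hw. symmetry. apply cder_unique.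
  apply cder_ext_loc with (cauchy_int G zeta 1).
  + exists (r - Cmod (w - z0)); split; [lra|]. intros v Hv. symmetry. apply H4.
    replace (v - z0)%C with ((v - w) + (w - z0))%C by ring.
    eapply Rle_lt_trans; [apply Cmod_triangle|]. lra.
  + apply (cder_cauchy_int_1 G zeta r M); auto.
- apply (cder_cauchy_int_2 G zeta r M); auto.
  replace (z0 - z0)%C with (RtoC 0) by ring. now rewrite Cmod_0.
Qed.

(** The constant is linear in [M] and otherwise depends on the radius alone, so such estimates can
    be summed over a series. It comes from the circle of radius R0/2. *)
Lemma cauchy_estimate M : 0 < R0 -> (forall z, Cmod (z - z0) < R0 -> Cmod (f z) <= M) ->
  forall w, Cmod (w - z0) < R0 / 4 ->
  Cmod (f w - f z0 - C_derive f z0 * (w - z0))%C <= M * (8 * (/ R0) ^ 2) * (Cmod (w - z0) * Cmod (w - z0)).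
Proof.
intros HR HM w Hw.
destruct (cauchy_int_rep (R0 / 2)) as [H1 [H2 [H3 H4]]]; [lra|].
set (r := R0 / 2) in *. assert (Hr : 0 < r) by (unfold r; lra).
set (G := fun t => (f (z0 + RtoC r * circ t) * (RtoC r * circ t))%C) in *.
set (zeta := fun t => (z0 + RtoC r * circ t)%C) in *.
assert (HG : forall t, 0 <= t <= 1 -> Cmod (G t) <= M * r).
{ intros t _. unfold G. rewrite !Cmod_mult, Cmod_circ, Cmod_R, Rabs_pos_eq, Rmult_1_r by lra.
  apply Rmult_le_compat_r; [lra|]. apply HM. rewrite H3. unfold r; lra. }
assert (E0 : Cmod (z0 - z0) = 0).
{ replace (z0 - z0)%C with (RtoC 0) by ring. apply Cmod_0. }
assert (E : C_derive f z0 = cauchy_int G zeta 2 z0).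
{ apply cder_unique. apply cder_ext_loc with (cauchy_int G zeta 1).
  - exists r; split; [exact Hr|]. intros v Hv. symmetry. now apply H4.
  - apply (cder_cauchy_int_1 G zeta r (M * r)); auto. lra. }
rewrite E, (H4 w), (H4 z0) by (unfold r; lra).
rewrite (Cmult_comm (cauchy_int G zeta 2 z0)).
eapply Rle_trans; [apply (cauchy_int_1_bound G zeta r (M * r) H3 H1 H2 HG z0 w r); unfold r in *; lra|].
right. unfold r. field. lra.
Qed.

End Cauchy.

(** * Complex series *)

Definition Clim (u : nat -> C) (l : C) : Prop :=
  forall eps : R, 0 < eps -> exists N : nat, forall n, (N <= n)%nat -> Cmod (u n - l)%C < eps.

(** Sums over i < n, so that the empty sum exists; [sum_n] includes the index n. *)
Fixpoint Csum (u : nat -> C) (n : nat) : C :=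
  match n with O => RtoC 0 | S m => (Csum u m + u m)%C end.

Fixpoint Rsum (u : nat -> R) (n : nat) : R :=
  match n with O => 0 | S m => Rsum u m + u m end.

Lemma Clim_filterlim u l : Clim u l <-> filterlim u eventually (Clocally l).
Proof. symmetry. apply (filterlim_Cmod eventually u l). Qed.

Lemma Clim_const c : Clim (fun _ => c) c.
Proof. apply Clim_filterlim, (@filterlim_const nat (AbsRing_UniformSpace C_AbsRing) eventually _). Qed.

Lemma Clim_ext_from N0 u v l : (forall n, (N0 <= n)%nat -> u n = v n) -> Clim u l -> Clim v l.
Proof.
rewrite !Clim_filterlim. intros E. apply filterlim_ext_loc. exists N0. exact E.
Qed.

Lemma Clim_ext u v l : (forall n, u n = v n) -> Clim u l -> Clim v l.
Proof. intros E. apply (Clim_ext_from 0). auto. Qed.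

Lemma Clim_plus u v l m : Clim u l -> Clim v m -> Clim (fun n => u n + v n)%C (l + m)%C.
Proof. rewrite !Clim_filterlim. apply (filterlim_C_plus eventually). Qed.

Lemma Clim_mult u v l m : Clim u l -> Clim v m -> Clim (fun n => u n * v n)%C (l * m)%C.
Proof. rewrite !Clim_filterlim. apply (filterlim_C_mult eventually). Qed.

Lemma Clim_scal c u l : Clim u l -> Clim (fun n => c * u n)%C (c * l)%C.
Proof. apply Clim_mult, Clim_const. Qed.

Lemma Clim_opp u l : Clim u l -> Clim (fun n => - u n)%C (- l)%C.
Proof.
intros H. replace (- l)%C with (- (1) * l)%C by ring.
apply (Clim_ext (fun n => - (1) * u n)%C); [intros; ring|]. now apply Clim_scal.
Qed.

Lemma Clim_minus u v l m : Clim u l -> Clim v m -> Clim (fun n => u n - v n)%C (l - m)%C.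
Proof. intros H1 H2. apply Clim_plus; [exact H1|now apply Clim_opp]. Qed.

Lemma Clim_cder f u l d : cder f l d -> Clim u l -> Clim (fun n => f (u n)) (f l).
Proof. rewrite !Clim_filterlim. apply filterlim_cder. Qed.

Lemma Clim_le u l M : Clim u l -> (forall n, Cmod (u n) <= M) -> Cmod l <= M.
Proof.
intros H HM. apply le_epsilon. intros e He. destruct (H e He) as [N HN].
specialize (HN N (Nat.le_refl _)). specialize (HM N).
replace l with (u N - (u N - l))%C by ring.
unfold Cminus at 1. eapply Rle_trans; [apply Cmod_triangle|]. rewrite Cmod_opp. lra.
Qed.

Lemma Clim_unique u l m : Clim u l -> Clim u m -> l = m.
Proof.
rewrite !Clim_filterlim.
apply (@filterlim_locally_unique nat C_AbsRing (AbsRing_NormedModule C_AbsRing) eventually _ u).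
Qed.

Lemma Clim_S u l : Clim u l -> Clim (fun n => u (S n)) l.
Proof.
intros H e He. destruct (H e He) as [N HN]. exists N. intros n Hn. apply HN. lia.
Qed.

Lemma Clim_of_S u l : Clim (fun n => u (S n)) l -> Clim u l.
Proof.
intros H e He. destruct (H e He) as [N HN]. exists (S N). intros [|n] Hn; [lia|]. apply HN. lia.
Qed.

Lemma Clim_squeeze u l b : (forall n, Cmod (u n - l)%C <= b n) -> is_lim_seq b 0 -> Clim u l.
Proof.
intros H Hb e He. apply is_lim_seq_spec in Hb. destruct (Hb (mkposreal e He)) as [N HN].
exists N. intros n Hn. eapply Rle_lt_trans; [apply H|]. specialize (HN n Hn). simpl in HN.
rewrite Rminus_0_r in HN. eapply Rle_lt_trans; [apply Rle_abs|exact HN].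
Qed.

Lemma Csum_ext u v n : (forall i, (i < n)%nat -> u i = v i) -> Csum u n = Csum v n.
Proof.
induction n as [|n IH]; intros H; [reflexivity|]. simpl. rewrite IH, H; auto.
Qed.

Lemma Csum_plus u v n : Csum (fun i => u i + v i)%C n = (Csum u n + Csum v n)%C.
Proof. induction n as [|n IH]; simpl; [ring|]. rewrite IH. ring. Qed.

Lemma Csum_scal c u n : Csum (fun i => c * u i)%C n = (c * Csum u n)%C.
Proof. induction n as [|n IH]; simpl; [ring|]. rewrite IH. ring. Qed.

Lemma Csum_S_l u n : Csum u (S n) = (u 0%nat + Csum (fun i => u (S i)) n)%C.
Proof. induction n as [|n IH]; [simpl; ring|]. change (Csum u (S (S n))) with (Csum u (S n) + u (S n))%C. rewrite IH. simpl. ring. Qed.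

Lemma Csum_add u n m : Csum u (n + m) = (Csum u n + Csum (fun i => u (n + i)%nat) m)%C.
Proof.
induction m as [|m IH]; [rewrite Nat.add_0_r; simpl; ring|].
rewrite Nat.add_succ_r. simpl. rewrite IH. ring.
Qed.

Lemma Csum_0 n : Csum (fun _ => RtoC 0) n = 0.
Proof. induction n as [|n IH]; simpl; [reflexivity|]. rewrite IH. ring. Qed.

Lemma Cmod_Csum u M n : (forall i, Cmod (u i) <= M i) -> Cmod (Csum u n) <= Rsum M n.
Proof.
intros H. induction n as [|n IH]; simpl; [rewrite Cmod_0; lra|].
eapply Rle_trans; [apply Cmod_triangle|]. specialize (H n). lra.
Qed.

Lemma Rsum_sum_n u n : sum_n u n = Rsum u (S n).
Proof.
induction n as [|n IH].
- rewrite sum_O. symmetry. apply Rplus_0_l.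
- rewrite sum_Sn, IH. reflexivity.
Qed.

Lemma Rsum_lim M : ex_series M -> is_lim_seq (Rsum M) (Series M).
Proof.
intros H. apply is_lim_seq_incr_1. apply is_lim_seq_ext with (sum_n M).
- intros n. apply Rsum_sum_n.
- now apply Series_correct.
Qed.

Lemma Rsum_le_Series M n : (forall i, 0 <= M i) -> ex_series M -> Rsum M n <= Series M.
Proof.
intros HM H.
apply (is_lim_seq_incr_compare (Rsum M)); [now apply Rsum_lim|].
intros k. simpl. specialize (HM k). lra.
Qed.

Lemma Csum_Re u n : Re (Csum u (S n)) = sum_n (fun n => Re (u n)) n.
Proof.
induction n as [|n IH].
- rewrite sum_O. apply Rplus_0_l.
- rewrite sum_Sn, <- IH. exact (re_plus (Csum u (S n)) (u (S n))).
Qed.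

Lemma Csum_Im u n : Im (Csum u (S n)) = sum_n (fun n => Im (u n)) n.
Proof.
induction n as [|n IH].
- rewrite sum_O. apply Rplus_0_l.
- rewrite sum_Sn, <- IH. exact (im_plus (Csum u (S n)) (u (S n))).
Qed.

Definition is_CSeries (u : nat -> C) (l : C) : Prop := Clim (Csum u) l.

Lemma CSeries_unique u l : is_CSeries u l -> CSeries u = l.
Proof.
intros H. apply Clim_S in H.
assert (Hr : is_lim_seq (sum_n (fun n => Re (u n))) (Re l)).
{ apply is_lim_seq_spec. intros e. destruct (H e (cond_pos e)) as [N HN]. exists N. intros n Hn.
  eapply Rle_lt_trans; [|apply (HN n Hn)]. rewrite <- Csum_Re.
  replace (Re (Csum u (S n)) - Re l) with (Re (Csum u (S n) - l)%C) by (unfold Cminus; now rewrite re_plus, re_opp).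
  apply re_le_Cmod. }
assert (Hi : is_lim_seq (sum_n (fun n => Im (u n))) (Im l)).
{ apply is_lim_seq_spec. intros e. destruct (H e (cond_pos e)) as [N HN]. exists N. intros n Hn.
  eapply Rle_lt_trans; [|apply (HN n Hn)]. rewrite <- Csum_Im.
  replace (Im (Csum u (S n)) - Im l) with (Im (Csum u (S n) - l)%C) by (unfold Cminus; now rewrite im_plus, im_opp).
  apply im_le_Cmod. }
unfold CSeries. apply Ceq; unfold Re at 1, Im at 1; simpl; now apply is_series_unique.
Qed.

Definition dominated (u : nat -> C) (M : nat -> R) : Prop :=
  ex_series M /\ forall n, Cmod (u n) <= M n.

Lemma dominated_pos u M : dominated u M -> forall n, 0 <= M n.
Proof. intros [_ H] n. eapply Rle_trans; [apply Cmod_ge_0|apply H]. Qed.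

Lemma CSeries_correct u M : dominated u M -> is_CSeries u (CSeries u).
Proof.
intros [HM H].
assert (Hr : ex_series (fun n => Re (u n))).
{ apply (ex_series_le (fun n => Re (u n)) M); [|exact HM]. intros n.
  eapply Rle_trans; [apply re_le_Cmod|apply H]. }
assert (Hi : ex_series (fun n => Im (u n))).
{ apply (ex_series_le (fun n => Im (u n)) M); [|exact HM]. intros n.
  eapply Rle_trans; [apply im_le_Cmod|apply H]. }
apply Clim_of_S. intros e He.
apply Series_correct in Hr. apply Series_correct in Hi.
apply (is_lim_seq_spec (sum_n (fun n => Re (u n))) (Series _)) in Hr.
apply (is_lim_seq_spec (sum_n (fun n => Im (u n))) (Series _)) in Hi.
destruct (Hr (mkposreal (e / 2) ltac:(lra))) as [N1 H1].
destruct (Hi (mkposreal (e / 2) ltac:(lra))) as [N2 H2].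
exists (max N1 N2). intros n Hn. specialize (H1 n ltac:(lia)). specialize (H2 n ltac:(lia)).
simpl in H1, H2. rewrite <- Csum_Re in H1. rewrite <- Csum_Im in H2.
eapply Rle_lt_trans; [apply Cmod_le_abs|].
unfold Cminus. rewrite re_plus, im_plus, re_opp, im_opp.
change (Re (CSeries u)) with (Series (fun n => Re (u n))).
change (Im (CSeries u)) with (Series (fun n => Im (u n))).
unfold Rminus in H1, H2. lra.
Qed.

Lemma CSeries_tail u M N : dominated u M ->
  Cmod (CSeries u - Csum u N)%C <= Series M - Rsum M N.
Proof.
intros H. assert (Hp := dominated_pos u M H).
assert (L : Clim (fun n => Csum (fun i => u (N + i)%nat) n) (CSeries u - Csum u N)%C).
{ apply (Clim_ext (fun n => Csum u (N + n) - Csum u N)%C).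
  - intros n. rewrite Csum_add. ring.
  - apply Clim_minus; [|apply Clim_const].
    intros e He. destruct (CSeries_correct u M H e He) as [K HK].
    exists K. intros n Hn. apply HK. lia. }
apply (Clim_le _ _ _ L). intros n.
eapply Rle_trans; [apply (Cmod_Csum _ (fun i => M (N + i)%nat)); intros; apply H|].
assert (E : forall k, Rsum (fun i => M (N + i)%nat) k = Rsum M (N + k) - Rsum M N).
{ induction k as [|k IH]; [rewrite Nat.add_0_r; simpl; ring|]. rewrite Nat.add_succ_r. simpl. rewrite IH. ring. }
rewrite E. assert (X := Rsum_le_Series M (N + n) Hp (proj1 H)). lra.
Qed.

Lemma Cmod_CSeries u M : dominated u M -> Cmod (CSeries u) <= Series M.
Proof.
intros H. generalize (CSeries_tail u M 0 H). simpl.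
replace (CSeries u - 0)%C with (CSeries u) by ring. lra.
Qed.

Lemma CSeries_ext u v : (forall n, u n = v n) -> CSeries u = CSeries v.
Proof.
intros H. unfold CSeries. f_equal; apply Series_ext; intros; now rewrite H.
Qed.

Lemma is_CSeries_plus u v l m : is_CSeries u l -> is_CSeries v m ->
  is_CSeries (fun n => u n + v n)%C (l + m)%C.
Proof.
intros H1 H2. unfold is_CSeries. eapply Clim_ext; [intros n; symmetry; apply Csum_plus|].
now apply Clim_plus.
Qed.

Lemma is_CSeries_scal c u l : is_CSeries u l -> is_CSeries (fun n => c * u n)%C (c * l)%C.
Proof.
intros H1. unfold is_CSeries. eapply Clim_ext; [intros n; symmetry; apply Csum_scal|].
now apply Clim_scal.
Qed.

Lemma is_CSeries_ext u v l : (forall n, u n = v n) -> is_CSeries u l -> is_CSeries v l.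
Proof. intros E. apply Clim_ext. intros n. apply Csum_ext. auto. Qed.

Lemma is_CSeries_opp u l : is_CSeries u l -> is_CSeries (fun n => - u n)%C (- l)%C.
Proof.
intros H. replace (- l)%C with (- (1) * l)%C by ring.
apply (is_CSeries_ext (fun n => - (1) * u n)%C); [intros; ring|]. now apply is_CSeries_scal.
Qed.

Lemma is_CSeries_minus u v l m : is_CSeries u l -> is_CSeries v m ->
  is_CSeries (fun n => u n - v n)%C (l - m)%C.
Proof. intros. apply is_CSeries_plus; [assumption|now apply is_CSeries_opp]. Qed.

Lemma is_CSeries_shift u l : is_CSeries (fun n => u (S n)) l -> is_CSeries u (u 0%nat + l)%C.
Proof.
intros H. apply Clim_of_S. eapply Clim_ext; [intros n; symmetry; apply Csum_S_l|].
apply Clim_plus; [apply Clim_const|exact H].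
Qed.

Lemma is_CSeries_finite u N : (forall n, (N <= n)%nat -> u n = RtoC 0) -> is_CSeries u (Csum u N).
Proof.
intros H. apply (Clim_ext_from N (fun _ => Csum u N)); [|apply Clim_const].
intros n Hn. replace n with (N + (n - N))%nat by lia. rewrite Csum_add.
rewrite (Csum_ext (fun i => u (N + i)%nat) (fun _ => RtoC 0)).
- rewrite Csum_0. ring.
- intros i _. apply H. lia.
Qed.

(** Dominated convergence for series: beyond a common index both tails are bounded by the tail of
    [M], and the finite parts converge termwise. *)
Theorem tannery (a : nat -> nat -> C) (b : nat -> C) (M : nat -> R) :
  (forall p, dominated (a p) M) -> (forall n, Clim (fun p => a p n) (b n)) ->
  Clim (fun p => CSeries (a p)) (CSeries b) /\ dominated b M.
Proof.
intros H Hb.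
assert (Hd : dominated b M).
{ split; [apply (H 0%nat)|]. intros n. apply (Clim_le _ _ _ (Hb n)). intros p. apply H. }
split; [|exact Hd].
intros e He.
assert (L := Rsum_lim M (proj1 Hd)). apply is_lim_seq_spec in L.
destruct (L (mkposreal (e / 3) ltac:(lra))) as [N HN]. specialize (HN N (Nat.le_refl _)). simpl in HN.
apply Rabs_def2 in HN.
assert (F : Clim (fun p => Csum (a p) N) (Csum b N)).
{ clear -Hb. induction N as [|N IH]; simpl; [apply Clim_const|]. now apply Clim_plus. }
destruct (F (e / 3) ltac:(lra)) as [P HP]. exists P. intros p Hp. specialize (HP p Hp).
assert (T1 := CSeries_tail (a p) M N (H p)). assert (T2 := CSeries_tail b M N Hd).
replace (CSeries (a p) - CSeries b)%C with
 ((CSeries (a p) - Csum (a p) N) + ((Csum (a p) N - Csum b N) + - (CSeries b - Csum b N)))%C by ring.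
eapply Rle_lt_trans; [apply Cmod_triangle|].
eapply Rle_lt_trans; [apply Rplus_le_compat_l, Cmod_triangle|]. rewrite Cmod_opp. lra.
Qed.

Lemma ex_series_scal_R c (M : nat -> R) : ex_series M -> ex_series (fun n => c * M n).
Proof. intros H. exact (ex_series_scal_l c M H). Qed.

Lemma Series_pos M : (forall n, 0 <= M n) -> ex_series M -> 0 <= Series M.
Proof. intros H1 H2. exact (Rsum_le_Series M 0 H1 H2). Qed.

(** Finite sums over n commute with the series over m; [tannery], with the majorant
    [Series N * M m], takes them to the limit. *)
Theorem CSeries_swap (a : nat -> nat -> C) (M N : nat -> R) :
  ex_series M -> ex_series N -> (forall m n, Cmod (a m n) <= M m * N n) ->
  (forall m, 0 <= M m) -> (forall n, 0 <= N n) ->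
  CSeries (fun m => CSeries (fun n => a m n)) = CSeries (fun n => CSeries (fun m => a m n)).
Proof.
intros HM HN H PM PN.
assert (D1 : forall m, dominated (fun n => a m n) (fun n => M m * N n)).
{ intros m. split; [now apply ex_series_scal_R|auto]. }
assert (D2 : forall n, dominated (fun m => a m n) (fun m => N n * M m)).
{ intros n. split; [now apply ex_series_scal_R|]. intros m. rewrite Rmult_comm. auto. }
assert (E : forall p, CSeries (fun m => Csum (fun n => a m n) p) = Csum (fun n => CSeries (fun m => a m n)) p).
{ intros p. apply CSeries_unique. induction p as [|p IH].
  - apply (is_CSeries_ext (fun _ => RtoC 0)); [reflexivity|].
    unfold is_CSeries. eapply Clim_ext; [intros; symmetry; apply Csum_0|apply Clim_const].
  - simpl. apply is_CSeries_plus; [exact IH|]. exact (CSeries_correct _ _ (D2 p)). }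
assert (T : Clim (fun p => CSeries (fun m => Csum (fun n => a m n) p)) (CSeries (fun m => CSeries (fun n => a m n)))).
{ apply (tannery (fun p m => Csum (fun n => a m n) p) _ (fun m => Series N * M m)).
  - intros p. split; [now apply ex_series_scal_R|]. intros m.
    eapply Rle_trans; [apply (Cmod_Csum _ (fun n => M m * N n)); auto|].
    assert (E2 : Rsum (fun n => M m * N n) p = M m * Rsum N p).
    { clear. induction p as [|p IH]; simpl; [ring|]. rewrite IH. ring. }
    rewrite E2, (Rmult_comm (Series N)). apply Rmult_le_compat_l; [auto|]. now apply Rsum_le_Series.
  - intros m. exact (CSeries_correct _ _ (D1 m)). }
symmetry. apply CSeries_unique. unfold is_CSeries. eapply Clim_ext; [|exact T]. exact E.
Qed.

(** The quadratic remainders of the terms are proportional to [M n] with one common factor, so their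
    sum is a quadratic remainder for the series. *)
Theorem weierstrass (f : nat -> C -> C) (z0 : C) (R0 : R) (M : nat -> R) :
  0 < R0 -> (forall n z, Cmod (z - z0) < R0 -> exists l, cder (f n) z l) ->
  (forall n z, Cmod (z - z0) < R0 -> Cmod (f n z) <= M n) -> ex_series M ->
  cder (fun z => CSeries (fun n => f n z)) z0 (CSeries (fun n => C_derive (f n) z0)).
Proof.
intros HR Hf HM HMs.
assert (E0 : Cmod (z0 - z0) < R0).
{ replace (z0 - z0)%C with (RtoC 0) by ring. now rewrite Cmod_0. }
assert (PM : forall n, 0 <= M n).
{ intros n. eapply Rle_trans; [apply Cmod_ge_0|apply (HM n z0 E0)]. }
assert (Hi : 0 < / R0) by now apply Rinv_0_lt_compat.
set (K := 8 * (/ R0) ^ 2). assert (HK : 0 < K) by (unfold K; simpl; nra).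
assert (Est := fun n => cauchy_estimate (f n) z0 R0 (Hf n) (M n) HR (HM n)). fold K in Est.
(* Bounds the derivatives at [z0] in terms of [M]: the quadratic estimate is read at a point at
   distance R0/8 and solved for the derivative. *)
set (K2 := (2 + K * (R0 / 8 * (R0 / 8))) * / (R0 / 8)).
assert (Dl : forall n, Cmod (C_derive (f n) z0) <= K2 * M n).
{ intros n. set (w := (z0 + RtoC (R0 / 8))%C).
  assert (Hw : Cmod (w - z0) = R0 / 8).
  { unfold w. replace (z0 + RtoC (R0 / 8) - z0)%C with (RtoC (R0 / 8)) by ring. rewrite Cmod_R, Rabs_pos_eq; lra. }
  assert (X := Est n w ltac:(lra)). rewrite Hw in X.
  assert (Y1 := HM n w ltac:(lra)). assert (Y2 := HM n z0 E0).
  assert (Z : Cmod (C_derive (f n) z0) * (R0 / 8) <= 2 * M n + M n * K * (R0 / 8 * (R0 / 8))).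
  { rewrite <- Hw at 1. rewrite <- Cmod_mult.
    replace (C_derive (f n) z0 * (w - z0))%C with
      ((f n w + - f n z0) + - (f n w - f n z0 - C_derive (f n) z0 * (w - z0)))%C by ring.
    eapply Rle_trans; [apply Cmod_triangle|]. rewrite Cmod_opp.
    assert (T := Cmod_triangle (f n w) (- f n z0)). rewrite Cmod_opp in T. lra. }
  unfold K2. apply Rmult_le_reg_r with (R0 / 8); [lra|].
  eapply Rle_trans; [exact Z|]. right. field. lra. }
assert (DD : dominated (fun n => C_derive (f n) z0) (fun n => K2 * M n)).
{ split; [now apply ex_series_scal_R|exact Dl]. }
assert (DF : forall z, Cmod (z - z0) < R0 -> dominated (fun n => f n z) M).
{ intros z Hz. split; auto. }
apply (cder_of_quadratic _ _ _ (R0 / 4) (K * Series M)); [lra| |].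
{ apply Rmult_le_pos; [lra|now apply Series_pos]. }
intros v Hv. set (h := (v - z0)%C) in *.
assert (S1 : is_CSeries (fun n => f n v - f n z0 - h * C_derive (f n) z0)%C
  (CSeries (fun n => f n v) - CSeries (fun n => f n z0) - h * CSeries (fun n => C_derive (f n) z0))%C).
{ apply is_CSeries_minus; [apply is_CSeries_minus|apply is_CSeries_scal].
  - apply (CSeries_correct _ M), DF. unfold h in Hv; lra.
  - apply (CSeries_correct _ M), DF, E0.
  - eapply CSeries_correct, DD. }
rewrite (Cmult_comm _ h). rewrite <- (CSeries_unique _ _ S1).
set (H2 := Cmod h * Cmod h).
replace (K * Series M * H2) with (Series (fun n => (K * H2) * M n)) by (rewrite Series_scal_l; ring).
apply Cmod_CSeries. split; [now apply ex_series_scal_R|].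
intros n. rewrite (Cmult_comm h). eapply Rle_trans; [apply Est, Hv|]. right. unfold H2, h. ring.
Qed.

Lemma Csum_rev u n : Csum u n = Csum (fun i => u (n - S i)%nat) n.
Proof.
induction n as [|n IH]; [reflexivity|].
rewrite (Csum_S_l (fun i => u (S n - S i)%nat)). simpl Csum at 1.
replace (S n - 1)%nat with n by lia. rewrite IH.
rewrite Cplus_comm. f_equal.
Qed.

(** * Expansions of the cotangent *)

Definition expi (u : C) : C := Cexp (Ci * RtoC PI * u)%C.
(* sin (pi u) and cos (pi u) *)
Definition csin (u : C) : C := ((expi u - / expi u) / (2 * Ci))%C.
Definition ccos (u : C) : C := ((expi u + / expi u) / 2)%C.
Definition picot (u : C) : C := (RtoC PI * (ccos u / csin u))%C.
Definition pisin2 (u : C) : C := (RtoC (PI ^ 2) / (csin u * csin u))%C.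

Lemma RtoC_neq_0 (r : R) : r <> 0 -> RtoC r <> RtoC 0.
Proof. intros H E. apply RtoC_inj in E. contradiction. Qed.

Ltac cnz := repeat split; repeat first [assumption | apply Ci_nz | apply C1_nz
  | apply Cmult_neq_0 | (apply RtoC_neq_0; lra) ].

Lemma Ci2 : (Ci * Ci)%C = RtoC (-1).
Proof. apply injective_projections; simpl; ring. Qed.

Lemma expi_plus a b : expi (a + b) = (expi a * expi b)%C.
Proof. unfold expi. rewrite <- Cexp_plus. f_equal. ring. Qed.

Lemma expi_neq_0 a : expi a <> 0.
Proof. apply Cexp_neq_0. Qed.

Lemma expi_0 : expi 0 = 1.
Proof. unfold expi. rewrite Cmult_0_r. apply Cexp_0. Qed.

Lemma expi_half : expi (RtoC (/ 2)) = Ci.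
Proof.
unfold expi. replace (Ci * RtoC PI * RtoC (/ 2))%C with ((0, PI / 2)%R : C)
  by (apply injective_projections; simpl; field).
unfold Cexp; simpl. rewrite exp_0, cos_PI2, sin_PI2. apply injective_projections; simpl; ring.
Qed.

Lemma expi_1 : expi 1 = RtoC (-1).
Proof.
replace (RtoC 1) with (RtoC (/ 2) + RtoC (/ 2))%C.
- rewrite expi_plus, expi_half. apply Ci2.
- rewrite <- RtoC_plus. f_equal. lra.
Qed.

Lemma csin_sub_1 u : csin (u - 1) = (- csin u)%C.
Proof.
assert (E : expi u = (expi (u - 1) * RtoC (-1))%C).
{ rewrite <- expi_1, <- expi_plus. f_equal. ring. }
unfold csin. rewrite E. assert (H := expi_neq_0 (u - 1)). field; cnz.
Qed.

Lemma ccos_sub_1 u : ccos (u - 1) = (- ccos u)%C.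
Proof.
assert (E : expi u = (expi (u - 1) * RtoC (-1))%C).
{ rewrite <- expi_1, <- expi_plus. f_equal. ring. }
unfold ccos. rewrite E. assert (H := expi_neq_0 (u - 1)). field; cnz.
Qed.

Lemma csin_plus a b : csin (a + b) = (csin a * ccos b + ccos a * csin b)%C.
Proof.
unfold csin, ccos. rewrite expi_plus.
assert (Ha := expi_neq_0 a). assert (Hb := expi_neq_0 b). field; cnz.
Qed.

Lemma csin_opp a : csin (- a) = (- csin a)%C.
Proof.
assert (E : expi (- a) = (/ expi a)%C).
{ unfold expi. rewrite <- Cexp_opp. f_equal. ring. }
unfold csin. rewrite E. assert (Ha := expi_neq_0 a). field; cnz.
Qed.

Lemma csin_half_facts u :
  csin ((u + 1) / 2) = ccos (u / 2) /\ ccos ((u + 1) / 2) = (- csin (u / 2))%C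
  /\ csin u = (2 * csin (u / 2) * ccos (u / 2))%C
  /\ ccos u = (ccos (u / 2) * ccos (u / 2) - csin (u / 2) * csin (u / 2))%C
  /\ (ccos (u / 2) * ccos (u / 2) + csin (u / 2) * csin (u / 2))%C = 1.
Proof.
assert (E : expi ((u + 1) / 2) = (expi (u / 2) * Ci)%C).
{ rewrite <- expi_half, <- expi_plus. f_equal. rewrite RtoC_inv by lra. field; cnz. }
assert (E2 : expi u = (expi (u / 2) * expi (u / 2))%C).
{ rewrite <- expi_plus. f_equal. field; cnz. }
assert (H := expi_neq_0 (u / 2)).
assert (EC := Ci_inv).
unfold csin, ccos. rewrite E, E2. set (F := expi (u / 2)) in *.
(* [field] treats [Ci] as an atom: its occurrences are brought to the numerator, where its square
   can be rewritten. *)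
assert (I2 : (Ci * Ci)%C = (- (1))%C).
{ rewrite Ci2. apply RtoC_opp. }
assert (I3 : forall X Y : C, (X * Ci = Y * Ci)%C -> X = Y).
{ intros X Y HXY. replace X with (X * Ci * / Ci)%C by (field; cnz). rewrite HXY. field; cnz. }
assert (I4 : (/ (F * Ci) = - Ci * / F)%C).
{ replace (/ (F * Ci))%C with (/ Ci * / F)%C by (field; cnz). now rewrite EC. }
assert (I5 : forall X, (X / (2 * Ci) = - Ci * X / 2)%C).
{ intros X. replace (X / (2 * Ci))%C with (/ Ci * X / 2)%C by (field; cnz). now rewrite EC. }
rewrite !I5, !I4.
repeat split.
- replace (- Ci * (F * Ci - - Ci * / F) / 2)%C with (- (Ci * Ci) * (F + / F) / 2)%C by (field; cnz). rewrite I2. field; cnz.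
- field; cnz.
- field; cnz.
- replace ((- Ci * (F - / F) / 2) * (- Ci * (F - / F) / 2))%C with ((Ci * Ci) * (F - / F) * (F - / F) / (2 * 2))%C by (field; cnz).
  rewrite I2. field; cnz.
- replace ((- Ci * (F - / F) / 2) * (- Ci * (F - / F) / 2))%C with ((Ci * Ci) * (F - / F) * (F - / F) / (2 * 2))%C by (field; cnz).
  rewrite I2. field; cnz.
Qed.

(** Adding 1/2 to u/2 turns sine into cosine and cosine into minus sine. So these are cot 2x = (cot
    x - tan x)/2 and 1/sin^2 2x = (1/sin^2 x + 1/cos^2 x)/4. *)
Lemma csin_dup u : csin u <> 0 ->
  csin (u / 2) <> 0 /\ csin ((u + 1) / 2) <> 0 /\
  picot u = (/ 2 * (picot (u / 2) + picot ((u + 1) / 2)))%C /\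
  pisin2 u = (/ 4 * (pisin2 (u / 2) + pisin2 ((u + 1) / 2)))%C.
Proof.
intros H. destruct (csin_half_facts u) as [E1 [E2 [E3 [E4 E5]]]].
assert (Hs : csin (u / 2) <> 0).
{ intros E. apply H. rewrite E3, E. ring. }
assert (Hc : ccos (u / 2) <> 0).
{ intros E. apply H. rewrite E3, E. ring. }
unfold picot, pisin2. rewrite E1, E2, E3, E4.
repeat split; auto.
- field; cnz.
- replace (RtoC (PI ^ 2)) with (RtoC (PI ^ 2) * (ccos (u / 2) * ccos (u / 2) + csin (u / 2) * csin (u / 2)))%C at 1
    by (rewrite E5; ring).
  field; cnz.
Qed.

Lemma picot_sub_1 u : picot (u - 1) = picot u.
Proof.
unfold picot. rewrite csin_sub_1, ccos_sub_1.
f_equal. unfold Cdiv.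
(* At a zero of the sine both sides are 0, because [/ 0] evaluates to 0; hence the period holds at
   every point. *)
destruct (Ceq_dec (csin u) 0) as [E|E].
- rewrite E, Copp_0.
  replace (/ 0)%C with (RtoC 0); [ring|].
  unfold Cinv; simpl. apply injective_projections; simpl; unfold Rdiv; ring.
- field. exact E.
Qed.

Lemma pisin2_sub_1 u : pisin2 (u - 1) = pisin2 u.
Proof.
unfold pisin2. rewrite csin_sub_1. f_equal. ring.
Qed.

(** * A linear lower bound for the sine on a strip *)

Lemma sinh_ge y : 0 <= y -> 2 * y <= exp y - exp (- y).
Proof.
intros [Hy|<-]; [|rewrite Ropp_0; lra].
destruct (MVT_cor2 (fun t => exp t - exp (- t)) (fun t => exp t + exp (- t)) 0 y Hy) as [c [Hc _]].
- intros t _.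
  apply is_derive_Reals. auto_derive; [easy|]. ring.
- cbv beta in Hc. rewrite Ropp_0 in Hc.
  assert (2 <= exp c + exp (- c)).
  { rewrite exp_Ropp. assert (P := exp_pos c). set (t := exp c) in *.
    apply Rmult_le_reg_r with t; [exact P|]. rewrite Rmult_plus_distr_r, Rinv_l by lra. generalize (Rle_0_sqr (t - 1)); unfold Rsqr; lra. }
  nra.
Qed.

(* From [sin y >= y cos y] and [sin (2 y) = 2 sin y cos y] for [y <= 3 pi / 8]. *)
Definition sinc0 : R := cos (3 * PI / 8) * cos (3 * PI / 8).

Lemma sinc0_pos : 0 < sinc0 <= 1.
Proof.
unfold sinc0. assert (P := PI_RGT_0).
assert (0 < cos (3 * PI / 8)) by (apply cos_gt_0; lra).
assert (cos (3 * PI / 8) <= 1) by apply COS_bound. nra.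
Qed.

Lemma sin_ge_pos x : 0 <= x <= 3 * PI / 4 -> sinc0 * x <= sin x.
Proof.
intros [[Hx|<-] Hx2]; [|rewrite sin_0; lra].
set (y := x / 2).
assert (Hy : 0 < y <= 3 * PI / 8) by (unfold y; lra).
assert (Cy : cos (3 * PI / 8) <= cos y) by (apply cos_decr_1; lra).
assert (C0 : 0 < cos (3 * PI / 8)) by (apply cos_gt_0; lra).
assert (S : y * cos y <= sin y).
{ destruct (MVT_cor2 sin cos 0 y) as [c [Hc Hc2]]; [lra|intros; apply derivable_pt_lim_sin|].
  rewrite sin_0 in Hc. assert (cos y <= cos c) by (apply cos_decr_1; lra). nra. }
replace x with (2 * y) by (unfold y; field). rewrite sin_2a. unfold sinc0.
assert (cos (3 * PI / 8) * cos (3 * PI / 8) <= cos y * cos y) by (apply Rmult_le_compat; lra).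
nra.
Qed.

Lemma Cmod_sqr (z : C) : Cmod z * Cmod z = Re z * Re z + Im z * Im z.
Proof. generalize (Cmod2_alt z). simpl. lra. Qed.

(** The identity |sin(pi(x + iy))|^2 = sin(pi x)^2 + sinh(pi y)^2 separates the two coordinates. The
    strip is wider than 1/2 because the arguments (z + k)/2^(p+1) can exceed 1/2 by the contribution
    of Re z. *)
Lemma csin_lower u : Rabs (Re u) <= 3 / 4 -> sinc0 * Cmod u <= Cmod (csin u).
Proof.
intros Hu. assert (P1 := PI2_1). assert (S0 := sinc0_pos).
apply Rsqr_incr_0_var; [|apply Cmod_ge_0]. unfold Rsqr.
set (x := Re u) in *. set (y := Im u).
assert (E : Cmod (csin u) * Cmod (csin u) =
   sin (PI * x) * sin (PI * x) + (exp (PI * y) - exp (- (PI * y))) * (exp (PI * y) - exp (- (PI * y))) / 4).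
{ unfold csin. replace (/ expi u)%C with (expi (- u)).
  2:{ unfold expi. rewrite <- Cexp_opp. f_equal. ring. }
  rewrite Cmod_div by cnz. rewrite Cmod_mult, Cmod_Ci, Cmod_R, Rabs_pos_eq by lra.
  match goal with |- Cmod ?X / _ * _ = _ => transitivity (Cmod X * Cmod X / 4); [field|] end.
  rewrite Cmod_sqr.
  assert (E1 : expi u = (exp (- (PI * y)) * cos (PI * x), exp (- (PI * y)) * sin (PI * x))%R).
  { unfold expi, Cexp. replace (Re (Ci * RtoC PI * u)) with (- (PI * y)) by (unfold y, Re, Im; simpl; ring).
    replace (Im (Ci * RtoC PI * u)) with (PI * x) by (unfold x, Re, Im; simpl; ring). reflexivity. }
  assert (E2 : expi (- u) = (exp (PI * y) * cos (PI * x), - (exp (PI * y) * sin (PI * x)))%R).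
  { unfold expi, Cexp. replace (Re (Ci * RtoC PI * - u)) with (PI * y) by (unfold y, Re, Im; simpl; ring).
    replace (Im (Ci * RtoC PI * - u)) with (- (PI * x)) by (unfold x, Re, Im; simpl; ring).
    rewrite cos_neg, sin_neg. apply injective_projections; simpl; ring. }
  rewrite E1, E2. unfold Re, Im; simpl.
  assert (Q : exp (PI * y) * exp (- (PI * y)) = 1).
  { rewrite <- exp_plus, <- exp_0. f_equal. ring. }
  assert (T := sin2_cos2 (PI * x)). unfold Rsqr in T.
  set (a := exp (PI * y)) in *. set (b := exp (- (PI * y))) in *.
  set (s := sin (PI * x)) in *. set (c := cos (PI * x)) in *.
  replace ((b * c + - (a * c)) * (b * c + - (a * c)) + (b * s + - - (a * s)) * (b * s + - - (a * s)))
    with ((a - b) * (a - b) * (s * s + c * c) + 4 * (a * b) * (s * s)) by ring.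
  rewrite Q, T. field. }
rewrite E.
assert (S1 : (sinc0 * x) * (sinc0 * x) <= sin (PI * x) * sin (PI * x)).
{ assert (HX : forall t, 0 <= t <= 3 / 4 -> (sinc0 * t) * (sinc0 * t) <= sin (PI * t) * sin (PI * t)).
  { intros t Ht. assert (Q := sin_ge_pos (PI * t)).
    assert (0 <= PI * t <= 3 * PI / 4) by nra. specialize (Q H).
    assert (sinc0 * t <= sinc0 * (PI * t)) by (apply Rmult_le_compat_l; nra).
    apply Rmult_le_compat; nra. }
  destruct (Rle_dec 0 x) as [Hx|Hx].
  - apply HX. rewrite Rabs_pos_eq in Hu; lra.
  - specialize (HX (- x)). rewrite Rabs_left in Hu by lra. specialize (HX ltac:(lra)).
    replace (PI * - x) with (- (PI * x)) in HX by ring. rewrite sin_neg in HX. lra. }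
assert (S2 : (2 * y) * (2 * y) <= (exp (PI * y) - exp (- (PI * y))) * (exp (PI * y) - exp (- (PI * y)))).
{ assert (HY : forall t, 0 <= t -> (2 * t) * (2 * t) <= (exp (PI * t) - exp (- (PI * t))) * (exp (PI * t) - exp (- (PI * t)))).
  { intros t Ht. assert (Q := sinh_ge (PI * t)). assert (0 <= PI * t) by nra. specialize (Q H).
    assert (t <= PI * t) by nra. apply Rmult_le_compat; lra. }
  destruct (Rle_dec 0 y) as [Hy|Hy].
  - now apply HY.
  - specialize (HY (- y) ltac:(lra)).
    replace (PI * - y) with (- (PI * y)) in HY by ring. rewrite Ropp_involutive in HY. nra. }
replace (sinc0 * Cmod u * (sinc0 * Cmod u)) with (sinc0 * sinc0 * (Cmod u * Cmod u)) by ring.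
rewrite Cmod_sqr. fold x y.
assert (sinc0 * sinc0 * (y * y) <= 1 * (y * y)) by (apply Rmult_le_compat_r; nra). nra.
Qed.

Lemma cder_expi u : cder expi u (Ci * RtoC PI * expi u)%C.
Proof.
unfold expi. apply (cder_comp Cexp (fun u => Ci * RtoC PI * u)%C); [apply cder_Cexp|apply cder_linear].
Qed.

Lemma cder_csin_0 : cder csin 0 (RtoC PI).
Proof.
assert (H := cder_expi 0). rewrite expi_0 in H.
assert (Hi := cder_comp _ _ _ _ _ (cder_inv (expi 0) (expi_neq_0 0)) (cder_expi 0)). rewrite expi_0 in Hi.
assert (Hs := cder_scal (/ (2 * Ci))%C _ _ _ (cder_minus _ _ _ _ _ H Hi)).
apply (cder_ext (fun w => / (2 * Ci) * (expi w - / expi w))%C).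
{ intros w. unfold csin, Cdiv. ring. }
match type of Hs with cder _ _ ?l => replace (RtoC PI) with l end; [exact Hs|].
field; cnz.
Qed.

Lemma cder_ccos_0 : exists l, cder ccos 0 l.
Proof.
assert (Hi := cder_comp _ _ _ _ _ (cder_inv (expi 0) (expi_neq_0 0)) (cder_expi 0)).
eexists. apply (cder_ext (fun w => / 2 * (expi w + / expi w))%C).
{ intros w. unfold ccos, Cdiv. ring. }
apply cder_scal, cder_plus; [apply cder_expi|exact Hi].
Qed.

Lemma csin_0 : csin 0 = 0.
Proof. unfold csin. rewrite expi_0. field; cnz. Qed.

Lemma ccos_0 : ccos 0 = 1.
Proof. unfold ccos. rewrite expi_0. field; cnz. Qed.

Opaque sinc0.

(** * Iterated duplication and its limit *)

Section Duplication.

Variables (phi : C -> C) (sc : R).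
Hypothesis phi_sub_1 : forall u, phi (u - 1) = phi u.
Hypothesis phi_dup : forall u, csin u <> 0 ->
  phi u = (RtoC sc * (phi (u / 2) + phi ((u + 1) / 2)))%C.

(** After p + 1 duplications the arguments are (z + n)/2^(p+1) with n modulo 2^(p+1). By periodicity
    the representatives n = k and n = -1 - k with k < 2^p can be chosen, so that for fixed k the
    arguments tend to 0 as p grows. *)
Definition dup_term (z : C) (p k : nat) : C :=
  (RtoC (sc ^ S p) * (phi ((z + RtoC (INR k)) * RtoC (/ 2 ^ S p))
                      + phi ((z - RtoC (INR (S k))) * RtoC (/ 2 ^ S p))))%C.

Lemma csin_dyadic_neq_0 z : csin z <> 0 -> forall p k, (k < 2 ^ p)%nat ->
  csin ((z + RtoC (INR k)) * RtoC (/ 2 ^ p)) <> 0 /\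
  csin ((z - RtoC (INR (S k))) * RtoC (/ 2 ^ p)) <> 0.
Proof.
intros Hz p k Hk.
assert (A : forall p k, (k < 2 ^ p)%nat -> csin ((z + RtoC (INR k)) * RtoC (/ 2 ^ p)) <> 0).
{ clear p k Hk. induction p as [|p IH]; intros k Hk.
  - simpl in Hk. replace k with 0%nat by lia. simpl. rewrite Rinv_1.
    replace ((z + 0) * 1)%C with z by ring. exact Hz.
  - assert (P2 : 2 ^ p <> 0) by (apply pow_nonzero; lra).
    destruct (Nat.lt_ge_cases k (2 ^ p)) as [H|H].
    + destruct (csin_dup _ (IH k H)) as [H1 _].
      replace ((z + RtoC (INR k)) * RtoC (/ 2 ^ S p))%C
        with ((z + RtoC (INR k)) * RtoC (/ 2 ^ p) / 2)%C; [exact H1|].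
      simpl pow. rewrite Rinv_mult, RtoC_mult, (RtoC_inv 2) by lra. field; cnz.
    + simpl in Hk. destruct (csin_dup _ (IH (k - 2 ^ p)%nat ltac:(lia))) as [_ [H1 _]].
      replace ((z + RtoC (INR k)) * RtoC (/ 2 ^ S p))%C
        with (((z + RtoC (INR (k - 2 ^ p))) * RtoC (/ 2 ^ p) + 1) / 2)%C; [exact H1|].
      rewrite minus_INR by exact H. rewrite pow_INR. simpl (INR 2). replace (1 + 1) with 2 by ring.
      simpl pow. rewrite Rinv_mult, RtoC_mult, (RtoC_inv 2), RtoC_minus, RtoC_inv by (auto; lra).
      field; cnz. }
split; [now apply A|].
assert (H := A p (2 ^ p - S k)%nat ltac:(lia)).
assert (P2 : 2 ^ p <> 0) by (apply pow_nonzero; lra).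
intros E. apply H.
set (v := ((z - RtoC (INR (S k))) * RtoC (/ 2 ^ p))%C) in *.
assert (Ev : ((z + RtoC (INR (2 ^ p - S k))) * RtoC (/ 2 ^ p) - 1 = v)%C).
{ unfold v. rewrite minus_INR by lia. rewrite pow_INR. change (INR 2) with 2.
  rewrite RtoC_minus, RtoC_inv by auto. field; cnz. }
rewrite <- Ev, csin_sub_1 in E.
apply (f_equal Copp) in E. rewrite Copp_0 in E. rewrite <- E. ring.
Qed.

Lemma dup_sum z : csin z <> 0 -> forall p, phi z = Csum (dup_term z p) (2 ^ p).
Proof.
intros Hz. induction p as [|p IH].
- simpl. unfold dup_term. rewrite (phi_dup z Hz).
  replace (sc ^ 1) with sc by ring. replace (2 ^ 1) with 2 by ring.
  rewrite RtoC_inv by lra. simpl INR.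
  rewrite <- (phi_sub_1 ((z + 1) / 2)).
  replace ((z + 0) * / 2)%C with (z / 2)%C by (field; cnz).
  replace ((z - 1) * / 2)%C with ((z + 1) / 2 - 1)%C by (field; cnz). ring.
- rewrite IH.
  assert (P2 : 2 ^ p <> 0) by (apply pow_nonzero; lra).

  set (t := RtoC (/ 2 ^ S (S p))).
  set (g := fun k : nat => (RtoC (sc ^ S (S p)) * (phi ((z + RtoC (INR k)) * t)))%C).
  set (h := fun k : nat => (RtoC (sc ^ S (S p)) * (phi ((z - RtoC (INR (S k))) * t)))%C).
  (* Duplicating both members of the k-th pair gives the members of index k at the next level,
     together with those of the reflected index 2^(p+1) - 1 - k. *)
  assert (E : forall k, (k < 2 ^ p)%nat ->
     dup_term z p k = (g k + h k + (h (2 * 2 ^ p - S k)%nat + g (2 * 2 ^ p - S k)%nat))%C).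
  { intros k Hk. unfold dup_term.
    destruct (csin_dyadic_neq_0 z Hz (S p) k) as [N1 N2]; [simpl; lia|].
    rewrite (phi_dup _ N1), (phi_dup _ N2).
    rewrite <- (phi_sub_1 (((z + RtoC (INR k)) * RtoC (/ 2 ^ S p) + 1) / 2)).
    unfold g, h. rewrite S_INR, !(S_INR (2 * 2 ^ p - S k)), minus_INR, mult_INR, pow_INR by lia.
    change (INR 2) with 2. rewrite S_INR.
    set (ik := INR k).
    replace (sc ^ S (S p)) with (sc ^ S p * sc) by (simpl; ring). rewrite RtoC_mult.
    assert (Et : t = (/ (2 * 2 * RtoC (2 ^ p)))%C).
    { unfold t. rewrite RtoC_inv by (apply pow_nonzero; lra). f_equal. simpl pow. rewrite !RtoC_mult. ring. }
    assert (Et1 : RtoC (/ 2 ^ S p) = (/ (2 * RtoC (2 ^ p)))%C).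
    { rewrite RtoC_inv by (apply pow_nonzero; lra). f_equal. simpl pow. now rewrite !RtoC_mult. }
    replace ((z + RtoC ik) * RtoC (/ 2 ^ S p) / 2)%C with ((z + RtoC ik) * t)%C
      by (rewrite Et, Et1; field; cnz).
    replace ((z - RtoC (ik + 1)) * RtoC (/ 2 ^ S p) / 2)%C with ((z - RtoC (ik + 1)) * t)%C
      by (rewrite Et, Et1; field; cnz).
    replace (((z + RtoC ik) * RtoC (/ 2 ^ S p) + 1) / 2 - 1)%C with ((z - RtoC (2 * 2 ^ p - (ik + 1) + 1)) * t)%C
      by (rewrite Et, Et1, !RtoC_plus, RtoC_minus, RtoC_mult, !RtoC_plus; field; cnz).
    replace (((z - RtoC (ik + 1)) * RtoC (/ 2 ^ S p) + 1) / 2)%C with ((z + RtoC (2 * 2 ^ p - (ik + 1))) * t)%C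
      by (rewrite Et, Et1, RtoC_minus, RtoC_mult, !RtoC_plus; field; cnz).
    ring. }
  rewrite (Csum_ext _ _ _ E), Csum_plus.
  replace (2 ^ S p)%nat with (2 ^ p + 2 ^ p)%nat by (simpl; lia).
  rewrite Csum_add. f_equal.
  + apply Csum_ext. intros k _. unfold g, h, dup_term. fold t. ring.
  + rewrite Csum_rev. apply Csum_ext. intros k Hk.
    replace (2 * 2 ^ p - S (2 ^ p - S k))%nat with (2 ^ p + k)%nat by lia.
    unfold g, h, dup_term. fold t. ring.
Qed.

(* Tannery's theorem lets [p] tend to infinity in [dup_sum]. *)
Lemma dup_limit z M v : csin z <> 0 -> ex_series M -> (forall k, 0 <= M k) ->
  (exists p0, forall p k, (p0 <= p)%nat -> (k < 2 ^ p)%nat -> Cmod (dup_term z p k) <= M k) ->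
  (forall k, Clim (fun p => dup_term z p k) (v k)) ->
  phi z = CSeries v /\ dominated v M.
Proof.
intros Hz HM PM [p0 HD] Hv.
(* The finite sum is extended by zeros to a series, and the stages before [p0] are skipped so that
   the majorant holds at every stage. *)
set (a := fun p k => if lt_dec k (2 ^ (p0 + p)) then dup_term z (p0 + p) k else RtoC 0).
assert (Ha : forall p, CSeries (a p) = phi z).
{ intros p. rewrite (dup_sum z Hz (p0 + p)). apply CSeries_unique.
  replace (Csum (dup_term z (p0 + p)) (2 ^ (p0 + p))) with (Csum (a p) (2 ^ (p0 + p))).
  - apply is_CSeries_finite. intros k Hk. unfold a. destruct lt_dec; [lia|reflexivity].
  - apply Csum_ext. intros k Hk. unfold a. destruct lt_dec; [reflexivity|lia]. }
destruct (tannery a v M) as [T D].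
- intros p. split; [exact HM|]. intros k. unfold a. destruct lt_dec; [apply HD; lia|].
  rewrite Cmod_0. apply PM.
- intros k. apply (Clim_ext_from k (fun p => dup_term z (p0 + p) k)).
  + intros p Hp. unfold a. destruct lt_dec as [|H]; [reflexivity|].
    exfalso. apply H. assert (p0 + p < 2 ^ (p0 + p))%nat by (apply Nat.pow_gt_lin_r; lia). lia.
  + intros e He. destruct (Hv k e He) as [N HN]. exists N. intros n Hn. apply HN. lia.
- split; [|exact D]. eapply Clim_unique; [|exact T].
  eapply Clim_ext; [intros p; symmetry; apply Ha|apply Clim_const].
Qed.

End Duplication.

Lemma Clim_dyadic w : Clim (fun p => w * RtoC (/ 2 ^ S p))%C 0.
Proof.
apply (Clim_squeeze _ _ (fun p => Cmod w * (/ 2) ^ S p)).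
- intros p. replace (w * RtoC (/ 2 ^ S p) - 0)%C with (w * RtoC (/ 2 ^ S p))%C by ring.
  rewrite Cmod_mult, Cmod_R, Rabs_pos_eq.
  + rewrite pow_inv. lra.
  + left. apply Rinv_0_lt_compat, pow_lt. lra.
- replace (Finite 0) with (Rbar_mult (Cmod w) (Finite 0)) by (simpl; f_equal; ring).
  apply is_lim_seq_scal_l.
  apply (is_lim_seq_incr_1 (fun p => (/ 2) ^ p)). apply is_lim_seq_geom. rewrite Rabs_pos_eq; lra.
Qed.

Lemma Clim_csin_dyadic w : Clim (fun p => RtoC (2 ^ S p) * csin (w * RtoC (/ 2 ^ S p)))%C (RtoC PI * w).
Proof.
intros e He.
assert (Hw := Cmod_ge_0 w).
assert (Hd : 0 < e / (1 + Cmod w)) by (apply Rdiv_lt_0_compat; lra).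
destruct (cder_csin_0 (e / (1 + Cmod w)) Hd) as [d [Hd0 H]].
destruct (Clim_dyadic w d Hd0) as [N HN]. exists N. intros p Hp. specialize (HN p Hp).
specialize (H _ HN). rewrite csin_0 in H.
set (u := (w * RtoC (/ 2 ^ S p))%C) in *.
replace (csin u - 0 - RtoC PI * (u - 0))%C with (csin u - RtoC PI * u)%C in H by ring.
replace (u - 0)%C with u in H by ring.
assert (P2 : 0 < 2 ^ S p) by (apply pow_lt; lra).
assert (Eu : w = (RtoC (2 ^ S p) * u)%C).
{ unfold u. rewrite RtoC_inv by lra. field; cnz. }
assert (Em : Cmod w = 2 ^ S p * Cmod u).
{ rewrite Eu at 1. rewrite Cmod_mult, Cmod_R, Rabs_pos_eq; lra. }
replace (RtoC (2 ^ S p) * csin u - RtoC PI * w)%C with (RtoC (2 ^ S p) * (csin u - RtoC PI * u))%C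
  by (rewrite Eu; ring).
rewrite Cmod_mult, Cmod_R, Rabs_pos_eq by lra.
apply Rle_lt_trans with (2 ^ S p * (e / (1 + Cmod w) * Cmod u)); [apply Rmult_le_compat_l; lra|].
replace (2 ^ S p * (e / (1 + Cmod w) * Cmod u)) with (e / (1 + Cmod w) * Cmod w) by (rewrite Em at 2; ring).
apply Rmult_lt_reg_r with (1 + Cmod w); [lra|].
replace (e / (1 + Cmod w) * Cmod w * (1 + Cmod w)) with (e * Cmod w) by (field; lra). nra.
Qed.

Lemma RtoC_pow_inv p : RtoC ((/ 2) ^ p) = (/ RtoC (2 ^ p))%C.
Proof. rewrite pow_inv. apply RtoC_inv, pow_nonzero. lra. Qed.

Lemma picot_dyadic_eq w p : (RtoC ((/ 2) ^ p) * picot w)%C = (RtoC PI * (ccos w * / (RtoC (2 ^ p) * csin w)))%C.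
Proof.
rewrite RtoC_pow_inv. unfold picot, Cdiv.
assert (H : RtoC (2 ^ p) <> 0) by (apply RtoC_neq_0, pow_nonzero; lra).
destruct (Ceq_dec (csin w) 0) as [E|E].
- rewrite E, Cmult_0_r.
  replace (/ 0)%C with (RtoC 0); [ring|].
  unfold Cinv; simpl. apply injective_projections; simpl; unfold Rdiv; ring.
- field; cnz.
Qed.

Lemma Clim_picot_dyadic w : w <> RtoC 0 ->
  Clim (fun p => RtoC ((/ 2) ^ S p) * picot (w * RtoC (/ 2 ^ S p)))%C (/ w).
Proof.
intros Hw. assert (HP := PI_RGT_0).
assert (HPn : RtoC PI <> 0) by (apply RtoC_neq_0; lra).
assert (L1 := Clim_csin_dyadic w).
assert (L1i := Clim_cder _ _ _ _ (cder_inv _ (Cmult_neq_0 _ _ HPn Hw)) L1).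
destruct cder_ccos_0 as [l Hl].
assert (L2 := Clim_cder _ _ _ _ Hl (Clim_dyadic w)). rewrite ccos_0 in L2.
assert (L3 := Clim_scal (RtoC PI) _ _ (Clim_mult _ _ _ _ L2 L1i)). cbv beta in L3.
replace (RtoC PI * (1 * / (RtoC PI * w)))%C with (/ w)%C in L3 by (field; cnz).
eapply Clim_ext; [|exact L3]. intros p. symmetry. apply picot_dyadic_eq.
Qed.

Lemma Clim_pisin2_dyadic w : w <> RtoC 0 ->
  Clim (fun p => RtoC ((/ 4) ^ S p) * pisin2 (w * RtoC (/ 2 ^ S p)))%C (/ (w * w)).
Proof.
intros Hw. assert (HP := PI_RGT_0).
assert (HPn : RtoC PI <> 0) by (apply RtoC_neq_0; lra).
assert (L1 := Clim_csin_dyadic w).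
assert (L1i := Clim_cder _ _ _ _ (cder_inv _ (Cmult_neq_0 _ _ HPn Hw)) L1).
assert (L3 := Clim_scal (RtoC (PI ^ 2)) _ _ (Clim_mult _ _ _ _ L1i L1i)). cbv beta in L3.
replace (RtoC (PI ^ 2) * (/ (RtoC PI * w) * / (RtoC PI * w)))%C with (/ (w * w))%C in L3.
2:{ simpl pow. rewrite Rmult_1_r, RtoC_mult. field; cnz. }
eapply Clim_ext; [|exact L3]. intros p. cbv beta.
set (u := (w * RtoC (/ 2 ^ S p))%C). unfold pisin2, Cdiv.
replace ((/ 4) ^ S p) with ((/ 2) ^ S p * (/ 2) ^ S p).
2:{ rewrite <- Rpow_mult_distr. f_equal. field. }
rewrite RtoC_mult, RtoC_pow_inv.
assert (H : RtoC (2 ^ S p) <> 0) by (apply RtoC_neq_0, pow_nonzero; lra).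
destruct (Ceq_dec (csin u) 0) as [E|E].
- rewrite E, !Cmult_0_r.
  replace (/ 0)%C with (RtoC 0); [ring|].
  unfold Cinv; simpl. apply injective_projections; simpl; unfold Rdiv; ring.
- field; cnz.
Qed.

(** Quadratic growth of the squared distances to the integers, listed in the pairs of [dup_term];
    this makes the terms comparable with 1/(1 + k^2). *)
Definition far_from_Z (z : C) (d : R) : Prop := 0 < d /\ forall k : nat,
  d * (1 + INR k * INR k) <= Cmod (z + RtoC (INR k)) * Cmod (z + RtoC (INR k)) /\
  d * (1 + INR k * INR k) <= Cmod (z - RtoC (INR (S k))) * Cmod (z - RtoC (INR (S k))).

Lemma far_from_Z_neq z d k : far_from_Z z d -> (z + RtoC (INR k))%C <> 0 /\ (z - RtoC (INR (S k)))%C <> 0.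
Proof.
intros [Hd H]. destruct (H k) as [H1 H2].
split; intros E; rewrite E, Cmod_0 in *; assert (0 <= INR k) by apply pos_INR; nra.
Qed.

Lemma ex_series_inv_sqr : ex_series (fun k => / (1 + INR k * INR k)).
Proof.
(* Comparison with the telescoping series of 6/((k + 1)(k + 2)). *)
apply (ex_series_le (fun k => / (1 + INR k * INR k)) (fun k => 6 * (/ INR (S k) - / INR (S (S k))))).
- intros k. assert (H := pos_INR k). rewrite Rabs_pos_eq.
  2:{ left. apply Rinv_0_lt_compat. nra. }
  rewrite !S_INR. set (x := INR k) in *.
  replace (6 * (/ (x + 1) - / (x + 1 + 1))) with (/ ((x + 1) * (x + 2) / 6)) by (field; lra).
  apply Rinv_le_contravar; nra.
- apply (ex_series_scal_R 6 (fun k => / INR (S k) - / INR (S (S k)))).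
  exists 1. change (is_lim_seq (sum_n (fun k => / INR (S k) - / INR (S (S k)))) 1).
  apply (is_lim_seq_ext (fun n => 1 - / INR (S (S n)))).
  + intros n. induction n as [|n IH].
    * rewrite sum_O. simpl. field.
    * rewrite sum_Sn, <- IH. unfold plus; simpl. ring.
  + replace (Finite 1) with (Finite (1 - 0)) by (f_equal; ring).
    apply is_lim_seq_minus'; [apply is_lim_seq_const|].
    apply (is_lim_seq_incr_1 (fun n => / INR (S n))), (is_lim_seq_incr_1 (fun n => / INR n)).
    apply (is_lim_seq_inv INR p_infty); [apply is_lim_seq_INR|discriminate].
Qed.

(* Beyond this threshold the dyadic arguments stay in the strip of [csin_lower]. *)
Lemma dyadic_strip z : exists p0, forall p k, (p0 <= p)%nat -> (k < 2 ^ p)%nat ->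
  sinc0 * (Cmod (z + RtoC (INR k)) * / 2 ^ S p) <= Cmod (csin ((z + RtoC (INR k)) * RtoC (/ 2 ^ S p))) /\
  sinc0 * (Cmod (z - RtoC (INR (S k))) * / 2 ^ S p) <= Cmod (csin ((z - RtoC (INR (S k))) * RtoC (/ 2 ^ S p))).
Proof.
destruct (nfloor_ex (2 * (Rabs (Re z) + 1))) as [p0 [_ Hp0]]; [generalize (Rabs_pos (Re z)); lra|].
exists (S p0). intros p k Hp Hk.
assert (P2 : 0 < 2 ^ S p) by (apply pow_lt; lra).
assert (Pi : 0 < / 2 ^ S p) by now apply Rinv_0_lt_compat.
assert (Hp2 : 2 * (Rabs (Re z) + 1) <= 2 ^ p).
{ apply Rle_trans with (INR p).
  - apply le_INR in Hp. rewrite S_INR in Hp. lra.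
  - change 2 with (INR 2). rewrite <- pow_INR. apply le_INR.
    assert (p < 2 ^ p)%nat by (apply Nat.pow_gt_lin_r; lia). lia. }
assert (Hk2 : INR k + 1 <= 2 ^ p).
{ rewrite <- S_INR. change 2 with (INR 2). rewrite <- pow_INR. apply le_INR. lia. }
assert (Hk0 := pos_INR k).
assert (E : forall w : C, Rabs (Re w) <= 3 / 4 * 2 ^ S p ->
   sinc0 * (Cmod w * / 2 ^ S p) <= Cmod (csin (w * RtoC (/ 2 ^ S p)))).
{ intros w Hw. replace (Cmod w * / 2 ^ S p) with (Cmod (w * RtoC (/ 2 ^ S p))).
  - apply csin_lower. rewrite re_scal_r, Rabs_mult, (Rabs_pos_eq (/ _)) by lra.
    apply Rmult_le_reg_r with (2 ^ S p); [exact P2|]. rewrite Rmult_assoc, Rinv_l by lra. lra.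
  - rewrite Cmod_mult, Cmod_R, Rabs_pos_eq by lra. reflexivity. }
simpl pow in E at 1. change (2 * 2 ^ p) with (2 ^ S p) in E.
split; apply E; unfold Cminus; rewrite re_plus, ?re_opp, re_RtoC, ?S_INR.
- eapply Rle_trans; [apply Rabs_triang|]. rewrite (Rabs_pos_eq (INR k)) by lra. simpl. lra.
- eapply Rle_trans; [apply Rabs_triang|]. rewrite Rabs_Ropp, (Rabs_pos_eq (INR k + 1)) by lra. simpl. lra.
Qed.

Lemma Rinv_sqr_bound s x d t : 0 < s -> 0 < d -> 0 < t -> s * x <= t -> d <= x * x -> 0 <= x ->
  / (t * t) <= / (s * s * d).
Proof.
intros Hs Hd Ht H1 H2 H3. apply Rinv_le_contravar.
- repeat apply Rmult_lt_0_compat; assumption.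
- apply Rle_trans with ((s * x) * (s * x)); [|apply Rmult_le_compat; nra].
  replace (s * x * (s * x)) with (s * s * (x * x)) by ring.
  apply Rmult_le_compat_l; nra.
Qed.

(** The lower bound for the sine costs a factor 4^(p+1), which the weight (1/4)^(p+1) of the
    duplication formula compensates; so the majorant is uniform in p. *)
Theorem pisin2_expansion z d : csin z <> 0 -> far_from_Z z d ->
  is_CSeries (fun k => / ((z + RtoC (INR k)) * (z + RtoC (INR k)))
                      + / ((z - RtoC (INR (S k))) * (z - RtoC (INR (S k)))))%C (pisin2 z).
Proof.
intros Hz Hfar. assert (S0 := sinc0_pos). assert (HP := PI_RGT_0).
destruct Hfar as [Hd Hf0]. assert (Hfar : far_from_Z z d) by (split; assumption).
set (K := 2 * (PI * PI) / (sinc0 * sinc0 * d)).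
assert (HK : 0 < K).
{ unfold K. apply Rdiv_lt_0_compat; [nra|]. apply Rmult_lt_0_compat; nra. }
destruct (dup_limit pisin2 (/ 4) pisin2_sub_1) with (z := z)
  (M := fun k => K * / (1 + INR k * INR k))
  (v := fun k => (/ ((z + RtoC (INR k)) * (z + RtoC (INR k)))
                      + / ((z - RtoC (INR (S k))) * (z - RtoC (INR (S k)))))%C) as [E D]; auto.
- intros u Hu. rewrite RtoC_inv by lra. now apply csin_dup.
- apply ex_series_scal_R, ex_series_inv_sqr.
- intros k. apply Rmult_le_pos; [lra|]. left. apply Rinv_0_lt_compat. generalize (pos_INR k); nra.
- destruct (dyadic_strip z) as [p0 Hp0]. exists p0. intros p k Hp Hk.
  destruct (csin_dyadic_neq_0 z Hz (S p) k) as [N1 N2]; [simpl; lia|].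
  destruct (Hp0 p k Hp Hk) as [L1 L2]. destruct (Hf0 k) as [F1 F2].
  apply Cmod_gt_0 in N1. apply Cmod_gt_0 in N2.
  assert (Hk0 := pos_INR k).
  assert (P2 : 0 < 2 ^ S p) by (apply pow_lt; lra).
  assert (Pi : 0 < / 2 ^ S p) by now apply Rinv_0_lt_compat.
  assert (G : forall w : C, 0 < Cmod (csin (w * RtoC (/ 2 ^ S p))) ->
     sinc0 * (Cmod w * / 2 ^ S p) <= Cmod (csin (w * RtoC (/ 2 ^ S p))) ->
     d * (1 + INR k * INR k) <= Cmod w * Cmod w ->
     Cmod (RtoC ((/ 4) ^ S p) * pisin2 (w * RtoC (/ 2 ^ S p))) <= K / 2 * / (1 + INR k * INR k)).
  { intros w Nw Lw Fw. unfold pisin2.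
    assert (Nw' : csin (w * RtoC (/ 2 ^ S p)) <> 0) by now apply Cmod_gt_0.
    rewrite Cmod_mult, Cmod_div by (apply Cmult_neq_0; exact Nw').
    rewrite Cmod_mult, !Cmod_R, !Rabs_pos_eq by (try (apply pow_le; lra)).
    set (t := Cmod (csin (w * RtoC (/ 2 ^ S p)))) in *.
    assert (B := Rinv_sqr_bound (sinc0 * / 2 ^ S p) (Cmod w) (d * (1 + INR k * INR k)) t).
    assert (B' : / (t * t) <= / (sinc0 * / 2 ^ S p * (sinc0 * / 2 ^ S p) * (d * (1 + INR k * INR k)))).
    { apply B; auto using Cmod_ge_0; try nra. }
    replace ((/ 4) ^ S p) with (/ 2 ^ S p * / 2 ^ S p).
    2:{ rewrite <- pow_inv, <- Rpow_mult_distr. f_equal. field. }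
    apply Rle_trans with (/ 2 ^ S p * / 2 ^ S p * (PI ^ 2 * / (sinc0 * / 2 ^ S p * (sinc0 * / 2 ^ S p) * (d * (1 + INR k * INR k))))).
    - apply Rmult_le_compat_l; [nra|]. unfold Rdiv. apply Rmult_le_compat_l; [simpl; nra|exact B'].
    - right. unfold K. field. repeat split; nra. }
  unfold dup_term. rewrite Cmult_plus_distr_l.
  eapply Rle_trans; [apply Cmod_triangle|].
  assert (G1 := G _ N1 L1 F1). assert (G2 := G _ N2 L2 F2). lra.
- intros k. destruct (far_from_Z_neq z d k Hfar) as [N1 N2].
  eapply Clim_ext; [|apply Clim_plus; [apply (Clim_pisin2_dyadic _ N1)|apply (Clim_pisin2_dyadic _ N2)]].
  intros p. unfold dup_term. cbv beta. ring.
- rewrite E. eapply CSeries_correct, D.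
Qed.

(** A single cotangent decays only like 1/k. In a pair, cot a + cot b = sin(a + b)/(sin a sin b),
    and a + b = (2z - 1)/2^(p+1) does not depend on k; this yields the decay 1/k^2. *)
Theorem picot_expansion z d : csin z <> 0 -> far_from_Z z d ->
  is_CSeries (fun k => / (z + RtoC (INR k)) + / (z - RtoC (INR (S k))))%C (picot z).
Proof.
intros Hz Hfar. assert (S0 := sinc0_pos). assert (HP := PI_RGT_0).
destruct Hfar as [Hd Hf0]. assert (Hfar : far_from_Z z d) by (split; assumption).
set (K := PI * (PI + 1) * Cmod (2 * z - 1) / (sinc0 * sinc0 * d)).
assert (HK : 0 <= K).
{ unfold K. assert (Q := Cmod_ge_0 (2 * z - 1)).
  apply Rmult_le_pos; [apply Rmult_le_pos; nra|]. left. apply Rinv_0_lt_compat. repeat apply Rmult_lt_0_compat; lra. }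
destruct (dup_limit picot (/ 2) picot_sub_1) with (z := z)
  (M := fun k => K * / (1 + INR k * INR k))
  (v := fun k => (/ (z + RtoC (INR k)) + / (z - RtoC (INR (S k))))%C) as [E D]; auto.
- intros u Hu. rewrite RtoC_inv by lra. now apply csin_dup.
- apply ex_series_scal_R, ex_series_inv_sqr.
- intros k. apply Rmult_le_pos; [lra|]. left. apply Rinv_0_lt_compat. generalize (pos_INR k); nra.
- destruct (dyadic_strip z) as [p0 Hp0].
  (* The derivative pi of [csin] at 0, taken with error 1, gives |csin c| <= (pi + 1)|c| for small
     c. *)
  destruct (cder_csin_0 1 Rlt_0_1) as [r [Hr0 Hr]].
  destruct (Clim_dyadic (2 * z - 1) r Hr0) as [p1 Hp1].
  exists (max p0 p1). intros p k Hp Hk.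
  destruct (csin_dyadic_neq_0 z Hz (S p) k) as [N1 N2]; [simpl; lia|].
  destruct (Hp0 p k ltac:(lia) Hk) as [L1 L2]. destruct (Hf0 k) as [F1 F2].
  specialize (Hp1 p ltac:(lia)). specialize (Hr _ Hp1). rewrite csin_0 in Hr.

  assert (P2 : 0 < 2 ^ S p) by (apply pow_lt; lra).
  assert (Pi : 0 < / 2 ^ S p) by now apply Rinv_0_lt_compat.
  set (a := ((z + RtoC (INR k)) * RtoC (/ 2 ^ S p))%C) in *.
  set (b := ((z - RtoC (INR (S k))) * RtoC (/ 2 ^ S p))%C) in *.
  set (c := ((2 * z - 1) * RtoC (/ 2 ^ S p))%C) in *.
  assert (Eab : (a + b)%C = c).
  { unfold a, b, c. rewrite S_INR, RtoC_plus. ring. }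
  assert (Hc : Cmod (csin c) <= (PI + 1) * (Cmod (2 * z - 1) * / 2 ^ S p)).
  { replace (Cmod (2 * z - 1) * / 2 ^ S p) with (Cmod c).
    2:{ unfold c. rewrite Cmod_mult, Cmod_R, Rabs_pos_eq by lra. reflexivity. }
    replace (csin c) with ((csin c - 0 - RtoC PI * (c - 0)) + RtoC PI * c)%C by ring.
    eapply Rle_trans; [apply Cmod_triangle|]. rewrite (Cmod_mult (RtoC PI)), Cmod_R, Rabs_pos_eq by lra.
    replace (c - 0)%C with c in Hr by ring. replace (c - 0)%C with c by ring. lra. }
  assert (Hterm : dup_term picot (/ 2) z p k = (RtoC (PI * (/ 2) ^ S p) * (csin c / (csin a * csin b)))%C).
  { unfold dup_term. fold a b. rewrite <- Eab, csin_plus, RtoC_mult. unfold picot. field; cnz. }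
  rewrite Hterm. apply Cmod_gt_0 in N1 as M1. apply Cmod_gt_0 in N2 as M2.
  rewrite Cmod_mult, Cmod_div, Cmod_mult, Cmod_R by (apply Cmult_neq_0; assumption).
  rewrite Rabs_pos_eq by (apply Rmult_le_pos; [lra|apply pow_le; lra]).
  rewrite pow_inv.
  set (h := / 2 ^ S p) in *. set (s := Cmod (csin a)) in *. set (t := Cmod (csin b)) in *.
  set (x := Cmod (z + RtoC (INR k))) in *. set (y := Cmod (z - RtoC (INR (S k)))) in *.
  assert (Hx : 0 <= x) by apply Cmod_ge_0. assert (Hy : 0 <= y) by apply Cmod_ge_0.
  set (q := 1 + INR k * INR k) in *. assert (Hq : 0 < q) by (unfold q; nra).
  assert (Hxy : d * q <= x * y).
  { apply Rsqr_incr_0_var; [|nra]. unfold Rsqr.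
    replace (x * y * (x * y)) with ((x * x) * (y * y)) by ring.
    apply Rmult_le_compat; nra. }
  assert (Hst : sinc0 * sinc0 * h * h * (d * q) <= s * t).
  { apply Rle_trans with ((sinc0 * (x * h)) * (sinc0 * (y * h))).
    - replace ((sinc0 * (x * h)) * (sinc0 * (y * h))) with (sinc0 * sinc0 * h * h * (x * y)) by ring.
      apply Rmult_le_compat_l; [|exact Hxy]. repeat apply Rmult_le_pos; lra.
    - apply Rmult_le_compat; try assumption; repeat apply Rmult_le_pos; lra. }
  assert (Hst0 : 0 < sinc0 * sinc0 * h * h * (d * q)) by (repeat apply Rmult_lt_0_compat; lra).
  apply Rle_trans with (PI * h * ((PI + 1) * (Cmod (2 * z - 1) * h) * / (sinc0 * sinc0 * h * h * (d * q)))).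
  + apply Rmult_le_compat_l; [nra|]. unfold Rdiv. apply Rmult_le_compat; [apply Cmod_ge_0| |exact Hc|].
    * left. apply Rinv_0_lt_compat. lra.
    * apply Rinv_le_contravar; assumption.
  + right. unfold K. field. repeat split; lra.
- intros k. destruct (far_from_Z_neq z d k Hfar) as [N1 N2].
  eapply Clim_ext; [|apply Clim_plus; [apply (Clim_picot_dyadic _ N1)|apply (Clim_picot_dyadic _ N2)]].
  intros p. unfold dup_term. cbv beta. ring.
- rewrite E. eapply CSeries_correct, D.
Qed.

(** * Eisenstein summation *)

(* Sums over Z pair [k] with [-1-k]. *)
Definition zpair (u : Z -> C) (k : nat) : C := (u (Z.of_nat k) + u (- Z.of_nat (S k))%Z)%C.
Definition is_zser (u : Z -> C) (l : C) : Prop := is_CSeries (zpair u) l.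
Definition zser (u : Z -> C) : C := CSeries (zpair u).

Lemma is_zser_ext u v l : (forall n, u n = v n) -> is_zser u l -> is_zser v l.
Proof. intros E. apply is_CSeries_ext. intros k. unfold zpair. now rewrite !E. Qed.

Lemma is_zser_plus u v l m : is_zser u l -> is_zser v m -> is_zser (fun n => u n + v n)%C (l + m)%C.
Proof.
intros H1 H2. eapply is_CSeries_ext; [|exact (is_CSeries_plus _ _ _ _ H1 H2)].
intros k. unfold zpair. ring.
Qed.

Lemma is_zser_scal c u l : is_zser u l -> is_zser (fun n => c * u n)%C (c * l)%C.
Proof.
intros H1. eapply is_CSeries_ext; [|exact (is_CSeries_scal c _ _ H1)].
intros k. unfold zpair. ring.
Qed.

Lemma is_zser_minus u v l m : is_zser u l -> is_zser v m -> is_zser (fun n => u n - v n)%C (l - m)%C.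
Proof.
intros H1 H2. eapply is_CSeries_ext; [|exact (is_CSeries_minus _ _ _ _ H1 H2)].
intros k. unfold zpair. ring.
Qed.

Lemma zser_unique u l : is_zser u l -> zser u = l.
Proof. apply CSeries_unique. Qed.

Lemma is_zser_unique u l m : is_zser u l -> is_zser u m -> l = m.
Proof. apply Clim_unique. Qed.

Definition delta0 (n : Z) : C := if Z.eq_dec n 0 then RtoC 1 else RtoC 0.

Lemma is_zser_delta0 : is_zser delta0 1.
Proof.
assert (H := is_CSeries_finite (zpair delta0) 1).
replace (RtoC 1) with (Csum (zpair delta0) 1).
- apply H. intros k Hk. unfold zpair, delta0. destruct (Z.eq_dec (Z.of_nat k) 0); [lia|].
  destruct Z.eq_dec; [lia|]. ring.
- simpl. unfold zpair, delta0. simpl. ring.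
Qed.

(** The N-th partial sum runs over -N <= n < N, which leaves the boundary values at -N and at N. *)
Lemma is_zser_telescope (g : Z -> C) L :
  Clim (fun N => g (- Z.of_nat N)%Z - g (Z.of_nat N))%C L -> is_zser (fun n => g n - g (n + 1)%Z)%C L.
Proof.
intros H. eapply Clim_ext; [|exact H]. intros N. symmetry.
induction N as [|N IH].
- simpl. ring.
- simpl Csum. rewrite IH. unfold zpair.
  replace (- Z.of_nat (S N) + 1)%Z with (- Z.of_nat N)%Z by lia.
  replace (Z.of_nat N + 1)%Z with (Z.of_nat (S N)) by lia. ring.
Qed.

Definition wt (n : Z) : R := / (1 + IZR n * IZR n).

Lemma wt_pos n : 0 < wt n.
Proof. unfold wt. apply Rinv_0_lt_compat. nra. Qed.

Lemma wt_nat k : wt (Z.of_nat k) = / (1 + INR k * INR k) /\ wt (- Z.of_nat (S k)) <= / (1 + INR k * INR k).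
Proof.
unfold wt. rewrite opp_IZR, <- !INR_IZR_INZ. split; [reflexivity|].
assert (H := pos_INR k). rewrite S_INR. apply Rinv_le_contravar; nra.
Qed.

(** The four sign choices for (m, n) are grouped into one term indexed by two natural numbers, to
    which [CSeries_swap] applies. *)
Theorem zser_swap (b : Z -> Z -> C) (K : R) : 0 <= K ->
  (forall m n, Cmod (b m n) <= K * wt m * wt n) ->
  exists A, is_zser (fun m => zser (fun n => b m n)) A /\ is_zser (fun n => zser (fun m => b m n)) A.
Proof.
intros HK Hb.
set (M := fun k => / (1 + INR k * INR k)).
assert (HM : ex_series M) by apply ex_series_inv_sqr.
assert (PM : forall k, 0 <= M k).
{ intros k. left. unfold M. apply Rinv_0_lt_compat. generalize (pos_INR k). nra. }
assert (Hb2 : forall m (k l : nat) , wt m <= M k -> Cmod (zpair (fun n => b m n) l) <= 2 * K * M k * M l).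
{ intros m k l Hm. unfold zpair. destruct (wt_nat l) as [W1 W2].
  eapply Rle_trans; [apply Cmod_triangle|].
  assert (B1 := Hb m (Z.of_nat l)). assert (B2 := Hb m (- Z.of_nat (S l))%Z).
  assert (P1 := wt_pos m). assert (P2 := wt_pos (- Z.of_nat (S l))).
  rewrite W1 in B1. fold (M l) in B1, W2.
  assert (K * wt m <= K * M k) by (apply Rmult_le_compat_l; lra).
  assert (K * wt m * M l <= K * M k * M l) by (apply Rmult_le_compat_r; auto).
  assert (K * wt m * wt (- Z.of_nat (S l)) <= K * M k * M l).
  { apply Rmult_le_compat; try lra. apply Rmult_le_pos; lra. }
  lra. }
assert (Hb2' : forall n (k l : nat) , wt n <= M l -> Cmod (zpair (fun m => b m n) k) <= 2 * K * M k * M l).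
{ intros n k l Hn. unfold zpair. destruct (wt_nat k) as [W1 W2].
  eapply Rle_trans; [apply Cmod_triangle|].
  assert (B1 := Hb (Z.of_nat k) n). assert (B2 := Hb (- Z.of_nat (S k))%Z n).
  assert (P1 := wt_pos n). assert (P2 := wt_pos (- Z.of_nat (S k))).
  rewrite W1 in B1. fold (M k) in B1, W2. specialize (PM k).
  assert (K * M k * wt n <= K * M k * M l) by (apply Rmult_le_compat_l; [apply Rmult_le_pos|]; lra).
  assert (K * wt (- Z.of_nat (S k)) <= K * M k) by (apply Rmult_le_compat_l; lra).
  assert (K * wt (- Z.of_nat (S k)) * wt n <= K * M k * M l).
  { apply Rmult_le_compat; try lra. apply Rmult_le_pos; lra. }
  lra. }
set (a := fun k l => zpair (fun m => zpair (fun n => b m n) l) k).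
assert (Ha : forall k l, Cmod (a k l) <= 4 * K * M k * M l).
{ intros k l. unfold a. unfold zpair at 1. eapply Rle_trans; [apply Cmod_triangle|].
  destruct (wt_nat k) as [W1 W2].
  assert (B1 := Hb2 (Z.of_nat k) k l (Req_le _ _ W1)). assert (B2 := Hb2 (- Z.of_nat (S k))%Z k l W2). lra. }
assert (E1 : forall k, zpair (fun m => zser (fun n => b m n)) k = CSeries (fun l => a k l)).
{ intros k. symmetry. apply CSeries_unique. destruct (wt_nat k) as [W1 W2].
  apply (is_CSeries_plus (zpair (fun n => b (Z.of_nat k) n)) (zpair (fun n => b (- Z.of_nat (S k))%Z n)));
   apply (CSeries_correct _ (fun l => 2 * K * M k * M l)); (split; [now apply ex_series_scal_R|]);
   intros l; apply Hb2; [apply Req_le|]; assumption. }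
assert (E2 : forall l, zpair (fun n => zser (fun m => b m n)) l = CSeries (fun k => a k l)).
{ intros l. symmetry. apply CSeries_unique. destruct (wt_nat l) as [W1 W2].
  eapply is_CSeries_ext; [|apply is_CSeries_plus].
  2: apply (CSeries_correct (zpair (fun m => b m (Z.of_nat l))) (fun k => M l * (2 * K * M k))).
  3: apply (CSeries_correct (zpair (fun m => b m (- Z.of_nat (S l))%Z)) (fun k => M l * (2 * K * M k))).
  - intros k. unfold a, zpair. ring.
  - split; [apply ex_series_scal_R, ex_series_scal_R, HM|]. intros k.
    eapply Rle_trans; [apply (Hb2' _ k l); apply Req_le, W1|]. right; ring.
  - split; [apply ex_series_scal_R, ex_series_scal_R, HM|]. intros k.
    eapply Rle_trans; [apply (Hb2' _ k l); apply W2|]. right; ring. }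
exists (CSeries (fun k => CSeries (fun l => a k l))). split.
- eapply is_CSeries_ext; [intros k; symmetry; apply E1|].
  apply (CSeries_correct _ (fun k => (4 * K * Series M) * M k)). split; [now apply ex_series_scal_R|].
  intros k. eapply Rle_trans; [apply (Cmod_CSeries _ (fun l => 4 * K * M k * M l))|].
  + split; [now apply ex_series_scal_R|auto].
  + rewrite Series_scal_l. right; ring.
- rewrite (CSeries_swap a (fun k => 4 * K * M k) M); auto.
  + eapply is_CSeries_ext; [intros l; symmetry; apply E2|].
    apply (CSeries_correct _ (fun l => (4 * K * Series M) * M l)). split; [now apply ex_series_scal_R|].
    intros l. eapply Rle_trans; [apply (Cmod_CSeries _ (fun k => (4 * K * M l) * M k))|].
    * split; [now apply ex_series_scal_R|]. intros k. eapply Rle_trans; [apply Ha|]. right; ring.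
    * rewrite Series_scal_l. right; ring.
  + now apply ex_series_scal_R.
  + intros m. apply Rmult_le_pos; [lra|apply PM].
Qed.

(* Determinant over trace of the quadratic form [|m tau + n|^2], a lower bound
   for its smaller eigenvalue. *)
Definition lattice_const (tau : C) : R := Im tau * Im tau / (Cmod tau * Cmod tau + 1).

Lemma lattice_const_pos tau : Im tau <> 0 -> 0 < lattice_const tau.
Proof.
intros H. unfold lattice_const. assert (P := Cmod_ge_0 tau). assert (P2 := Rmult_le_pos _ _ P P).
apply Rdiv_lt_0_compat; [exact (Rsqr_pos_lt _ H)|lra].
Qed.

Lemma lattice_bound tau (m n : R) :
  lattice_const tau * (m * m + n * n) <= Cmod (RtoC m * tau + RtoC n) * Cmod (RtoC m * tau + RtoC n).
Proof.
unfold lattice_const. rewrite !Cmod_sqr, re_plus, im_plus, re_scal_l, im_scal_l, re_RtoC, im_RtoC.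
set (x := Re tau). set (y := Im tau).
assert (Hd : 0 < x * x + y * y + 1) by nra.
apply Rmult_le_reg_r with (x * x + y * y + 1); [exact Hd|].
replace (y * y / (x * x + y * y + 1) * (m * m + n * n) * (x * x + y * y + 1)) with (y * y * (m * m + n * n)) by (field; lra).
(* With N the real part of m tau + n, the difference of the two sides is (x N + y^2 m)^2 + N^2. *)
set (N := m * x + n). replace n with (N - m * x) by (unfold N; ring).
assert (A1 := Rle_0_sqr (x * N + y * y * m)). assert (A2 := Rle_0_sqr N). unfold Rsqr in *.
replace (m * x + (N - m * x)) with N by ring. lra.
Qed.

Lemma far_from_Z_Im z : Im z <> 0 -> far_from_Z z (lattice_const z).
Proof.
intros H. assert (P := lattice_const_pos z H). split; [exact P|]. intros k. assert (Hk := pos_INR k). split.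
- assert (L := lattice_bound z 1 (INR k)).
  replace (RtoC 1 * z + RtoC (INR k))%C with (z + RtoC (INR k))%C in L by ring. nra.
- assert (L := lattice_bound z 1 (- INR (S k))).
  replace (RtoC 1 * z + RtoC (- INR (S k)))%C with (z - RtoC (INR (S k)))%C in L by (rewrite RtoC_opp; ring).
  rewrite S_INR in *. eapply Rle_trans; [|exact L]. apply Rmult_le_compat_l; nra.
Qed.

Lemma Cmod_expi u : Cmod (expi u) = exp (- (PI * Im u)).
Proof. unfold expi. rewrite Cmod_Cexp. f_equal. unfold Re, Im; simpl. ring. Qed.

Lemma csin_Im z : Im z <> 0 -> csin z <> 0.
Proof.
intros H E. assert (P := PI_RGT_0).
assert (E1 : (expi z * expi z)%C = 1).
{ unfold csin in E. assert (N := expi_neq_0 z).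
  assert (X : (expi z - / expi z = 0)%C).
  { replace (expi z - / expi z)%C with ((expi z - / expi z) / (2 * Ci) * (2 * Ci))%C by (field; cnz). rewrite E. ring. }
  apply Ceq_minus in X. rewrite X at 2. field; cnz. }
apply (f_equal Cmod) in E1. rewrite Cmod_mult, Cmod_expi, Cmod_1, <- exp_plus, <- exp_0 in E1.
apply exp_inv in E1. apply H. nra.
Qed.

Lemma RtoC_zpair (z : C) k : (z + RtoC (IZR (Z.of_nat k)) = z + RtoC (INR k))%C /\
  (z + RtoC (IZR (- Z.of_nat (S k))) = z - RtoC (INR (S k)))%C.
Proof. rewrite opp_IZR, <- !INR_IZR_INZ, RtoC_opp. split; ring. Qed.

Lemma pisin2_zser z : Im z <> 0 -> is_zser (fun n => / ((z + RtoC (IZR n)) * (z + RtoC (IZR n))))%C (pisin2 z).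
Proof.
intros H. eapply is_CSeries_ext; [|apply (pisin2_expansion z (lattice_const z)); [now apply csin_Im|now apply far_from_Z_Im]].
intros k. unfold zpair. destruct (RtoC_zpair z k) as [E1 E2]. now rewrite E1, E2.
Qed.

Lemma picot_zser z : Im z <> 0 -> is_zser (fun n => / (z + RtoC (IZR n)))%C (picot z).
Proof.
intros H. eapply is_CSeries_ext; [|apply (picot_expansion z (lattice_const z)); [now apply csin_Im|now apply far_from_Z_Im]].
intros k. unfold zpair. destruct (RtoC_zpair z k) as [E1 E2]. now rewrite E1, E2.
Qed.

(** The expansion of pi^2/sin^2 at z = 1/2 meets every odd square twice and gives pi^2/8 for the sum
    over odd integers. Splitting by parity, the full sum s satisfies s = pi^2/8 + s/4. *)
Lemma basel : is_CSeries (fun k => / RtoC (INR (S k) * INR (S k)))%C (RtoC (PI ^ 2 / 6)).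
Proof.
assert (Half : is_CSeries (fun k => / ((RtoC (/ 2) + RtoC (INR k)) * (RtoC (/ 2) + RtoC (INR k)))
   + / ((RtoC (/ 2) - RtoC (INR (S k))) * (RtoC (/ 2) - RtoC (INR (S k)))))%C (RtoC (PI ^ 2))).
{ assert (E : csin (RtoC (/ 2)) = 1).
  { unfold csin. rewrite expi_half, Ci_inv. field; cnz. }
  replace (RtoC (PI ^ 2)) with (pisin2 (RtoC (/ 2))).
  - apply (pisin2_expansion (RtoC (/ 2)) (/ 4)).
    + rewrite E. apply C1_nz.
    + split; [lra|]. intros k. assert (Hk := pos_INR k).
      rewrite <- RtoC_plus, <- RtoC_minus, !Cmod_R, S_INR.
      rewrite (Rabs_pos_eq (/ 2 + INR k)) by lra.
      rewrite (Rabs_left (/ 2 - (INR k + 1))) by lra. split; nra.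
  - unfold pisin2. rewrite E. field; cnz. }
assert (Odd : is_CSeries (fun k => / RtoC (INR (2 * k + 1) * INR (2 * k + 1)))%C (RtoC (PI ^ 2 / 8))).
{ replace (RtoC (PI ^ 2 / 8)) with (RtoC (/ 8) * RtoC (PI ^ 2))%C by (rewrite <- RtoC_mult; f_equal; field).
  eapply is_CSeries_ext; [|exact (is_CSeries_scal (RtoC (/ 8)) _ _ Half)].
  intros k. cbv beta. assert (Hk := pos_INR k).
  rewrite <- RtoC_plus, <- RtoC_minus, <- !RtoC_mult, <- !RtoC_inv, <- RtoC_plus, <- RtoC_mult;
   rewrite ?plus_INR, ?mult_INR, ?S_INR; simpl INR; try nra.
  f_equal. field. lra. }
set (M := fun k => 2 * / (1 + INR k * INR k)).
assert (D : dominated (fun k => / RtoC (INR (S k) * INR (S k)))%C M).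
{ split; [apply ex_series_scal_R, ex_series_inv_sqr|]. intros k. assert (Hk := pos_INR k).
  rewrite S_INR. rewrite Cmod_inv by (apply RtoC_neq_0; nra). rewrite Cmod_R, Rabs_pos_eq by nra.
  unfold M. replace (2 * / (1 + INR k * INR k)) with (/ ((1 + INR k * INR k) / 2)) by (field; nra).
  apply Rinv_le_contravar; nra. }
assert (L := CSeries_correct _ M D).
set (z2 := CSeries (fun k => / RtoC (INR (S k) * INR (S k)))%C) in *.
assert (L2 : Clim (fun N => Csum (fun k => / RtoC (INR (S k) * INR (S k)))%C (2 * N)) z2).
{ intros e He. destruct (L e He) as [N HN]. exists N. intros n Hn. apply HN. lia. }
assert (L3 : Clim (fun N => Csum (fun k => / RtoC (INR (S k) * INR (S k)))%C (2 * N)) (RtoC (PI ^ 2 / 8) + RtoC (/ 4) * z2)%C).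
{ eapply Clim_ext; [|apply Clim_plus; [exact Odd|apply (Clim_scal (RtoC (/ 4)) _ _ L)]].
  intros N. induction N as [|N IH]; [simpl; ring|].
  replace (2 * S N)%nat with (S (S (2 * N))) by lia. cbv beta in *. cbn [Csum]. rewrite <- IH.
  replace (/ RtoC (INR (S (S (2 * N))) * INR (S (S (2 * N)))))%C with (RtoC (/ 4) * / RtoC (INR (S N) * INR (S N)))%C.
  - rewrite Nat.add_1_r. ring.
  - assert (Hk := pos_INR N).
    rewrite <- !RtoC_inv, <- RtoC_mult; rewrite ?S_INR, ?mult_INR; simpl INR; try nra.
    f_equal. field. lra. }
assert (E := Clim_unique _ _ _ L2 L3).
replace (RtoC (PI ^ 2 / 6)) with z2; [exact L|].
assert (E' : (RtoC (3 / 4) * z2 = RtoC (PI ^ 2 / 8))%C).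
{ replace (RtoC (3 / 4)) with (1 - RtoC (/ 4))%C by (rewrite <- RtoC_minus; f_equal; field).
  replace ((1 - RtoC (/ 4)) * z2)%C with (z2 - RtoC (/ 4) * z2)%C by ring. rewrite E at 1. ring. }
replace z2 with (RtoC (4 / 3) * (RtoC (3 / 4) * z2))%C.
- rewrite E', <- RtoC_mult. f_equal. field.
- rewrite Cmult_assoc, <- RtoC_mult. replace (4 / 3 * (3 / 4)) with 1 by field. ring.
Qed.

Lemma ccos_opp a : ccos (- a) = ccos a.
Proof.
assert (E : expi (- a) = (/ expi a)%C).
{ unfold expi. rewrite <- Cexp_opp. f_equal. ring. }
unfold ccos. rewrite E. assert (Ha := expi_neq_0 a). field; cnz.
Qed.

Lemma picot_opp a : csin a <> 0 -> picot (- a) = (- picot a)%C.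
Proof. intros H. unfold picot. rewrite ccos_opp, csin_opp. field; cnz. Qed.

Lemma pisin2_opp a : pisin2 (- a) = pisin2 a.
Proof. unfold pisin2. rewrite csin_opp. f_equal. ring. Qed.

(** As a function of E = exp(pi i z), the function pi cot(pi z) is pi i (E^2 + 1)/(E^2 - 1), which
    is continuous at E = 0. *)
Lemma picot_limit (z : nat -> C) : (forall n, Im (z n) <> 0) ->
  Clim (fun n => expi (z n)) 0 -> Clim (fun n => picot (z n)) (- (RtoC PI * Ci)).
Proof.
intros Hz H.
set (f := fun E : C => (RtoC PI * Ci * ((E * E + 1) / (E * E - 1)))%C).
assert (Hf : exists l, cder f 0 l).
{ eexists. unfold f. apply cder_scal. apply cder_div.
  - replace (0 * 0 - 1)%C with (- (1))%C by ring. intros E. apply C1_nz.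
    replace (RtoC 1) with (- - (1))%C by ring. rewrite E. ring.
  - apply cder_plus; [apply cder_mult; apply cder_id|apply cder_const].
  - apply cder_minus; [apply cder_mult; apply cder_id|apply cder_const]. }
destruct Hf as [l Hl].
assert (L := Clim_cder _ _ _ _ Hl H).
replace (f 0) with (- (RtoC PI * Ci))%C in L.
- eapply Clim_ext; [|exact L]. intros n. unfold f, picot.
  assert (N := csin_Im _ (Hz n)). unfold csin, ccos in *. assert (N2 := expi_neq_0 (z n)).
  set (E := expi (z n)) in *.
  assert (N3 : (E * E - 1)%C <> 0).
  { intros X. apply N. replace ((E - / E) / (2 * Ci))%C with ((E * E - 1) / (2 * Ci * E))%C by (field; cnz). rewrite X. field; cnz. }
  assert (N4 : (E - / E)%C <> 0).
  { intros X. apply N3. replace (E * E - 1)%C with (E * (E - / E))%C by (field; cnz). rewrite X. ring. }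
  field; cnz.
- unfold f. field.
Qed.

Lemma exp_nat (x : R) n : exp (INR n * x) = exp x ^ n.
Proof.
induction n as [|n IH]; [simpl; rewrite Rmult_0_l; apply exp_0|].
rewrite S_INR, Rmult_plus_distr_r, exp_plus, IH, Rmult_1_l. simpl. ring.
Qed.

Lemma expi_limit (z : nat -> C) c e : 0 < c -> (forall n, Im (z n) = c * INR n + e) ->
  Clim (fun n => expi (z n)) 0.
Proof.
intros Hc Hz. assert (P := PI_RGT_0).
apply (Clim_squeeze _ _ (fun n => exp (- (PI * e)) * exp (- (PI * c)) ^ n)).
- intros n. replace (expi (z n) - 0)%C with (expi (z n)) by ring.
  rewrite Cmod_expi, Hz, <- exp_nat, <- exp_plus. right. f_equal. ring.
- replace (Finite 0) with (Rbar_mult (exp (- (PI * e))) (Finite 0)) by (simpl; f_equal; ring).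
  apply is_lim_seq_scal_l, is_lim_seq_geom.
  rewrite Rabs_pos_eq by (left; apply exp_pos). rewrite <- exp_0. apply exp_increasing. nra.
Qed.

(** This is 2 zeta(2). *)
Definition basel2 : C := RtoC (PI ^ 2 / 3).

Lemma basel2_zser : is_zser (fun n => if Z.eq_dec n 0 then RtoC 0 else / RtoC (IZR n * IZR n))%C basel2.
Proof.
assert (B := basel).
set (u := fun k : nat => if Z.eq_dec (Z.of_nat k) 0 then RtoC 0 else (/ RtoC (INR k * INR k))%C).
assert (U : is_CSeries u (u 0%nat + RtoC (PI ^ 2 / 6))%C).
{ apply is_CSeries_shift. eapply is_CSeries_ext; [|exact B]. intros k. unfold u. destruct Z.eq_dec; [lia|reflexivity]. }
assert (S := is_CSeries_plus _ _ _ _ U B).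
replace basel2 with (u 0%nat + RtoC (PI ^ 2 / 6) + RtoC (PI ^ 2 / 6))%C.
2:{ unfold basel2, u. simpl. rewrite Cplus_0_l, <- RtoC_plus. f_equal. field. }
eapply is_CSeries_ext; [|exact S].
intros k. unfold zpair, u. rewrite opp_IZR, <- !INR_IZR_INZ.
destruct (Z.eq_dec (- Z.of_nat (Datatypes.S k)) 0); [lia|].
replace (- INR (Datatypes.S k) * - INR (Datatypes.S k)) with (INR (Datatypes.S k) * INR (Datatypes.S k)) by ring. reflexivity.
Qed.

(** * The double sum over the lattice, in both orders *)

Section Lattice.

Variable tau : C.
Hypothesis Htau : 0 < Im tau.

Let w (m n : Z) : C := (RtoC (IZR m) * tau + RtoC (IZR n))%C.
Let v (m n : Z) : C := ((w m n - RtoC (/ 2)) * (w m n + RtoC (/ 2)))%C.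

(* Eisenstein's summation is made absolutely convergent by subtracting the
   telescoping terms [1 / (w - 1/2) - 1 / (w + 1/2) = 1 / (w^2 - 1/4)]. *)
Let b (m n : Z) : C :=
  if Z.eq_dec (m * m + n * n) 0 then RtoC 0 else (/ (w m n * w m n) - / v m n)%C.

Lemma tau_neq_0 : tau <> 0.
Proof. intros E. rewrite E in Htau. simpl in Htau. lra. Qed.

Lemma lat_pos : 0 < lattice_const tau.
Proof. apply lattice_const_pos. lra. Qed.

Lemma lat_w m n : lattice_const tau * (IZR m * IZR m + IZR n * IZR n) <= Cmod (w m n) * Cmod (w m n).
Proof. apply lattice_bound. Qed.

(** For an integer n both |n - 1/2| and |n + 1/2| are at least 1/2 and at least |n|/2; so the points
    w - 1/2 and w + 1/2 avoid 0 and grow like w. *)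
Lemma half_int n : (/ 4) * (1 + IZR n * IZR n) <= (IZR n - / 2) * (IZR n - / 2) + / 4
  /\ (/ 4) * (1 + IZR n * IZR n) <= (IZR n + / 2) * (IZR n + / 2) + / 4
  /\ / 4 <= (IZR n - / 2) * (IZR n - / 2) /\ / 4 <= (IZR n + / 2) * (IZR n + / 2)
  /\ (/ 4) * (IZR n * IZR n) <= (IZR n - / 2) * (IZR n - / 2)
  /\ (/ 4) * (IZR n * IZR n) <= (IZR n + / 2) * (IZR n + / 2).
Proof.
assert (H : (n <= -1 \/ n = 0 \/ 1 <= n)%Z) by lia.
destruct H as [H|[H|H]].
- apply IZR_le in H. nra.
- subst n. lra.
- apply IZR_le in H. nra.
Qed.

Lemma lat_v m n : lattice_const tau * (/ 4) * (IZR m * IZR m + IZR n * IZR n) <= Cmod (w m n - RtoC (/ 2)) * Cmod (w m n - RtoC (/ 2))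
 /\ lattice_const tau * (/ 4) * (IZR m * IZR m + IZR n * IZR n) <= Cmod (w m n + RtoC (/ 2)) * Cmod (w m n + RtoC (/ 2))
 /\ (w m n - RtoC (/ 2))%C <> 0 /\ (w m n + RtoC (/ 2))%C <> 0.
Proof.
assert (L := lat_pos). destruct (half_int n) as [_ [_ [B1 [B2 [B3 B4]]]]].
assert (L1 := lattice_bound tau (IZR m) (IZR n - / 2)). assert (L2 := lattice_bound tau (IZR m) (IZR n + / 2)).
replace (RtoC (IZR m) * tau + RtoC (IZR n - / 2))%C with (w m n - RtoC (/ 2))%C in L1
  by (unfold w; rewrite RtoC_minus; ring).
replace (RtoC (IZR m) * tau + RtoC (IZR n + / 2))%C with (w m n + RtoC (/ 2))%C in L2
  by (unfold w; rewrite RtoC_plus; ring).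
assert (M := Rle_0_sqr (IZR m)). unfold Rsqr in M.
repeat split.
- eapply Rle_trans; [|exact L1]. rewrite Rmult_assoc. apply Rmult_le_compat_l; lra.
- eapply Rle_trans; [|exact L2]. rewrite Rmult_assoc. apply Rmult_le_compat_l; lra.
- intros E. rewrite E, Cmod_0 in L1. nra.
- intros E. rewrite E, Cmod_0 in L2. nra.
Qed.

Lemma lat_neq m n : (m * m + n * n <> 0)%Z -> w m n <> 0 /\ 1 <= IZR m * IZR m + IZR n * IZR n.
Proof.
intros H. assert (H1 : (1 <= m * m + n * n)%Z) by nia.
apply IZR_le in H1. rewrite plus_IZR, !mult_IZR in H1. split; [|exact H1].
intros E. assert (L := lat_w m n). rewrite E, Cmod_0 in L. assert (P := lat_pos). nra.
Qed.

(** Away from the origin the term is -1/4 over w^2 (w^2 - 1/4), of order (m^2 + n^2)^(-2). The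
    inequality 4 (m^2 + n^2)^2 >= (1 + m^2)(1 + n^2) turns this into a product of weights. *)
Lemma eisenstein_term_bound m n : Cmod (b m n) <= / (lattice_const tau * lattice_const tau) * 4 * wt m * wt n.
Proof.
assert (P := lat_pos). assert (Pm := wt_pos m). assert (Pn := wt_pos n).
assert (P2 : 0 < / (lattice_const tau * lattice_const tau)) by (apply Rinv_0_lt_compat; nra).
unfold b. destruct Z.eq_dec as [E|E].
- rewrite Cmod_0. repeat apply Rmult_le_pos; lra.
- destruct (lat_neq m n E) as [N S1]. destruct (lat_v m n) as [V1 [V2 [N1 N2]]].
  assert (L := lat_w m n).
  replace (/ (w m n * w m n) - / v m n)%C with (- RtoC (/ 4) / (w m n * w m n * ((w m n - RtoC (/ 2)) * (w m n + RtoC (/ 2)))))%C.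
  2:{ unfold v. replace (RtoC (/ 4)) with (RtoC (/ 2) * RtoC (/ 2))%C by (rewrite <- RtoC_mult; f_equal; field). field; cnz. }
  rewrite Cmod_div by cnz. rewrite Cmod_opp, Cmod_R, Rabs_pos_eq, !Cmod_mult by lra.
  apply Cmod_gt_0 in N. apply Cmod_gt_0 in N1. apply Cmod_gt_0 in N2.
  set (c := lattice_const tau) in *. set (x := Cmod (w m n)) in *.
  set (y1 := Cmod (w m n - RtoC (/ 2))) in *. set (y2 := Cmod (w m n + RtoC (/ 2))) in *.
  set (s := IZR m * IZR m + IZR n * IZR n) in *.
  assert (Y : c * / 4 * s <= y1 * y2).
  { apply Rsqr_incr_0_var; [|nra]. unfold Rsqr.
    replace (y1 * y2 * (y1 * y2)) with ((y1 * y1) * (y2 * y2)) by ring.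
    apply Rmult_le_compat; nra. }
  assert (cs : 0 < c * s) by nra.
  assert (T : c * s * (c * / 4 * s) <= x * x * (y1 * y2)) by (apply Rmult_le_compat; nra).
  apply Rle_trans with (/ 4 * / (c * s * (c * / 4 * s))).
  + unfold Rdiv. apply Rmult_le_compat_l; [lra|]. apply Rinv_le_contravar; [|exact T].
    apply Rmult_lt_0_compat; [lra|nra].
  + replace (/ 4 * / (c * s * (c * / 4 * s))) with (/ (c * c) * / (s * s)) by (field; split; nra).
    rewrite !Rmult_assoc. apply Rmult_le_compat_l; [lra|].
    unfold wt. assert (Q1 := Rle_0_sqr (IZR m)). assert (Q2 := Rle_0_sqr (IZR n)). unfold Rsqr in Q1, Q2.
    fold s. set (p := IZR m * IZR m) in *. set (q := IZR n * IZR n) in *.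
    replace (4 * (/ (1 + p) * / (1 + q))) with (/ ((1 + p) * (1 + q) / 4)) by (field; lra).
    assert (Es : s = p + q) by reflexivity.
    apply Rinv_le_contravar; nra.
Qed.

Lemma Cmod_large_limit (z : nat -> C) K : (forall n, INR n - K <= Cmod (z n)) -> Clim (fun n => / z n)%C 0.
Proof.
intros H e He.
destruct (nfloor_ex (Rabs K + / e + 1)) as [N [_ HN]].
{ assert (0 < / e) by now apply Rinv_0_lt_compat. generalize (Rabs_pos K). lra. }
exists (S N). intros n Hn. apply le_INR in Hn. rewrite S_INR in Hn. specialize (H n).
assert (HK := Rle_abs K). assert (Pe : 0 < / e) by now apply Rinv_0_lt_compat.
assert (Q : / e < Cmod (z n)) by lra.
assert (Nz : z n <> 0) by (apply Cmod_gt_0; lra).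
replace (/ z n - 0)%C with (/ z n)%C by ring. rewrite Cmod_inv by exact Nz.
rewrite <- (Rinv_inv e). apply Rinv_lt_contravar; [nra|exact Q].
Qed.

Lemma v_split m n : (/ v m n = / (w m n - RtoC (/ 2)) - / (w m (n + 1) - RtoC (/ 2)))%C.
Proof.
destruct (lat_v m n) as [_ [_ [N1 N2]]].
replace (w m (n + 1) - RtoC (/ 2))%C with (w m n + RtoC (/ 2))%C.
2:{ unfold w. rewrite plus_IZR, RtoC_plus. replace (RtoC 1) with (RtoC (/ 2) + RtoC (/ 2))%C by (rewrite <- RtoC_plus; f_equal; field). ring. }
unfold v. field_simplify; [|cnz|cnz]. f_equal.
rewrite <- RtoC_mult. f_equal. field.
Qed.

Lemma v_rows m : is_zser (fun n => / v m n)%C 0.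
Proof.
apply (is_zser_ext (fun n => / (w m n - RtoC (/ 2)) - / (w m (n + 1) - RtoC (/ 2)))%C).
{ intros n. symmetry. apply v_split. }
apply (is_zser_telescope (fun n => / (w m n - RtoC (/ 2)))%C).
replace (RtoC 0) with (0 - 0)%C by ring.
set (K := Cmod (RtoC (IZR m) * tau - RtoC (/ 2))).
apply Clim_minus; apply Cmod_large_limit with K; intros N; unfold w.
- replace (RtoC (IZR m) * tau + RtoC (IZR (- Z.of_nat N)) - RtoC (/ 2))%C
   with (- (RtoC (INR N) - (RtoC (IZR m) * tau - RtoC (/ 2))))%C.
  2:{ rewrite opp_IZR, RtoC_opp, <- INR_IZR_INZ. ring. }
  rewrite Cmod_opp. eapply Rle_trans; [|apply Cmod_triangle_rev].
  rewrite Cmod_R, Rabs_pos_eq by apply pos_INR. unfold K. lra.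
- replace (RtoC (IZR m) * tau + RtoC (IZR (Z.of_nat N)) - RtoC (/ 2))%C
   with (RtoC (INR N) - - (RtoC (IZR m) * tau - RtoC (/ 2)))%C.
  2:{ rewrite <- INR_IZR_INZ. ring. }
  eapply Rle_trans; [|apply Cmod_triangle_rev].
  rewrite Cmod_R, Rabs_pos_eq, Cmod_opp by apply pos_INR. unfold K. lra.
Qed.

(* The row sums of Eisenstein's series; the row through the origin omits it. *)
Definition eis_row (t : C) (m : Z) : C := if Z.eq_dec m 0 then basel2 else pisin2 (RtoC (IZR m) * t)%C.

(** The telescoping terms of a row sum to 0. At the origin 1/v = -4, while [b] is 0 there by
    convention, so the row m = 0 falls short by 4. *)
Lemma eisenstein_row_sum m : zser (fun n => b m n) = (eis_row tau m - 4 * delta0 m)%C.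
Proof.
apply zser_unique. unfold eis_row, delta0. destruct (Z.eq_dec m 0) as [->|Hm].
- assert (H := is_zser_minus _ _ _ _ basel2_zser (is_zser_plus _ _ _ _ (v_rows 0) (is_zser_scal 4 _ _ is_zser_delta0))).
  replace (basel2 - 4 * 1)%C with (basel2 - (0 + 4 * 1))%C by ring.
  eapply is_zser_ext; [|exact H]. intros n. unfold b, delta0. rewrite Z.mul_0_l, Z.add_0_l.
  destruct (Z.eq_dec n 0) as [->|Hn].
  + simpl. unfold v, w.
    replace (RtoC (/ 2)) with (/ 2)%C by (rewrite RtoC_inv by lra; reflexivity). field; cnz.
  + destruct Z.eq_dec; [nia|].
    replace (w 0 n * w 0 n)%C with (RtoC (IZR n * IZR n)) by (unfold w; rewrite RtoC_mult; ring). ring.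
- replace (pisin2 (RtoC (IZR m) * tau) - 4 * 0)%C with (pisin2 (RtoC (IZR m) * tau) - 0)%C by ring.
  assert (Hi : Im (RtoC (IZR m) * tau) <> 0).
  { rewrite im_scal_l. apply not_0_IZR in Hm. nra. }
  assert (H := is_zser_minus _ _ _ _ (pisin2_zser _ Hi) (v_rows m)).
  eapply is_zser_ext; [|exact H]. intros n. unfold b. destruct Z.eq_dec; [nia|reflexivity].
Qed.

Lemma Im_inv_tau : Im (/ tau) < 0.
Proof.
unfold Im, Cinv; simpl. unfold Rdiv. rewrite Ropp_mult_distr_l_reverse.
apply Ropp_lt_gt_0_contravar, Rmult_lt_0_compat; [exact Htau|].
apply Rinv_0_lt_compat. unfold Im in Htau. nra.
Qed.

Let z (n : Z) : C := (RtoC (IZR n - / 2) * / tau)%C.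

Lemma Im_z n : Im (z n) <> 0.
Proof.
unfold z. rewrite im_scal_l. assert (H := Im_inv_tau). destruct (half_int n) as [_ [_ [H2 _]]]. nra.
Qed.

(** In the other order the subtracted terms no longer sum to 0: their partial fractions in m give a
    difference of cotangents. *)
Lemma v_column n : is_zser (fun m => / v m n)%C (/ tau * (picot (z n) - picot (z (n + 1))))%C.
Proof.
assert (T0 := tau_neq_0).
assert (H := is_zser_scal (/ tau) _ _ (is_zser_minus _ _ _ _ (picot_zser _ (Im_z n)) (picot_zser _ (Im_z (n + 1))))).
eapply is_zser_ext; [|exact H]. intros m. cbv beta.
destruct (lat_v m n) as [_ [_ [N1 N2]]].
assert (E1 : (w m n - RtoC (/ 2) = tau * (z n + RtoC (IZR m)))%C).
{ unfold w, z. rewrite RtoC_minus. field; cnz. }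
assert (E2 : (w m n + RtoC (/ 2) = tau * (z (n + 1) + RtoC (IZR m)))%C).
{ unfold w, z. rewrite plus_IZR. replace (IZR n + 1 - / 2) with (IZR n + / 2) by field. rewrite RtoC_plus. field; cnz. }
assert (E3 : (w m n + RtoC (/ 2) - (w m n - RtoC (/ 2)) = 1)%C).
{ replace (w m n + RtoC (/ 2) - (w m n - RtoC (/ 2)))%C with (RtoC (/ 2) + RtoC (/ 2))%C by ring.
  rewrite <- RtoC_plus. f_equal. field. }
unfold v. rewrite E1, E2 in *.
assert (M1 : (z n + RtoC (IZR m))%C <> 0) by (intros X; apply N1; rewrite X; ring).
assert (M2 : (z (n + 1) + RtoC (IZR m))%C <> 0) by (intros X; apply N2; rewrite X; ring).
set (A := (z n + RtoC (IZR m))%C) in *. set (B := (z (n + 1) + RtoC (IZR m))%C) in *.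
replace (/ (tau * A * (tau * B)))%C with ((tau * B - tau * A) * / (tau * A * (tau * B)))%C by (rewrite E3; ring).
field; cnz.
Qed.

Lemma eisenstein_column_sum n : zser (fun m => b m n)
  = (/ (tau * tau) * eis_row (- / tau) n - / tau * (picot (z n) - picot (z (n + 1))) - 4 * delta0 n)%C.
Proof.
assert (T0 := tau_neq_0).
apply zser_unique. unfold eis_row, delta0. destruct (Z.eq_dec n 0) as [->|Hn].
- assert (H := is_zser_minus _ _ _ _ (is_zser_minus _ _ _ _ (is_zser_scal (/ (tau * tau)) _ _ basel2_zser) (v_column 0))
    (is_zser_scal 4 _ _ is_zser_delta0)).
  eapply is_zser_ext; [|exact H]. intros m. unfold b, delta0. rewrite Z.mul_0_l, Z.add_0_r.
  destruct (Z.eq_dec m 0) as [->|Hm].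
  + simpl. unfold v, w.
    replace (RtoC (/ 2)) with (/ 2)%C by (rewrite RtoC_inv by lra; reflexivity). field; cnz.
  + destruct Z.eq_dec; [nia|].
    assert (M : RtoC (IZR m) <> 0) by (apply RtoC_neq_0, not_0_IZR, Hm).
    replace (/ (w m 0 * w m 0))%C with (/ (tau * tau) * / RtoC (IZR m * IZR m))%C; [ring|].
    unfold w. rewrite RtoC_mult. simpl. rewrite Cplus_0_r. field; cnz.
- assert (Hi : Im (- (RtoC (IZR n) * - / tau)) <> 0).
  { replace (- (RtoC (IZR n) * - / tau))%C with (RtoC (IZR n) * / tau)%C by ring.
    rewrite im_scal_l. apply not_0_IZR in Hn. assert (H := Im_inv_tau). nra. }
  rewrite <- pisin2_opp.
  assert (H := is_zser_minus _ _ _ _ (is_zser_scal (/ (tau * tau)) _ _ (pisin2_zser _ Hi)) (v_column n)).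
  match goal with |- is_zser _ (Cminus ?x ?y) => replace (Cminus x y) with x by ring end.
  eapply is_zser_ext; [|exact H]. intros m. unfold b. destruct Z.eq_dec; [nia|]. cbv beta. f_equal.
  assert (N : (m * m + n * n <> 0)%Z) by nia. destruct (lat_neq m n N) as [N0 _].
  assert (E : w m n = (tau * (- (RtoC (IZR n) * - / tau) + RtoC (IZR m)))%C) by (unfold w; field; cnz).
  rewrite E in *. assert (M1 : (- (RtoC (IZR n) * - / tau) + RtoC (IZR m))%C <> 0) by (intros X; apply N0; rewrite X; ring).
  set (A := (- (RtoC (IZR n) * - / tau) + RtoC (IZR m))%C) in *. field; cnz.
Qed.

(** As n goes to minus and plus infinity, Im (z n) tends to plus and minus infinity, where the
    cotangent terms tend to -pi i and pi i. The jump -2 pi i is the source of the anomaly of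
    [E2]. *)
Lemma z_telescope : is_zser (fun n => picot (z n) - picot (z (n + 1)))%C (- (2 * (RtoC PI * Ci))).
Proof.
apply (is_zser_telescope (fun n => picot (z n))).
replace (- (2 * (RtoC PI * Ci)))%C with (- (RtoC PI * Ci) - - - (RtoC PI * Ci))%C by ring.
assert (Hy := Im_inv_tau).
assert (Iz : forall n, Im (z n) = (- Im (/ tau)) * (- IZR n) + (- Im (/ tau)) * / 2).
{ intros n. unfold z. rewrite im_scal_l. ring. }
apply Clim_minus.
- apply picot_limit; [intros; apply Im_z|].
  apply (expi_limit _ (- Im (/ tau)) (- Im (/ tau) * / 2)); [lra|]. intros n.
  rewrite Iz, opp_IZR, <- INR_IZR_INZ. ring.
- apply (Clim_ext (fun n => - picot (- z (Z.of_nat n)))%C).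
  { intros n. rewrite picot_opp by apply csin_Im, Im_z. ring. }
  apply Clim_opp, picot_limit; [intros n; rewrite im_opp; generalize (Im_z (Z.of_nat n)); lra|].
  apply (expi_limit _ (- Im (/ tau)) (Im (/ tau) * / 2)); [lra|]. intros n.
  rewrite im_opp, Iz, <- INR_IZR_INZ. ring.
Qed.

(** The rows and the columns of [b] have one common sum A; restoring the 4 lost at the origin gives
    G = A + 4. *)
Theorem eisenstein_S : exists G, is_zser (eis_row tau) G /\
  is_zser (eis_row (- / tau)) (tau * tau * G - 2 * (RtoC PI * Ci) * tau)%C.
Proof.
assert (T0 := tau_neq_0). assert (P := lat_pos).
destruct (zser_swap b (/ (lattice_const tau * lattice_const tau) * 4)) as [A [H1 H2]].
- left. apply Rmult_lt_0_compat; [apply Rinv_0_lt_compat; nra|lra].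
- apply eisenstein_term_bound.
- exists (A + 4)%C. split.
  + assert (H := is_zser_plus _ _ _ _ H1 (is_zser_scal 4 _ _ is_zser_delta0)).
    replace (A + 4)%C with (A + 4 * 1)%C by ring.
    eapply is_zser_ext; [|exact H]. intros m. cbv beta. rewrite eisenstein_row_sum. ring.
  + assert (H := is_zser_scal (tau * tau) _ _ (is_zser_plus _ _ _ _ (is_zser_plus _ _ _ _ H2 (is_zser_scal 4 _ _ is_zser_delta0))
      (is_zser_scal (/ tau) _ _ z_telescope))).
    replace (tau * tau * (A + 4) - 2 * (RtoC PI * Ci) * tau)%C
     with (tau * tau * (A + 4 * 1 + / tau * - (2 * (RtoC PI * Ci))))%C by (field; cnz).
    eapply is_zser_ext; [|exact H]. intros n. cbv beta. rewrite eisenstein_column_sum. field; cnz.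
Qed.

End Lattice.

(** * Quasimodularity of E2 *)

Lemma ex_series_poly_geom r : 0 < r < 1 -> ex_series (fun n => INR (S n) ^ 3 * r ^ n).
Proof.
intros [Hr0 Hr1]. apply ex_series_Rabs, (ex_series_DAlembert _ r Hr1).
- intros n. apply Rmult_integral_contrapositive; split; apply pow_nonzero; [apply not_0_INR; lia|lra].
- apply (is_lim_seq_ext (fun n => (1 + / INR (S n)) ^ 3 * r)).
  + intros n. assert (H : 0 < INR (S n)) by (apply lt_0_INR; lia).
    assert (Hp : r ^ n <> 0) by (apply pow_nonzero; lra).
    rewrite Rabs_pos_eq.
    * rewrite (S_INR (S n)). set (x := INR (S n)) in *. change (r ^ S n) with (r * r ^ n). field. lra.
    * apply Rdiv_le_0_compat.
      -- apply Rmult_le_pos; apply pow_le; [apply pos_INR|lra].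
      -- apply Rmult_lt_0_compat; apply pow_lt; lra.
  + replace r with ((1 + 0) ^ 3 * r) at 1 by ring.
    assert (L : is_lim_seq (fun n => 1 + / INR (S n)) (1 + 0)).
    { apply is_lim_seq_plus'; [apply is_lim_seq_const|].
      apply (is_lim_seq_incr_1 (fun n => / INR n)).
      apply (is_lim_seq_inv INR p_infty); [apply is_lim_seq_INR|discriminate]. }
    apply is_lim_seq_mult'; [|apply is_lim_seq_const]. simpl.
    repeat (apply is_lim_seq_mult'; [exact L|]). apply is_lim_seq_const.
Qed.

Definition cube_S (n : nat) : R := INR (S n) ^ 3.

Lemma cube_S_ge n : 1 <= INR (S n) /\ INR (S n) <= cube_S n /\ 1 <= cube_S n /\ INR (S n) ^ 2 <= cube_S n.
Proof.
assert (H : 1 <= INR (S n)) by (rewrite S_INR; generalize (pos_INR n); lra).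
unfold cube_S. set (x := INR (S n)) in *. simpl. nra.
Qed.

Lemma ex_series_geom_R r : 0 < r < 1 -> ex_series (fun n => r ^ n).
Proof. intros H. apply ex_series_geom. rewrite Rabs_pos_eq; lra. Qed.

Lemma Cmod_lt_mid (q : C) : Cmod q < 1 -> exists r, Cmod q <= r /\ 0 < r < 1.
Proof. intros H. exists ((1 + Cmod q) / 2). generalize (Cmod_ge_0 q). lra. Qed.

Lemma one_minus_neq_0 (y : C) : Cmod y < 1 -> (1 - y)%C <> 0.
Proof.
intros H. apply Cmod_gt_0. generalize (Cmod_triangle_rev 1 y). rewrite Cmod_1. lra.
Qed.

(** Disposes of the remainders of the next three series, whose partial sums are closed forms minus
    y^(n+1) p(n) with p of at most cubic growth. *)
Lemma poly_geom_limit (y : C) (p : nat -> C) K : Cmod y < 1 -> (forall n, Cmod (p n) <= K * cube_S n) ->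
  Clim (fun n => y ^ S n * p n)%C 0.
Proof.
intros Hy Hp. destruct (Cmod_lt_mid y Hy) as [r [Hr Hr1]].
apply (Clim_squeeze _ _ (fun n => (K * r) * (INR (S n) ^ 3 * r ^ n))).
- intros n. replace (y ^ S n * p n - 0)%C with (y ^ S n * p n)%C by ring.
  rewrite Cmod_mult, Cmod_pow.
  apply Rle_trans with (r ^ S n * (K * cube_S n)).
  + apply Rmult_le_compat; auto using Cmod_ge_0.
    * apply pow_le, Cmod_ge_0.
    * apply pow_incr. split; [apply Cmod_ge_0|exact Hr].
  + right. unfold cube_S. simpl (r ^ S n). ring.
- replace (Finite 0) with (Rbar_mult (K * r) (Finite 0)) by (simpl; f_equal; ring).
  apply is_lim_seq_scal_l. apply ex_series_lim_0, ex_series_poly_geom, Hr1.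
Qed.

Lemma geom_series (y : C) : Cmod y < 1 -> is_CSeries (fun n => y ^ S n)%C (y / (1 - y))%C.
Proof.
intros Hy. assert (N := one_minus_neq_0 y Hy).
assert (L := poly_geom_limit y (fun _ => / (1 - y))%C (Cmod (/ (1 - y))) Hy).
assert (L' := Clim_minus _ _ _ _ (Clim_const (y / (1 - y))%C) (L ltac:(intros n; destruct (cube_S_ge n) as [_ [_ [H _]]]; generalize (Cmod_ge_0 (/ (1 - y))); nra))).
replace (y / (1 - y) - 0)%C with (y / (1 - y))%C in L' by ring.
eapply Clim_ext; [|exact L']. intros n. cbv beta.
induction n as [|n IH].
- simpl. field; cnz.
- cbn [Csum]. rewrite <- IH. simpl Cpow. field; cnz.
Qed.

Lemma geom_series_1 (y : C) : Cmod y < 1 ->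
  is_CSeries (fun n => RtoC (INR (S n)) * y ^ S n)%C (y / ((1 - y) * (1 - y)))%C.
Proof.
intros Hy. assert (N := one_minus_neq_0 y Hy).
set (p := fun n => (RtoC (INR (S n)) * / (1 - y) + y / ((1 - y) * (1 - y)))%C).
assert (L := poly_geom_limit y p (Cmod (/ (1 - y)) + Cmod (y / ((1 - y) * (1 - y)))) Hy).
assert (L' := Clim_minus _ _ _ _ (Clim_const (y / ((1 - y) * (1 - y)))%C) (L ltac:(
  intros n; destruct (cube_S_ge n) as [H0 [H1 [H2 _]]];
  unfold p; eapply Rle_trans; [apply Cmod_triangle|]; rewrite (Cmod_mult (RtoC _)), Cmod_R, Rabs_pos_eq by lra;
  generalize (Cmod_ge_0 (/ (1 - y))) (Cmod_ge_0 (y / ((1 - y) * (1 - y)))); nra))).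
match type of L' with Clim _ ?l => replace l with (y / ((1 - y) * (1 - y)))%C in L' by ring end.
eapply Clim_ext; [|exact L']. intros n. cbv beta. unfold p.
induction n as [|n IH].
- simpl. field; cnz.
- cbn [Csum]. rewrite <- IH. rewrite (S_INR (S n)), RtoC_plus. simpl Cpow. field; cnz.
Qed.

Lemma geom_series_3 (y : C) : Cmod y < 1 ->
  is_CSeries (fun n => RtoC (INR (S n) ^ 3) * y ^ S n)%C
   (y * (1 + 4 * y + y * y) / ((1 - y) * (1 - y) * ((1 - y) * (1 - y))))%C.
Proof.
intros Hy. assert (N := one_minus_neq_0 y Hy).
(* The remainder is y^(n+1) times the sum over j >= 0 of (n + 1 + j)^3 y^j; expanding the cube gives
   the coefficients [s0] to [s3] of the powers of n + 1. *)
set (s0 := (/ (1 - y))%C). set (s1 := (3 * (y / ((1 - y) * (1 - y))))%C).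
set (s2 := (3 * (y * (1 + y) / ((1 - y) * (1 - y) * (1 - y))))%C).
set (s3 := (y * (1 + 4 * y + y * y) / ((1 - y) * (1 - y) * ((1 - y) * (1 - y))))%C).
set (p := fun n => (RtoC (INR (S n) ^ 3) * s0 + RtoC (INR (S n) ^ 2) * s1 + RtoC (INR (S n)) * s2 + s3)%C).
assert (L := poly_geom_limit y p (Cmod s0 + Cmod s1 + Cmod s2 + Cmod s3) Hy).
assert (L' := Clim_minus _ _ _ _ (Clim_const s3) (L ltac:(
  intros n; destruct (cube_S_ge n) as [H0 [H1 [H2 H3]]];
  unfold p; eapply Rle_trans; [apply Cmod_triangle|];
  eapply Rle_trans; [apply Rplus_le_compat_r, Cmod_triangle|];
  eapply Rle_trans; [apply Rplus_le_compat_r, Rplus_le_compat_r, Cmod_triangle|];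
  rewrite !Cmod_mult, !Cmod_R, !Rabs_pos_eq by (try apply pow_le; lra); fold (cube_S n);
  generalize (Cmod_ge_0 s0) (Cmod_ge_0 s1) (Cmod_ge_0 s2) (Cmod_ge_0 s3); nra))).
replace (s3 - 0)%C with s3 in L' by ring.
eapply Clim_ext; [|exact L']. intros n. cbv beta. unfold p.
induction n as [|n IH].
- unfold s0, s1, s2, s3. simpl. rewrite ?Rmult_1_r. field; cnz.
- cbn [Csum]. rewrite <- IH. rewrite !RtoC_pow, (S_INR (S n)), RtoC_plus. unfold s0, s1, s2, s3.
  set (x := RtoC (INR (S n))). simpl Cpow. field; cnz.
Qed.

Lemma pow_le_1 (r : R) m n : 0 <= r <= 1 -> (m <= n)%nat -> r ^ n <= r ^ m.
Proof.
intros H Hmn. replace n with (m + (n - m))%nat by lia. rewrite pow_add.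
assert (0 <= r ^ m) by now apply pow_le.
assert (r ^ (n - m) <= 1) by (rewrite <- (pow1 (n - m)); now apply pow_incr).
nra.
Qed.

Lemma Cmod_pow_lt (q : C) n : Cmod q < 1 -> Cmod (q ^ S n) < 1.
Proof.
intros H. rewrite Cmod_pow. destruct (Cmod_lt_mid q H) as [r [Hr Hr1]].
apply Rle_lt_trans with (r ^ S n); [apply pow_incr; split; [apply Cmod_ge_0|exact Hr]|].
apply Rle_lt_trans with (r ^ 1); [apply pow_le_1; [lra|lia]|lra].
Qed.

(** Both sums are iterated sums of the double series of c_n q^((n+1)(m+1)). *)
Lemma lambert_swap (c : nat -> C) (g : C -> C) (q : C) :
  (forall n, Cmod (c n) <= cube_S n) ->
  (forall y, Cmod y < 1 -> is_CSeries (fun n => c n * y ^ S n)%C (g y)) -> Cmod q < 1 ->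
  exists l, is_CSeries (fun n => c n * q ^ S n / (1 - q ^ S n))%C l /\
            is_CSeries (fun m => g (q ^ S m)%C) l.
Proof.
intros Hc Hg Hq. destruct (Cmod_lt_mid q Hq) as [r [Hr Hr1]].
set (M := fun n => INR (S n) ^ 3 * r ^ n). set (N := fun n => r ^ n).
assert (HM : ex_series M) by now apply ex_series_poly_geom.
assert (HN : ex_series N) by now apply ex_series_geom_R.
assert (PM : forall n, 0 <= M n).
{ intros n. apply Rmult_le_pos; apply pow_le; [apply pos_INR|lra]. }
assert (PN : forall n, 0 <= N n) by (intros; apply pow_le; lra).
set (a := fun n m => (c n * (q ^ S n) ^ S m)%C).
assert (Ha : forall n m, Cmod (a n m) <= M n * N m).
{ intros n m. unfold a, M, N. rewrite <- Cpow_mult_r, Cmod_mult, Cmod_pow, Rmult_assoc, <- pow_add.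
  apply Rmult_le_compat; auto using Cmod_ge_0; [apply pow_le, Cmod_ge_0|].
  apply Rle_trans with (r ^ (S n * S m)); [apply pow_incr; split; [apply Cmod_ge_0|exact Hr]|].
  apply pow_le_1; [lra|lia]. }
assert (E1 : forall n, CSeries (fun m => a n m) = (c n * q ^ S n / (1 - q ^ S n))%C).
{ intros n. apply CSeries_unique. unfold Cdiv. rewrite <- Cmult_assoc. apply is_CSeries_scal.
  apply geom_series, Cmod_pow_lt, Hq. }
assert (E2 : forall m, CSeries (fun n => a n m) = g (q ^ S m)%C).
{ intros m. apply CSeries_unique. eapply is_CSeries_ext; [|apply Hg, (Cmod_pow_lt q m Hq)].
  intros n. unfold a. rewrite <- !Cpow_mult_r. now rewrite Nat.mul_comm. }
exists (CSeries (fun n => CSeries (fun m => a n m))). split.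
- eapply is_CSeries_ext; [exact E1|].
  apply (CSeries_correct _ (fun n => Series N * M n)). split; [now apply ex_series_scal_R|].
  intros n. eapply Rle_trans; [apply (Cmod_CSeries _ (fun m => M n * N m))|].
  + split; [now apply ex_series_scal_R|auto].
  + rewrite Series_scal_l. right; ring.
- rewrite (CSeries_swap a M N) by auto.
  eapply is_CSeries_ext; [exact E2|].
  apply (CSeries_correct _ (fun m => Series M * N m)). split; [now apply ex_series_scal_R|].
  intros m. eapply Rle_trans; [apply (Cmod_CSeries _ (fun n => N m * M n))|].
  + split; [now apply ex_series_scal_R|]. intros n. rewrite Rmult_comm. auto.
  + rewrite Series_scal_l. right; ring.
Qed.

(* The terms of index [m] belong to the exponent [m + 1]. For [q = exp (2 i theta)]
   they are [-1/4] times [1 / sin^2] and [i] times [cot], at [(m + 1) theta]. *)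
Definition lx (q : C) (m : nat) : C := (q ^ S m / ((1 - q ^ S m) * (1 - q ^ S m)))%C.
Definition lu (q : C) (m : nat) : C := ((1 + q ^ S m) / (1 - q ^ S m))%C.

Definition E2q (q : C) : C := (1 - 24 * CSeries (lx q))%C.

Lemma lambert_1 q : Cmod q < 1 -> exists l,
  is_CSeries (fun m => RtoC (INR (S m)) * q ^ S m / (1 - q ^ S m))%C l /\ is_CSeries (lx q) l.
Proof.
intros Hq. apply (lambert_swap (fun n => RtoC (INR (S n))) (fun y => y / ((1 - y) * (1 - y)))%C); [|apply geom_series_1|exact Hq].
intros n. destruct (cube_S_ge n) as [H0 [H1 _]]. rewrite Cmod_R, Rabs_pos_eq; lra.
Qed.

(** With x = y/(1 - y)^2 one has y(1 + 4y + y^2)/(1 - y)^4 = x + 6x^2. This expresses [E4] through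
    the terms that give [E2]. *)
Lemma lambert_3 q : Cmod q < 1 -> exists l,
  is_CSeries (fun m => RtoC (INR (S m) ^ 3) * q ^ S m / (1 - q ^ S m))%C l /\
  is_CSeries (fun m => lx q m + 6 * (lx q m * lx q m))%C l.
Proof.
intros Hq.
destruct (lambert_swap (fun n => RtoC (INR (S n) ^ 3))
  (fun y => y * (1 + 4 * y + y * y) / ((1 - y) * (1 - y) * ((1 - y) * (1 - y))))%C q) with (2 := geom_series_3) as [l [H1 H2]].
- intros n. rewrite Cmod_R, Rabs_pos_eq by (apply pow_le, pos_INR). apply Rle_refl.
- exact Hq.
- exists l. split; [exact H1|]. eapply is_CSeries_ext; [|exact H2]. intros m. cbv beta.
  unfold lx. assert (N := one_minus_neq_0 _ (Cmod_pow_lt q m Hq)). field; cnz.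
Qed.

(** * From the variable [q] to the transformation law *)

Lemma Cmod_qexp tau : Cmod (qexp tau) = exp (- (2 * PI * Im tau)).
Proof. unfold qexp. rewrite Cmod_Cexp. f_equal. unfold Re, Im; simpl. ring. Qed.

Lemma Cmod_qexp_lt tau : HH tau -> Cmod (qexp tau) < 1.
Proof.
intros H. rewrite Cmod_qexp, <- exp_0. apply exp_increasing. unfold HH in H. generalize PI_RGT_0. nra.
Qed.

Lemma E2_eq tau : HH tau -> E2 tau = E2q (qexp tau).
Proof.
intros H. destruct (lambert_1 _ (Cmod_qexp_lt tau H)) as [l [H1 H2]].
unfold E2, E2q. now rewrite (CSeries_unique _ _ H1), (CSeries_unique _ _ H2).
Qed.

Lemma E4_eq tau : HH tau -> E4 tau = (1 + 240 * CSeries (fun m => lx (qexp tau) m + 6 * (lx (qexp tau) m * lx (qexp tau) m)))%C.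
Proof.
intros H. destruct (lambert_3 _ (Cmod_qexp_lt tau H)) as [l [H1 H2]].
unfold E4. now rewrite (CSeries_unique _ _ H1), (CSeries_unique _ _ H2).
Qed.

Lemma qexp_plus a b : qexp (a + b) = (qexp a * qexp b)%C.
Proof. unfold qexp. rewrite <- Cexp_plus. f_equal. ring. Qed.

Lemma qexp_1 : qexp 1 = 1.
Proof. exact circ_1. Qed.

Lemma qexp_mul_nat n tau : qexp (RtoC (INR n) * tau) = (qexp tau ^ n)%C.
Proof.
induction n as [|n IH].
- simpl. rewrite Cmult_0_l. unfold qexp. rewrite Cmult_0_r. apply Cexp_0.
- rewrite S_INR, RtoC_plus. replace ((RtoC (INR n) + 1) * tau)%C with (tau + RtoC (INR n) * tau)%C by ring.
  rewrite qexp_plus, IH. reflexivity.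
Qed.

Lemma pisin2_qexp z : Im z <> 0 -> pisin2 z = (RtoC (- (4 * PI ^ 2)) * (qexp z / ((1 - qexp z) * (1 - qexp z))))%C.
Proof.
intros H. assert (N := csin_Im z H). assert (N2 := expi_neq_0 z).
assert (E : qexp z = (expi z * expi z)%C).
{ unfold qexp, expi. rewrite <- Cexp_plus. f_equal. rewrite RtoC_mult. ring. }
unfold pisin2. rewrite E. unfold csin in *. set (X := expi z) in *.
assert (N3 : (1 - X * X)%C <> 0).
{ intros Y. apply N. replace ((X - / X) / (2 * Ci))%C with (- (1 - X * X) / (2 * Ci * X))%C by (field; cnz). rewrite Y. field; cnz. }
assert (N4 : (X - / X)%C <> 0).
{ intros Y. apply N. rewrite Y. field; cnz. }
assert (N5 : (X * X - 1)%C <> 0).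
{ intros Y. apply N3. replace (1 - X * X)%C with (- (X * X - 1))%C by ring. rewrite Y. ring. }
assert (I2 : (Ci * Ci = - (1))%C) by (rewrite Ci2; apply RtoC_opp).
replace ((X - / X) / (2 * Ci) * ((X - / X) / (2 * Ci)))%C with ((X - / X) * (X - / X) / (4 * (Ci * Ci)))%C by (field; cnz).
rewrite I2, RtoC_opp, RtoC_mult. field; cnz.
Qed.

(** The rows m and -m agree, and for m > 0 they equal -4 pi^2 q^m/(1 - q^m)^2. Since 8 pi^2 is 24
    times pi^2/3, factoring out [basel2] leaves the Lambert form of [E2]. *)
Lemma eis_row_sum tau : HH tau -> is_zser (eis_row tau) (basel2 * E2 tau)%C.
Proof.
intros H.
destruct (lambert_1 _ (Cmod_qexp_lt tau H)) as [l [_ Hl]].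
rewrite E2_eq by exact H. unfold E2q. rewrite (CSeries_unique _ _ Hl).
assert (Ev : forall m, eis_row tau (- m) = eis_row tau m).
{ intros m. unfold eis_row. destruct (Z.eq_dec m 0) as [->|Hm]; [reflexivity|].
  destruct Z.eq_dec; [lia|]. rewrite opp_IZR, RtoC_opp, <- pisin2_opp. f_equal. ring. }
set (u := fun k : nat => eis_row tau (Z.of_nat k)).
assert (V : is_CSeries (fun k => u (S k)) (RtoC (- (4 * PI ^ 2)) * l)%C).
{ eapply is_CSeries_ext; [|apply (is_CSeries_scal (RtoC (- (4 * PI ^ 2))) _ _ Hl)].
  intros k. unfold u, eis_row. destruct Z.eq_dec; [lia|].
  rewrite <- INR_IZR_INZ, pisin2_qexp.
  - rewrite qexp_mul_nat. reflexivity.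
  - rewrite im_scal_l. unfold HH in H. assert (0 < INR (S k)) by (apply lt_0_INR; lia). nra. }
assert (W := is_CSeries_plus _ _ _ _ (is_CSeries_shift u _ V) V).
replace (basel2 * (1 - 24 * l))%C with (u 0%nat + RtoC (- (4 * PI ^ 2)) * l + RtoC (- (4 * PI ^ 2)) * l)%C.
- eapply is_CSeries_ext; [|exact W]. intros k. unfold zpair. cbv beta. rewrite Ev. reflexivity.
- unfold u, eis_row. simpl Z.of_nat. destruct Z.eq_dec; [|lia]. unfold basel2.
  replace (RtoC (- (4 * PI ^ 2))) with (RtoC (PI ^ 2 / 3) * RtoC (- 12))%C by (rewrite <- RtoC_mult; f_equal; field).
  ring.
Qed.

(** The constant 12/(2 pi i) of the anomaly of [E2]. *)
Definition kappa : C := (6 / (RtoC PI * Ci))%C.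

Lemma RtoC_PI_neq_0 : RtoC PI <> 0.
Proof. apply RtoC_neq_0. generalize PI_RGT_0. lra. Qed.

Lemma E2_S tau : HH tau -> HH (- / tau) /\ E2 (- / tau) = (tau * tau * E2 tau + kappa * tau)%C.
Proof.
intros H. assert (P0 := RtoC_PI_neq_0).
assert (H' : HH (- / tau)).
{ unfold HH. rewrite im_opp. generalize (Im_inv_tau tau H). lra. }
split; [exact H'|].
destruct (eisenstein_S tau H) as [G [G1 G2]].
assert (X := is_zser_unique _ _ _ G1 (eis_row_sum tau H)). subst G.
assert (Y := is_zser_unique _ _ _ G2 (eis_row_sum _ H')).
assert (B : basel2 = (RtoC PI * RtoC PI / 3)%C).
{ unfold basel2. rewrite <- RtoC_mult, <- RtoC_div by lra. f_equal. field. }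
assert (B0 : basel2 <> 0).
{ rewrite B. unfold Cdiv. apply Cmult_neq_0; [cnz|]. rewrite <- RtoC_inv by lra. apply RtoC_neq_0. lra. }
assert (Z : E2 (- / tau) = (/ basel2 * (basel2 * E2 (- / tau)))%C) by (field; exact B0).
rewrite Z, <- Y. unfold kappa.
assert (I2 : (Ci * Ci = - (1))%C) by (rewrite Ci2; apply RtoC_opp).
replace (6 / (RtoC PI * Ci))%C with (- (6 * Ci / RtoC PI))%C.
- replace (/ basel2 * (tau * tau * (basel2 * E2 tau) - 2 * (RtoC PI * Ci) * tau))%C
    with (tau * tau * E2 tau - / basel2 * (2 * (RtoC PI * Ci) * tau))%C by (field; exact B0).
  rewrite B. field; cnz.
- replace (6 / (RtoC PI * Ci))%C with (6 * Ci / (RtoC PI * (Ci * Ci)))%C by (field; cnz). rewrite I2. field; cnz.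
Qed.

Lemma E2_T tau n : E2 (tau + RtoC (IZR n)) = E2 tau.
Proof.
assert (P : forall t m, qexp (t + RtoC (INR m)) = qexp t).
{ intros t m. rewrite qexp_plus. replace (RtoC (INR m)) with (RtoC (INR m) * 1)%C by ring.
  rewrite qexp_mul_nat, qexp_1, Cpow_1_l. ring. }
assert (E : qexp (tau + RtoC (IZR n)) = qexp tau).
{ destruct (Z_le_gt_dec 0 n) as [Hn|Hn].
  - rewrite <- (Z2Nat.id n Hn), <- INR_IZR_INZ. apply P.
  - rewrite <- (P (tau + RtoC (IZR n))%C (Z.to_nat (- n))). f_equal.
    rewrite INR_IZR_INZ, Z2Nat.id, opp_IZR, RtoC_opp by lia. ring. }
unfold E2. now rewrite E.
Qed.

Lemma moebius_facts (a b c d : Z) tau : (a * d - b * c = 1)%Z -> HH tau ->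
  (RtoC (IZR c) * tau + RtoC (IZR d))%C <> 0 /\
  HH ((RtoC (IZR a) * tau + RtoC (IZR b)) / (RtoC (IZR c) * tau + RtoC (IZR d))).
Proof.
intros Hdet H. unfold HH in *.
assert (N : (RtoC (IZR c) * tau + RtoC (IZR d))%C <> 0).
{ intros E. assert (L := lattice_bound tau (IZR c) (IZR d)). rewrite E, Cmod_0 in L.
  assert (P := lattice_const_pos tau ltac:(lra)).
  assert (N0 : (1 <= c * c + d * d)%Z) by nia. apply IZR_le in N0. rewrite plus_IZR, !mult_IZR in N0. nra. }
split; [exact N|].
assert (M := proj1 (Cmod_gt_0 _) N).
set (j := (RtoC (IZR c) * tau + RtoC (IZR d))%C) in *.
assert (E : (RtoC (Cmod j ^ 2) * ((RtoC (IZR a) * tau + RtoC (IZR b)) / j) = (RtoC (IZR a) * tau + RtoC (IZR b)) * Cconj j)%C).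
{ rewrite Cmod2_conj. field. exact N. }
apply (f_equal Im) in E. rewrite im_scal_l, im_mult, re_conj, im_conj in E.
unfold j at 3 4 in E. rewrite !re_plus, !im_plus, !re_scal_l, !im_scal_l, !re_RtoC, !im_RtoC in E.
apply (f_equal IZR) in Hdet. rewrite minus_IZR, !mult_IZR in Hdet.
set (y := Im ((RtoC (IZR a) * tau + RtoC (IZR b)) / j)) in *.
replace ((IZR a * Re tau + IZR b) * - (IZR c * Im tau + 0) + (IZR a * Im tau + 0) * (IZR c * Re tau + IZR d))
  with ((IZR a * IZR d - IZR b * IZR c) * Im tau) in E by ring.
rewrite Hdet in E. nra.
Qed.

(** Euclid's algorithm on the first column: if a' is the remainder of a by c, the matrix is T^n S
    times the matrix with rows (c, d) and (-a', -b'), whose lower left entry is smaller than c in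
    absolute value. *)
Lemma E2_quasimodular_aux N : forall (a b c d : Z) tau, (Z.abs c <= Z.of_nat N)%Z -> (a * d - b * c = 1)%Z -> HH tau ->
  E2 ((RtoC (IZR a) * tau + RtoC (IZR b)) / (RtoC (IZR c) * tau + RtoC (IZR d)))
  = ((RtoC (IZR c) * tau + RtoC (IZR d)) * (RtoC (IZR c) * tau + RtoC (IZR d)) * E2 tau
     + kappa * RtoC (IZR c) * (RtoC (IZR c) * tau + RtoC (IZR d)))%C.
Proof.
induction N as [|N IH]; intros a b c d tau Hc Hdet H.
- assert (c = 0)%Z by lia. subst c.
  assert (Hd : (d = 1 /\ a = 1 \/ d = -1 /\ a = -1)%Z).
  { rewrite Z.mul_0_r, Z.sub_0_r in Hdet. destruct (Z.mul_eq_1 a d Hdet) as [-> | ->]; lia. }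
  destruct Hd as [[-> ->]|[-> ->]].
  + replace ((RtoC (IZR 1) * tau + RtoC (IZR b)) / (RtoC (IZR 0) * tau + RtoC (IZR 1)))%C with (tau + RtoC (IZR b))%C by (field; cnz).
    rewrite E2_T. ring.
  + replace ((RtoC (IZR (-1)) * tau + RtoC (IZR b)) / (RtoC (IZR 0) * tau + RtoC (IZR (-1))))%C with (tau + RtoC (IZR (- b)))%C.
    * rewrite E2_T. ring.
    * rewrite opp_IZR, RtoC_opp. field; cnz.
- destruct (Z.eq_dec c 0) as [->|Hc0]; [apply IH; auto; lia|].
  set (n := (a / c)%Z). set (a' := (a - n * c)%Z). set (b' := (b - n * d)%Z).
  assert (Ha' : (Z.abs a' < Z.abs c)%Z).
  { unfold a', n. rewrite Z.mul_comm, <- Z.mod_eq by exact Hc0. now apply Z.mod_bound_abs. }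
  assert (Hdet' : (c * (- b') - d * (- a') = 1)%Z) by (unfold a', b'; nia).
  assert (Hdet2 : (a' * d - b' * c = 1)%Z) by lia.
  destruct (moebius_facts c d (- a') (- b') tau Hdet' H) as [N1 S1].
  destruct (moebius_facts a' b' c d tau Hdet2 H) as [N2 _].
  assert (X := IH c d (- a')%Z (- b')%Z tau ltac:(lia) Hdet' H).
  rewrite !opp_IZR, !RtoC_opp in *.
  set (j := (RtoC (IZR c) * tau + RtoC (IZR d))%C) in *.
  set (p := (- RtoC (IZR a') * tau + - RtoC (IZR b'))%C) in *.
  assert (E : ((RtoC (IZR a) * tau + RtoC (IZR b)) / j = - / (j / p) + RtoC (IZR n))%C).
  { replace (RtoC (IZR a)) with (RtoC (IZR a') + RtoC (IZR n) * RtoC (IZR c))%C.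
    2:{ unfold a'. rewrite minus_IZR, mult_IZR, RtoC_minus, RtoC_mult. ring. }
    replace (RtoC (IZR b)) with (RtoC (IZR b') + RtoC (IZR n) * RtoC (IZR d))%C.
    2:{ unfold b'. rewrite minus_IZR, mult_IZR, RtoC_minus, RtoC_mult. ring. }
    replace ((RtoC (IZR a') + RtoC (IZR n) * RtoC (IZR c)) * tau + (RtoC (IZR b') + RtoC (IZR n) * RtoC (IZR d)))%C
      with (- p + RtoC (IZR n) * j)%C by (unfold p, j; ring).
    field; cnz. }
  rewrite E, E2_T. destruct (E2_S _ S1) as [_ ES]. rewrite ES, X.
  (* In this form the determinant merges the anomaly of the inversion with that of the smaller
     matrix. *)
  assert (D : (- RtoC (IZR a') * j + 1 = RtoC (IZR c) * p)%C).
  { apply (f_equal IZR) in Hdet2. rewrite minus_IZR, !mult_IZR in Hdet2. apply (f_equal RtoC) in Hdet2.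
    rewrite RtoC_minus, !RtoC_mult in Hdet2. rewrite <- Hdet2. unfold j, p. ring. }
  replace (j / p * (j / p) * (p * p * E2 tau + kappa * - RtoC (IZR a') * p) + kappa * (j / p))%C
    with (j * j * E2 tau + kappa * (j / p) * (- RtoC (IZR a') * j + 1))%C by (field; cnz).
  rewrite D. field; cnz.
Qed.

Theorem E2_quasimodular g tau : HH tau ->
  E2 (moebius g tau) = (autfactor g tau * autfactor g tau * E2 tau + kappa * RtoC (IZR (slc g)) * autfactor g tau)%C.
Proof.
intros H. destruct g as [a b c d Hdet]. unfold moebius, autfactor; simpl.
apply (E2_quasimodular_aux (Z.to_nat (Z.abs c))); auto. lia.
Qed.

(** * Ramanujan's differential equation *)

Definition geo2 (r : R) (f : nat -> nat -> C) : Prop :=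
  exists K, 0 <= K /\ forall a b, Cmod (f a b) <= K * (r ^ a * r ^ b).
Definition dsum (f : nat -> nat -> C) : C := CSeries (fun a => CSeries (fun b => f a b)).

Section DoubleSums.

Variable r : R.
Hypothesis Hr : 0 < r < 1.

Lemma geo2_rows f : geo2 r f ->
  (forall a, is_CSeries (fun b => f a b) (CSeries (fun b => f a b))) /\
  is_CSeries (fun a => CSeries (fun b => f a b)) (dsum f).
Proof.
intros [K [HK H]]. assert (G := ex_series_geom_R r Hr).
assert (D : forall a, dominated (fun b => f a b) (fun b => (K * r ^ a) * r ^ b)).
{ intros a. split; [now apply ex_series_scal_R|]. intros b. rewrite Rmult_assoc. apply H. }
split.
- intros a. exact (CSeries_correct _ _ (D a)).
- apply (CSeries_correct _ (fun a => (K * Series (fun b => r ^ b)) * r ^ a)).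
  split; [now apply ex_series_scal_R|]. intros a.
  eapply Rle_trans; [apply (Cmod_CSeries _ _ (D a))|]. rewrite (Series_scal_l _ (fun n => _ ^ n)). right; ring.
Qed.

Lemma dsum_swap f : geo2 r f -> dsum f = dsum (fun a b => f b a).
Proof.
intros [K [HK H]]. assert (G := ex_series_geom_R r Hr).
apply (CSeries_swap f (fun a => K * r ^ a) (fun b => r ^ b)).
- now apply ex_series_scal_R.
- exact G.
- intros a b. rewrite Rmult_assoc. apply H.
- intros a. apply Rmult_le_pos; [exact HK|apply pow_le; lra].
- intros b. apply pow_le; lra.
Qed.

Lemma dsum_plus f g : geo2 r f -> geo2 r g -> dsum (fun a b => f a b + g a b)%C = (dsum f + dsum g)%C.
Proof.
intros Hf Hg. destruct (geo2_rows f Hf) as [F1 F2]. destruct (geo2_rows g Hg) as [G1 G2].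
apply CSeries_unique. eapply is_CSeries_ext; [|apply is_CSeries_plus; [exact F2|exact G2]].
intros a. symmetry. apply CSeries_unique. now apply is_CSeries_plus.
Qed.

Lemma dsum_scal c f : geo2 r f -> dsum (fun a b => c * f a b)%C = (c * dsum f)%C.
Proof.
intros Hf. destruct (geo2_rows f Hf) as [F1 F2].
apply CSeries_unique. eapply is_CSeries_ext; [|apply is_CSeries_scal; exact F2].
intros a. symmetry. apply CSeries_unique. now apply is_CSeries_scal.
Qed.

Lemma dsum_ext f g : (forall a b, f a b = g a b) -> dsum f = dsum g.
Proof. intros H. apply CSeries_ext. intros a. apply CSeries_ext. intros b. apply H. Qed.

Lemma dsum_mult f g F G : is_CSeries f F -> is_CSeries g G -> dsum (fun a b => f a * g b)%C = (F * G)%C.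
Proof.
intros HF HG. apply CSeries_unique. rewrite Cmult_comm.
eapply is_CSeries_ext; [|apply is_CSeries_scal, HF]. intros a. cbv beta.
rewrite Cmult_comm. symmetry. apply CSeries_unique. now apply is_CSeries_scal.
Qed.

(** Regroups by c = a + b + 1, the index that belongs to the sum of the exponents a + 1 and b + 1.
    The bound depends on c alone, but exchanging the sums asks for a product; for a < c, r^c = s^c
    s^c <= s^a s^c with s the square root of r. *)
Lemma dsum_triangle (H : nat -> nat -> C) K : 0 <= K ->
  (forall a c, (a < c)%nat -> Cmod (H a c) <= K * r ^ c) ->
  is_CSeries (fun c => Csum (fun a => H a c) c) (dsum (fun a b => H a (a + S b)%nat)).
Proof.
intros HK HH. set (s := sqrt r).
assert (Hs : 0 < s < 1).
{ split; [apply sqrt_lt_R0; lra|]. rewrite <- sqrt_1. apply sqrt_lt_1; lra. }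
assert (Hss : forall n, r ^ n = s ^ n * s ^ n).
{ intros n. rewrite <- Rpow_mult_distr. unfold s. rewrite sqrt_sqrt by lra. reflexivity. }
set (h := fun a c => if lt_dec a c then H a c else RtoC 0).
assert (Hh : forall a c, Cmod (h a c) <= (K * s ^ a) * s ^ c).
{ intros a c. unfold h. destruct lt_dec as [L|L].
  - eapply Rle_trans; [now apply HH|]. rewrite Hss, Rmult_assoc. apply Rmult_le_compat_l; [exact HK|].
    apply Rmult_le_compat_r; [apply pow_le; lra|]. apply pow_le_1; [lra|lia].
  - rewrite Cmod_0. repeat apply Rmult_le_pos; try apply pow_le; lra. }
assert (Ge := ex_series_geom_R s Hs).
assert (E1 : dsum (fun a b => H a (a + S b)%nat) = dsum h).
{ apply CSeries_ext. intros a. apply CSeries_unique.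
  assert (D : dominated (h a) (fun c => (K * s ^ a) * s ^ c)).
  { split; [now apply ex_series_scal_R|apply Hh]. }
  assert (L := CSeries_correct _ _ D). intros e He. destruct (L e He) as [N HN].
  exists N. intros n Hn. specialize (HN (S a + n)%nat ltac:(lia)).
  rewrite Csum_add in HN. rewrite (Csum_ext (h a) (fun _ => RtoC 0) (S a)) in HN.
  - rewrite Csum_0, Cplus_0_l in HN.
    rewrite (Csum_ext _ (fun i => h a (S a + i)%nat)); [exact HN|].
    intros b _. unfold h. destruct lt_dec; [|lia]. f_equal. lia.
  - intros i Hi. unfold h. destruct lt_dec; [lia|reflexivity]. }
rewrite E1.
assert (E2 : dsum h = CSeries (fun c => CSeries (fun a => h a c))).
{ apply (CSeries_swap h (fun a => K * s ^ a) (fun c => s ^ c)); auto.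
  - now apply ex_series_scal_R.
  - intros a. apply Rmult_le_pos; [exact HK|apply pow_le; lra].
  - intros c. apply pow_le; lra. }
rewrite E2.
assert (E3 : forall c, CSeries (fun a => h a c) = Csum (fun a => H a c) c).
{ intros c. apply CSeries_unique. replace (Csum (fun a => H a c) c) with (Csum (fun a => h a c) c).
  - apply is_CSeries_finite. intros a Ha. unfold h. destruct lt_dec; [lia|reflexivity].
  - apply Csum_ext. intros a Ha. unfold h. destruct lt_dec; [reflexivity|lia]. }
eapply is_CSeries_ext; [exact E3|].
apply (CSeries_correct _ (fun c => (K * Series (fun a => s ^ a)) * s ^ c)). split; [now apply ex_series_scal_R|].
intros c. eapply Rle_trans; [apply (Cmod_CSeries _ (fun a => (K * s ^ c) * s ^ a))|].
- split; [now apply ex_series_scal_R|]. intros a. eapply Rle_trans; [apply Hh|]. right; ring.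
- rewrite (Series_scal_l _ (fun n => _ ^ n)). right; ring.
Qed.

End DoubleSums.

(** * Convolutions of the Lambert terms *)

Section Ramanujan.

Variables (q : C) (r : R).
Hypothesis Hr : 0 < r < 1.
Hypothesis Hq : Cmod q <= r.

Let x (a : nat) : C := lx q a.
Let u (a : nat) : C := lu q a.
Let k : R := / (1 - r).

Lemma k_ge1 : 1 <= k.
Proof. unfold k. rewrite <- Rinv_1 at 1. apply Rinv_le_contravar; lra. Qed.

Lemma qpow_bound a : Cmod (q ^ S a) <= r ^ S a.
Proof. rewrite Cmod_pow. apply pow_incr. split; [apply Cmod_ge_0|exact Hq]. Qed.

Lemma qpow_den a : (1 - q ^ S a)%C <> 0 /\ Cmod (/ (1 - q ^ S a)) <= k.
Proof.
assert (H := qpow_bound a). assert (H2 : r ^ S a <= r ^ 1) by (apply pow_le_1; [lra|lia]). rewrite pow_1 in H2.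
assert (N : (1 - q ^ S a)%C <> 0) by (apply one_minus_neq_0; lra). split; [exact N|].
rewrite Cmod_inv by exact N. unfold k. apply Rinv_le_contravar; [lra|].
generalize (Cmod_triangle_rev 1 (q ^ S a)). rewrite Cmod_1. lra.
Qed.

Lemma x_bound a : Cmod (x a) <= k ^ 2 * r ^ S a.
Proof.
unfold x, lx. destruct (qpow_den a) as [N B].
replace (q ^ S a / ((1 - q ^ S a) * (1 - q ^ S a)))%C with (q ^ S a * (/ (1 - q ^ S a) * / (1 - q ^ S a)))%C by (field; cnz).
rewrite !Cmod_mult, Rmult_comm. apply Rmult_le_compat; auto using Cmod_ge_0, qpow_bound.
- apply Rmult_le_pos; apply Cmod_ge_0.
- simpl. rewrite Rmult_1_r. apply Rmult_le_compat; auto using Cmod_ge_0.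
Qed.

Lemma u_bound a : Cmod (u a) <= 2 * k.
Proof.
unfold u, lu, Cdiv. destruct (qpow_den a) as [N B]. rewrite Cmod_mult.
assert (H := qpow_bound a). assert (H2 : r ^ S a <= r ^ 1) by (apply pow_le_1; [lra|lia]). rewrite pow_1 in H2.
apply Rmult_le_compat; auto using Cmod_ge_0.
eapply Rle_trans; [apply Cmod_triangle|]. rewrite Cmod_1. lra.
Qed.

Lemma u_diff_bound b c : (b <= c)%nat -> Cmod (u b - u c)%C <= 4 * k ^ 2 * r ^ S b.
Proof.
intros Hbc. unfold u, lu. destruct (qpow_den b) as [N1 B1]. destruct (qpow_den c) as [N2 B2].
replace ((1 + q ^ S b) / (1 - q ^ S b) - (1 + q ^ S c) / (1 - q ^ S c))%C
 with (2 * (q ^ S b - q ^ S c) * (/ (1 - q ^ S b) * / (1 - q ^ S c)))%C by (field; cnz).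
rewrite !Cmod_mult, Cmod_R, Rabs_pos_eq by lra.
replace (4 * k ^ 2 * r ^ S b) with (2 * (r ^ S b + r ^ S b) * (k * k)) by ring.
assert (H := qpow_bound b). assert (H' := qpow_bound c). assert (H2 : r ^ S c <= r ^ S b) by (apply pow_le_1; [lra|lia]).
apply Rmult_le_compat.
- apply Rmult_le_pos; [lra|apply Cmod_ge_0].
- apply Rmult_le_pos; apply Cmod_ge_0.
- apply Rmult_le_compat_l; [lra|]. unfold Cminus. eapply Rle_trans; [apply Cmod_triangle|]. rewrite Cmod_opp. lra.
- apply Rmult_le_compat; auto using Cmod_ge_0.
Qed.

Lemma u_sq a : (u a * u a)%C = (1 + 4 * x a)%C.
Proof. unfold u, x, lu, lx. destruct (qpow_den a) as [N B]. field; cnz. Qed.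

Lemma qpow_sum a b : (q ^ S (a + S b))%C = (q ^ S a * q ^ S b)%C.
Proof. rewrite <- Cpow_add_r. f_equal. Qed.

(** Write c for the sum of the two angles. With u_c = (1 + u_a u_b)/(u_a + u_b) and u^2 = 1 + 4x,
    the right side becomes x_c (u_a + u_b)^2/4, and x_c = 4 x_a x_b/(u_a + u_b)^2 by the same
    formulas. *)
Lemma cot_identity_1 a b : (x a * x b)%C =
  (x (a + S b)%nat * x a + x (a + S b)%nat * x b + / 2 * (x (a + S b)%nat * u (a + S b)%nat * u a + x (a + S b)%nat * u (a + S b)%nat * u b))%C.
Proof.
unfold x, u, lx, lu. destruct (qpow_den a) as [N1 _]. destruct (qpow_den b) as [N2 _]. destruct (qpow_den (a + S b)) as [N3 _].
rewrite !qpow_sum in *. set (y := (q ^ S a)%C) in *. set (z := (q ^ S b)%C) in *. field; cnz.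
Qed.

(** The previous identity at the angles c and -b, whose sum is a; x is even in the angle and u is
    odd. *)
Lemma cot_identity_2 a b : (x b * x (a + S b)%nat + / 2 * (x a * u a * (u b - u (a + S b)%nat)))%C =
  (x a * x b + x (a + S b)%nat * x a)%C.
Proof.
unfold x, u, lx, lu. destruct (qpow_den a) as [N1 _]. destruct (qpow_den b) as [N2 _]. destruct (qpow_den (a + S b)) as [N3 _].
rewrite !qpow_sum in *. set (y := (q ^ S a)%C) in *. set (z := (q ^ S b)%C) in *. field; cnz.
Qed.

Lemma pow_r_le_1 n : 0 <= r ^ n <= 1.
Proof. split; [apply pow_le; lra|]. rewrite <- (pow1 n). apply pow_incr. lra. Qed.

Lemma x_geom : exists K, 0 <= K /\ forall a, Cmod (x a) <= K * r ^ a.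
Proof.
exists (k ^ 2). assert (K1 := k_ge1). split; [apply pow_le; lra|]. intros a. eapply Rle_trans; [apply x_bound|].
apply Rmult_le_compat_l; [apply pow_le; lra|]. apply pow_le_1; [lra|lia].
Qed.

Lemma geo2_xx : geo2 r (fun a b => x a * x b)%C.
Proof.
destruct x_geom as [K [HK H]]. exists (K * K). split; [nra|]. intros a b. rewrite Cmod_mult.
replace (K * K * (r ^ a * r ^ b)) with ((K * r ^ a) * (K * r ^ b)) by ring.
apply Rmult_le_compat; auto using Cmod_ge_0.
Qed.

Lemma geo2_c (f : nat -> nat -> C) M : 0 <= M -> (forall a b, Cmod (f a b) <= M) ->
  geo2 r (fun a b => x (a + S b)%nat * f a b)%C.
Proof.
intros HM Hf. assert (K1 := k_ge1). exists (k ^ 2 * M). assert (0 <= k ^ 2) by (apply pow_le; lra). split; [nra|].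
intros a b. rewrite Cmod_mult.
replace (k ^ 2 * M * (r ^ a * r ^ b)) with ((k ^ 2 * (r ^ a * r ^ b)) * M) by ring.
apply Rmult_le_compat; auto using Cmod_ge_0.
eapply Rle_trans; [apply x_bound|]. apply Rmult_le_compat_l; [lra|].
rewrite <- pow_add. apply pow_le_1; [lra|lia].
Qed.

Lemma x_bdd a : Cmod (x a) <= k ^ 2.
Proof.
eapply Rle_trans; [apply x_bound|]. assert (K1 := k_ge1).
assert (H1 := pow_r_le_1 (S a)). nra.
Qed.

Lemma geo2_cxa : geo2 r (fun a b => x (a + S b)%nat * x a)%C.
Proof. apply (geo2_c (fun a b => x a) (k ^ 2)); [apply pow_le; generalize k_ge1; lra|]. intros; apply x_bdd. Qed.

Lemma geo2_cxb : geo2 r (fun a b => x (a + S b)%nat * x b)%C.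
Proof. apply (geo2_c (fun a b => x b) (k ^ 2)); [apply pow_le; generalize k_ge1; lra|]. intros; apply x_bdd. Qed.

Lemma geo2_ext f g : (forall a b, f a b = g a b) -> geo2 r f -> geo2 r g.
Proof. intros E [K [HK H]]. exists K. split; [exact HK|]. intros a b. rewrite <- E. apply H. Qed.

Lemma uu_bound a b : Cmod (u a * u b) <= 4 * k ^ 2.
Proof.
rewrite Cmod_mult. replace (4 * k ^ 2) with ((2 * k) * (2 * k)) by ring.
apply Rmult_le_compat; auto using Cmod_ge_0, u_bound.
Qed.

Lemma geo2_cua : geo2 r (fun a b => x (a + S b)%nat * u (a + S b)%nat * u a)%C.
Proof.
apply (geo2_ext (fun a b => x (a + S b)%nat * (u (a + S b)%nat * u a))%C); [intros; ring|].
apply (geo2_c _ (4 * k ^ 2)); [generalize (pow_le k 2); generalize k_ge1; lra|]. intros; apply uu_bound.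
Qed.

Lemma geo2_cub : geo2 r (fun a b => x (a + S b)%nat * u (a + S b)%nat * u b)%C.
Proof.
apply (geo2_ext (fun a b => x (a + S b)%nat * (u (a + S b)%nat * u b))%C); [intros; ring|].
apply (geo2_c _ (4 * k ^ 2)); [generalize (pow_le k 2); generalize k_ge1; lra|]. intros; apply uu_bound.
Qed.

(** Each u_b tends to 1, so the decay in b comes from the difference only; the two terms must not be
    summed separately. *)
Lemma geo2_diff : geo2 r (fun a b => x a * u a * (u b - u (a + S b)%nat))%C.
Proof.
destruct x_geom as [K [HK H]]. assert (K1 := k_ge1). assert (0 <= k ^ 2) by (apply pow_le; lra).
exists (K * (2 * k) * (4 * k ^ 2)). split; [repeat apply Rmult_le_pos; lra|].
intros a b. rewrite !Cmod_mult.
replace (K * (2 * k) * (4 * k ^ 2) * (r ^ a * r ^ b)) with (((K * r ^ a) * (2 * k)) * (4 * k ^ 2 * r ^ b)) by ring.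
apply Rmult_le_compat; try apply Cmod_ge_0.
- apply Rmult_le_pos; apply Cmod_ge_0.
- apply Rmult_le_compat; auto using Cmod_ge_0, u_bound.
- eapply Rle_trans; [apply u_diff_bound; lia|]. apply Rmult_le_compat_l; [lra|]. apply pow_le_1; [lra|lia].
Qed.

Lemma u_limit : Clim u 1.
Proof.
assert (H : Clim (fun n => q ^ S n * 1)%C 0).
{ apply (poly_geom_limit q (fun _ => RtoC 1) 1); [lra|]. intros n. rewrite Cmod_1. destruct (cube_S_ge n) as [_ [_ [H _]]]. lra. }
assert (Hf : exists l, cder (fun y => (1 + y) / (1 - y))%C 0 l).
{ eexists. apply cder_div.
  - replace (1 - 0)%C with (RtoC 1) by ring. apply C1_nz.
  - apply cder_plus; [apply cder_const|apply cder_id].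
  - apply cder_minus; [apply cder_const|apply cder_id]. }
destruct Hf as [l Hl].
assert (L := Clim_cder _ _ _ _ Hl H). cbv beta in L.
replace ((1 + 0) / (1 - 0))%C with (RtoC 1) in L.
- eapply Clim_ext; [|exact L]. intros n. unfold u, lu. now rewrite Cmult_1_r.
- replace (1 - 0)%C with (RtoC 1) by ring. field; cnz.
Qed.

(** A sequence minus its shift by a + 1 sums to the first a + 1 terms minus a + 1 times the limit 1.
    This produces the factor a + 1 of the differentiated series. *)
Lemma diff_row a : is_CSeries (fun b => u b - u (a + S b)%nat)%C (Csum u a + u a - RtoC (INR (S a)))%C.
Proof.
assert (L : Clim (fun n => Csum u (S a) - Csum (fun i => u (n + i)%nat) (S a))%C (Csum u (S a) - RtoC (INR (S a)))%C).
{ apply Clim_minus; [apply Clim_const|].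
  assert (G : forall m, Clim (fun n => Csum (fun i => u (n + i)%nat) m) (RtoC (INR m))).
  { induction m as [|m IH]; [exact (Clim_const 0)|]. rewrite S_INR, RtoC_plus. apply Clim_plus; [exact IH|].
    intros e He. destruct (u_limit e He) as [N HN]. exists N. intros n Hn. apply HN. lia. }
  apply G. }
eapply Clim_ext; [|exact L]. intros n. symmetry.
assert (E : (Csum u (n + S a) = Csum u (S a + n))%C) by (f_equal; lia).
rewrite !Csum_add in E.
assert (E2 : Csum (fun b => u b - u (a + S b)%nat)%C n = (Csum u n - Csum (fun i => u (S a + i)%nat) n)%C).
{ clear. induction n as [|n IH]; [simpl; ring|]. cbn [Csum]. rewrite IH.
  replace (a + S n)%nat with (S a + n)%nat by lia. ring. }
rewrite E2. replace (Csum u n) with (Csum u n + Csum (fun i => u (n + i)%nat) (S a) - Csum (fun i => u (n + i)%nat) (S a))%C by ring.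
rewrite E. ring.
Qed.

(** The two identities give S1^2 = 2T + W and Y = 2 S1^2. Splitting the square of S1 into a < b, a =
    b and a > b gives S1^2 = 2T + S2, hence W = S2. Summing Y by rows gives Y = W + S1 + 4 S2 - DS.
    The sum [DS] is q times the derivative of S1 with respect to q. *)
Theorem ramanujan_convolution S2 S1 DS :
  is_CSeries x S1 -> is_CSeries (fun a => x a * x a)%C S2 ->
  is_CSeries (fun a => RtoC (INR (S a)) * (x a * u a))%C DS ->
  (2 * (S1 * S1) = 5 * S2 + S1 - DS)%C.
Proof.
intros HS1 HS2 HDS.
set (T := dsum (fun a b => x (a + S b)%nat * x a)%C).
set (W := dsum (fun a b => x (a + S b)%nat * u (a + S b)%nat * u a)%C).
set (Y := dsum (fun a b => x a * u a * (u b - u (a + S b)%nat))%C).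
assert (T' : dsum (fun a b => x (a + S b)%nat * x b)%C = T).
{ rewrite (dsum_swap r Hr _ geo2_cxb). apply dsum_ext. intros a b. now replace (b + S a)%nat with (a + S b)%nat by lia. }
assert (W' : dsum (fun a b => x (a + S b)%nat * u (a + S b)%nat * u b)%C = W).
{ rewrite (dsum_swap r Hr _ geo2_cub). apply dsum_ext. intros a b. now replace (b + S a)%nat with (a + S b)%nat by lia. }
assert (P : dsum (fun a b => x a * x b)%C = (S1 * S1)%C) by now apply dsum_mult.
assert (gp : forall f g, geo2 r f -> geo2 r g -> geo2 r (fun a b => f a b + g a b)%C).
{ intros f g [K1 [HK1 H1]] [K2 [HK2 H2]]. exists (K1 + K2). split; [lra|]. intros a b.
  eapply Rle_trans; [apply Cmod_triangle|]. specialize (H1 a b). specialize (H2 a b). lra. }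
assert (gs : forall c f, geo2 r f -> geo2 r (fun a b => c * f a b)%C).
{ intros c f [K1 [HK1 H1]]. assert (Hc := Cmod_ge_0 c). exists (Cmod c * K1). split; [nra|]. intros a b.
  rewrite Cmod_mult, Rmult_assoc. apply Rmult_le_compat_l; auto. }
assert (R1 : (S1 * S1 = T + T + / 2 * (W + W))%C).
{ rewrite <- P, (dsum_ext _ _ cot_identity_1).
  rewrite (dsum_plus r Hr (fun a b => x (a + S b)%nat * x a + x (a + S b)%nat * x b)%C); auto using geo2_cxa, geo2_cxb, geo2_cua, geo2_cub.
  rewrite (dsum_scal r Hr (/ 2) (fun a b => x (a + S b)%nat * u (a + S b)%nat * u a + x (a + S b)%nat * u (a + S b)%nat * u b)%C); auto using geo2_cua, geo2_cub.
  rewrite (dsum_plus r Hr (fun a b => x (a + S b)%nat * x a)%C); auto using geo2_cxa, geo2_cxb.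
  rewrite (dsum_plus r Hr (fun a b => x (a + S b)%nat * u (a + S b)%nat * u a)%C); auto using geo2_cua, geo2_cub.
  rewrite T', W'. reflexivity. }
assert (R2 : (T + / 2 * Y = S1 * S1 + T)%C).
{ rewrite <- P. unfold T at 2. rewrite <- (dsum_plus r Hr _ _ geo2_xx geo2_cxa).
  rewrite <- (dsum_ext _ _ cot_identity_2).
  rewrite (dsum_plus r Hr (fun a b => x b * x (a + S b)%nat)%C).
  - rewrite (dsum_scal r Hr _ _ geo2_diff). fold Y. f_equal. rewrite <- T'. apply dsum_ext. intros; ring.
  - apply (geo2_ext (fun a b => x (a + S b)%nat * x b)%C); [intros; ring|apply geo2_cxb].
  - apply gs, geo2_diff. }
assert (K1 := k_ge1). assert (K2 : 0 <= k ^ 2) by (apply pow_le; lra).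
assert (TT : is_CSeries (fun c => Csum (fun a => x c * x a)%C c) T).
{ apply (dsum_triangle r Hr (fun a c => x c * x a)%C (k ^ 2 * k ^ 2)); [nra|]. intros a c _.
  rewrite Cmod_mult. replace (k ^ 2 * k ^ 2 * r ^ c) with ((k ^ 2 * r ^ c) * k ^ 2) by ring.
  apply Rmult_le_compat; auto using Cmod_ge_0, x_bdd.
  eapply Rle_trans; [apply x_bound|]. apply Rmult_le_compat_l; [lra|]. apply pow_le_1; [lra|lia]. }
assert (WW : is_CSeries (fun c => Csum (fun a => x c * u c * u a)%C c) W).
{ apply (dsum_triangle r Hr (fun a c => x c * u c * u a)%C (k ^ 2 * (4 * k ^ 2))); [nra|]. intros a c _.
  rewrite <- Cmult_assoc, Cmod_mult. replace (k ^ 2 * (4 * k ^ 2) * r ^ c) with ((k ^ 2 * r ^ c) * (4 * k ^ 2)) by ring.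
  apply Rmult_le_compat; auto using Cmod_ge_0, uu_bound.
  eapply Rle_trans; [apply x_bound|]. apply Rmult_le_compat_l; [lra|]. apply pow_le_1; [lra|lia]. }
assert (R3 : (S1 * S1 = T + S2 + T)%C).
{ rewrite <- P. apply CSeries_unique.
  destruct (geo2_rows r Hr _ geo2_cxa) as [A1 A2].
  assert (Z := is_CSeries_plus _ _ _ _ (is_CSeries_plus _ _ _ _ TT HS2) A2).
  eapply is_CSeries_ext; [|exact Z]. intros a. cbv beta.
  symmetry. apply CSeries_unique.
  rewrite Csum_scal. replace (x a * Csum x a + x a * x a)%C with (Csum (fun b => x a * x b)%C (S a)) by (cbn [Csum]; rewrite Csum_scal; reflexivity).
  specialize (A1 a).
  intros e He. destruct (A1 e He) as [N HN]. exists (S a + N)%nat. intros n Hn.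
  specialize (HN (n - S a)%nat ltac:(lia)).
  replace n with (S a + (n - S a))%nat by lia. rewrite Csum_add.
  rewrite (Csum_ext (fun i => x a * x (S a + i)%nat)%C (fun b => x (a + S b)%nat * x a)%C).
  - match goal with |- Cmod ?A < _ => match type of HN with Cmod ?B < _ => replace A with B by ring end end. exact HN.
  - intros i _. replace (a + S i)%nat with (S a + i)%nat by lia. ring. }
assert (R4 : (Y = W + (S1 + 4 * S2) - DS)%C).
{ apply CSeries_unique.
  assert (Z := is_CSeries_minus _ _ _ _ (is_CSeries_plus _ _ _ _ WW (is_CSeries_plus _ _ _ _ HS1 (is_CSeries_scal 4 _ _ HS2))) HDS).
  eapply is_CSeries_ext; [|exact Z]. intros a. cbv beta. symmetry. apply CSeries_unique.
  rewrite Csum_scal.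
  replace (x a * u a * Csum u a + (x a + 4 * (x a * x a)) - RtoC (INR (S a)) * (x a * u a))%C
    with (x a * u a * (Csum u a + u a - RtoC (INR (S a))))%C.
  - apply is_CSeries_scal, diff_row.
  - replace (x a * u a * (Csum u a + u a - RtoC (INR (S a))))%C
     with (x a * u a * Csum u a + x a * (u a * u a) - RtoC (INR (S a)) * (x a * u a))%C by ring.
    rewrite u_sq. ring. }
assert (EW : (W = S2)%C).
{ assert (X1 : (T + T + / 2 * (W + W) = T + T + W)%C) by (field; cnz).
  rewrite X1 in R1. rewrite R1 in R3.
  replace W with (T + T + W - T - T)%C by ring. rewrite R3. ring. }
assert (EY : (Y = 2 * (S1 * S1))%C).
{ replace Y with (2 * (T + / 2 * Y - T))%C by (field; cnz). rewrite R2. ring. }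
rewrite <- EY, R4, EW. ring.
Qed.

End Ramanujan.

(** * The differential equation in the variables [q] and [tau] *)

Lemma cder_lx q m : Cmod q < 1 ->
  cder (fun z => lx z m) q (RtoC (INR (S m)) * q ^ m * (1 + q ^ S m) / ((1 - q ^ S m) * (1 - q ^ S m) * (1 - q ^ S m)))%C.
Proof.
intros Hq. assert (N := one_minus_neq_0 _ (Cmod_pow_lt q m Hq)).
assert (P := cder_pow m q).
assert (P1 := cder_minus _ _ _ _ _ (cder_const 1 q) P).
assert (Q := cder_div (fun z => z ^ S m)%C (fun z => (1 - z ^ S m) * (1 - z ^ S m))%C q _ _ (Cmult_neq_0 _ _ N N) P (cder_mult _ _ _ _ _ P1 P1)).
cbv beta in Q.
apply (cder_eq _ _ _ _ Q).
set (y := (q ^ S m)%C) in *. set (d := (RtoC (INR (S m)) * q ^ m)%C). field; cnz.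
Qed.

Lemma cder_E2q q : Cmod q < 1 -> exists DS,
  is_CSeries (fun m => RtoC (INR (S m)) * (lx q m * lu q m))%C DS /\
  exists l, cder E2q q l /\ (q * l = - (24 * DS))%C.
Proof.
intros Hq. destruct (Cmod_lt_mid q Hq) as [r [Hr Hr1]].
set (R0 := (1 - r) / 2). set (r2 := (1 + r) / 2).
assert (Hr2 : 0 < r2 < 1) by (unfold r2; lra).
assert (Hb : forall z, Cmod (z - q) < R0 -> Cmod z <= r2).
{ intros z Hz. replace z with ((z - q) + q)%C by ring. eapply Rle_trans; [apply Cmod_triangle|]. unfold R0, r2 in *. lra. }
assert (W := weierstrass (fun m z => lx z m) q R0 (fun m => (/ (1 - r2)) ^ 2 * r2 * r2 ^ m)).
assert (W' : cder (fun z => CSeries (fun n => lx z n)) q (CSeries (fun n => C_derive (fun z => lx z n) q))).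
{ apply W.
  - unfold R0; lra.
  - intros n z Hz. eexists. apply cder_lx. specialize (Hb z Hz). lra.
  - intros n z Hz. eapply Rle_trans; [apply (x_bound z r2 Hr2 (Hb z Hz) n)|]. right. simpl. ring.
  - apply ex_series_scal_R, ex_series_geom_R, Hr2. }
assert (D : dominated (fun m => RtoC (INR (S m)) * (lx q m * lu q m))%C
   (fun m => (/ (1 - r)) ^ 2 * (2 * / (1 - r)) * (INR (S m) ^ 3 * r ^ m))).
{ split; [apply ex_series_scal_R, ex_series_poly_geom, Hr1|]. intros m.
  assert (B1 := x_bound q r Hr1 Hr m). assert (B2 := u_bound q r Hr1 Hr m).
  destruct (cube_S_ge m) as [C0 [C1 _]]. unfold cube_S in C1.
  rewrite !Cmod_mult, Cmod_R, Rabs_pos_eq by lra.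
  assert (K1 := k_ge1 r Hr1).
  apply Rle_trans with (INR (S m) ^ 3 * (((/ (1 - r)) ^ 2 * r ^ m) * (2 * / (1 - r)))); [|right; ring].
  apply Rmult_le_compat; [lra|apply Rmult_le_pos; apply Cmod_ge_0|exact C1|].
  apply Rmult_le_compat; auto using Cmod_ge_0.
  eapply Rle_trans; [exact B1|]. apply Rmult_le_compat_l; [apply pow_le; lra|]. apply pow_le_1; [lra|lia]. }
assert (L := CSeries_correct _ _ D).
exists (CSeries (fun m => RtoC (INR (S m)) * (lx q m * lu q m))%C). split; [exact L|].
set (DS := CSeries (fun m => RtoC (INR (S m)) * (lx q m * lu q m))%C) in *.
set (l := CSeries (fun n => C_derive (fun z => lx z n) q)) in *.
exists (- (24 * l))%C. split.
- apply (cder_ext (fun z => 1 - 24 * CSeries (fun n => lx z n))%C); [reflexivity|].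
  replace (- (24 * l))%C with (0 - 24 * l)%C by ring.
  apply cder_minus; [apply cder_const|apply cder_scal, W'].
- assert (Eq : forall n, (q * C_derive (fun z => lx z n) q = RtoC (INR (S n)) * (lx q n * lu q n))%C).
  { intros n. rewrite (cder_unique _ _ _ (cder_lx q n Hq)). unfold lx, lu.
    assert (N := one_minus_neq_0 _ (Cmod_pow_lt q n Hq)).
    simpl Cpow in *. set (y := (q ^ n)%C) in *. field; cnz. }
  (* For q <> 0 the sum of the derivatives is recovered from [DS] by dividing by q; at q = 0 both
     sides vanish. *)
  destruct (Ceq_dec q 0) as [E0|N0].
  + assert (DS = 0).
    { apply CSeries_unique. apply (is_CSeries_ext (fun _ => RtoC 0)).
      - intros n. rewrite <- Eq, E0. ring.
      - unfold is_CSeries. eapply Clim_ext; [intros; symmetry; apply Csum_0|apply Clim_const]. }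
    rewrite H, E0. ring.
  + assert (DS = (q * l)%C).
    { apply CSeries_unique. apply (is_CSeries_ext (fun n => q * C_derive (fun z => lx z n) q)%C); [exact Eq|].
      apply is_CSeries_scal.
      replace l with (/ q * DS)%C.
      - apply (is_CSeries_ext (fun n => / q * (RtoC (INR (S n)) * (lx q n * lu q n)))%C).
        + intros n. rewrite <- Eq. field; cnz.
        + apply is_CSeries_scal, L.
      - symmetry. apply CSeries_unique.
        apply (is_CSeries_ext (fun n => / q * (RtoC (INR (S n)) * (lx q n * lu q n)))%C).
        + intros n. rewrite <- Eq. field; cnz.
        + apply is_CSeries_scal, L. }
    rewrite H. ring.
Qed.

Lemma E2q_ramanujan q : Cmod q < 1 -> exists l, cder E2q q l /\
  (12 * (q * l) = E2q q * E2q q - (1 + 240 * CSeries (fun m => lx q m + 6 * (lx q m * lx q m))))%C.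
Proof.
intros Hq. destruct (cder_E2q q Hq) as [DS [HDS [l [Hl El]]]].
exists l. split; [exact Hl|]. rewrite El.
destruct (Cmod_lt_mid q Hq) as [r [Hr Hr1]].
destruct (lambert_1 q Hq) as [S1 [_ H1]].
destruct (lambert_3 q Hq) as [S3 [_ H3]].
assert (H2 : is_CSeries (fun m => lx q m * lx q m)%C (/ 6 * (S3 - S1))%C).
{ eapply is_CSeries_ext; [|apply (is_CSeries_scal (/ 6) _ _ (is_CSeries_minus _ _ _ _ H3 H1))].
  intros n. cbv beta. field; cnz. }
assert (E := ramanujan_convolution q r Hr1 Hr _ _ _ H1 H2 HDS).
unfold E2q. rewrite (CSeries_unique _ _ H1), (CSeries_unique _ _ H3).
replace DS with (5 * (/ 6 * (S3 - S1)) + S1 - 2 * (S1 * S1))%C by (rewrite E; ring).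
field; cnz.
Qed.

Lemma cder_qexp tau : cder qexp tau (twopii * qexp tau)%C.
Proof.
unfold qexp. apply (cder_comp Cexp (fun z => RtoC (2 * PI) * Ci * z)%C); [apply cder_Cexp|apply cder_linear].
Qed.

Lemma HH_open tau : HH tau -> exists d, 0 < d /\ forall z, Cmod (z - tau) < d -> HH z.
Proof.
intros H. exists (Im tau). split; [exact H|]. intros z Hz. unfold HH in *.
assert (B := im_le_Cmod (z - tau)). unfold Cminus in B at 1. rewrite im_plus, im_opp in B.
apply Rabs_le_between in B. lra.
Qed.

Theorem D_E2 tau : HH tau ->
  cder E2 tau (twopii * Defs.D E2 tau)%C /\ Defs.D E2 tau = ((E2 tau * E2 tau - E4 tau) / 12)%C.
Proof.
intros H. destruct (E2q_ramanujan _ (Cmod_qexp_lt tau H)) as [l [Hl E]].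
assert (Hd : cder E2 tau (twopii * qexp tau * l)%C).
{ destruct (HH_open tau H) as [d [Hd0 Hd]].
  apply (cder_ext_loc (fun z => E2q (qexp z))).
  - exists d. split; [exact Hd0|]. intros z Hz. symmetry. apply E2_eq, Hd, Hz.
  - apply cder_comp; [exact Hl|apply cder_qexp]. }
assert (ED : Defs.D E2 tau = (qexp tau * l)%C).
{ unfold Defs.D. rewrite (cder_unique _ _ _ Hd). fold twopii. assert (N := twopii_neq_0). field; cnz. }
split.
- rewrite ED, Cmult_assoc. exact Hd.
- rewrite ED, E2_eq, E4_eq, <- E by exact H. field; cnz.
Qed.

(** * The slash operator *)

Definition Clog (w : C) : C := (ln (Cmod w), Carg w).

Lemma Cpower_plus w s t : Cpower w (s + t) = (Cpower w s * Cpower w t)%C.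
Proof. unfold Cpower. rewrite <- Cexp_plus. f_equal. rewrite RtoC_plus. ring. Qed.

Lemma Re_ratio (w : C) : w <> 0 -> -1 <= Re w / Cmod w <= 1 /\
  (Re w / Cmod w) * (Re w / Cmod w) + (Im w / Cmod w) * (Im w / Cmod w) = 1.
Proof.
intros H. assert (P := proj1 (Cmod_gt_0 w) H).
assert (E : (Re w / Cmod w) * (Re w / Cmod w) + (Im w / Cmod w) * (Im w / Cmod w) = 1).
{ replace (_ + _) with ((Re w * Re w + Im w * Im w) / (Cmod w * Cmod w)) by (field; lra).
  rewrite <- Cmod_sqr. field. lra. }
split; [|exact E].
assert (Q := Rle_0_sqr (Im w / Cmod w)). unfold Rsqr in Q. split; nra.
Qed.

Lemma Cexp_Clog (w : C) : w <> 0 -> Cexp (Clog w) = w.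
Proof.
intros H. assert (P := proj1 (Cmod_gt_0 w) H). destruct (Re_ratio w H) as [B E].
unfold Cexp, Clog. unfold Re at 1 2, Im at 1 2; simpl fst; simpl snd.
rewrite exp_ln by exact P. unfold Carg.
set (x := Re w / Cmod w) in *. set (y := Im w / Cmod w) in *.
assert (Hc : cos (acos x) = x) by (apply cos_acos; lra).
assert (Hs : sin (acos x) = sqrt (1 - x²)) by (apply sin_acos; lra).
assert (Hy : 1 - x² = y²) by (unfold Rsqr; lra). rewrite Hy in Hs.
assert (Ex : Cmod w * x = Re w) by (unfold x; field; lra).
assert (Ey : Cmod w * y = Im w) by (unfold y; field; lra).
apply Ceq; [unfold Re at 1|unfold Im at 1]; simpl.
- rewrite <- Ex. f_equal. destruct Rle_dec; rewrite ?cos_neg; exact Hc.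
- rewrite <- Ey. f_equal. destruct Rle_dec as [L|L].
  + rewrite Hs. apply sqrt_Rsqr. unfold y. apply Rdiv_le_0_compat; lra.
  + rewrite sin_neg, Hs, Rsqr_neg, sqrt_Rsqr; [ring|].
    apply Rnot_le_lt in L. unfold y, Rdiv. rewrite Ropp_mult_distr_l. apply Rmult_le_pos; [lra|]. left. now apply Rinv_0_lt_compat.
Qed.

Lemma Cpower_1 (w : C) : w <> 0 -> Cpower w 1 = w.
Proof. intros H. unfold Cpower. rewrite Cmult_1_l. now apply Cexp_Clog. Qed.

Lemma Cpower_neq_0 w s : Cpower w s <> 0.
Proof. apply Cexp_neq_0. Qed.

Lemma Cpower_sub_2 (w : C) s : w <> 0 -> Cpower w (- (s + 2)) = (Cpower w (- s) / (w * w))%C.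
Proof.
intros H. replace (- s) with (- (s + 2) + (1 + 1)) by ring.
rewrite Cpower_plus, (Cpower_plus w 1 1), Cpower_1 by exact H. field; cnz.
Qed.

Definition ccont (g : C -> R) (w : C) : Prop :=
  @continuous (AbsRing_UniformSpace C_AbsRing) R_UniformSpace g w.

Lemma ccont_eps g w : ccont g w <-> forall eps, 0 < eps -> exists d, 0 < d /\
  forall z, Cmod (z - w) < d -> Rabs (g z - g w) < eps.
Proof.
unfold ccont, continuous. rewrite filterlim_locally. split.
- intros H eps He. destruct (H (mkposreal eps He)) as [d Hd]. exists d. split; [apply cond_pos|exact Hd].
- intros H eps. destruct (H eps (cond_pos eps)) as [d [Hd Hz]]. exists (mkposreal d Hd). exact Hz.
Qed.

Lemma ccont_comp f g w : ccont g w -> continuity_pt f (g w) -> ccont (fun z => f (g z)) w.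
Proof. intros Hg Hf. apply (@continuous_comp (AbsRing_UniformSpace C_AbsRing) R_UniformSpace R_UniformSpace g f); [exact Hg|]. now apply continuity_pt_filterlim. Qed.

Lemma ccont_mult f g w : ccont f w -> ccont g w -> ccont (fun z => f z * g z) w.
Proof. apply (@continuous_mult (AbsRing_UniformSpace C_AbsRing) R_AbsRing). Qed.

Lemma ccont_Re w : ccont Re w.
Proof.
apply ccont_eps. intros eps He. exists eps. split; [exact He|]. intros z Hz.
eapply Rle_lt_trans; [|exact Hz]. generalize (re_le_Cmod (z - w)). unfold Cminus at 1. now rewrite re_plus, re_opp.
Qed.

Lemma ccont_Cmod w : ccont Cmod w.
Proof.
apply ccont_eps. intros eps He. exists eps. split; [exact He|]. intros z Hz.
eapply Rle_lt_trans; [|exact Hz]. apply Rabs_le. split.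
- generalize (Cmod_triangle_rev w z). rewrite <- (Cmod_opp (w - z)).
  replace (- (w - z))%C with (z - w)%C by ring. lra.
- apply Cmod_triangle_rev.
Qed.

(** Off the real axis the sign of the imaginary part is constant on a disc, so a single branch of
    the definition applies there; moreover the argument of [acos] lies strictly between -1 and 1. *)
Lemma ccont_Carg w : Im w <> 0 -> ccont Carg w.
Proof.
intros H. assert (N : w <> 0) by (intros E; rewrite E in H; apply H; reflexivity).
assert (P := proj1 (Cmod_gt_0 w) N). destruct (Re_ratio w N) as [B E].
assert (B' : -1 < Re w / Cmod w < 1).
{ assert (Q : 0 < (Im w / Cmod w) * (Im w / Cmod w)).
  { apply Rsqr_pos_lt. apply Rmult_integral_contrapositive; split; [exact H|]. apply Rinv_neq_0_compat. lra. }
  split; nra. }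
assert (A : ccont (fun z => acos (Re z / Cmod z)) w).
{ apply (ccont_comp acos (fun z => Re z / Cmod z)).
  - apply (ccont_mult Re (fun z => / Cmod z)); [apply ccont_Re|].
    apply (ccont_comp Rinv Cmod); [apply ccont_Cmod|].
    apply (continuity_pt_inv (fun x => x)); [apply derivable_continuous_pt, derivable_pt_id|lra].
  - apply derivable_continuous_pt. now apply derivable_pt_acos. }
apply ccont_eps. intros eps He. destruct (proj1 (ccont_eps _ _) A eps He) as [d [Hd HA]].
exists (Rmin d (Rabs (Im w))). split; [apply Rmin_pos; [exact Hd|now apply Rabs_pos_lt]|].
intros z Hz. specialize (HA z (Rlt_le_trans _ _ _ Hz (Rmin_l _ _))).
assert (Hi := Rlt_le_trans _ _ _ Hz (Rmin_r _ _)).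
assert (Hi2 := Rle_lt_trans _ _ _ (im_le_Cmod (z - w)) Hi). unfold Cminus in Hi2. rewrite im_plus, im_opp in Hi2.
unfold Carg.
destruct (Rle_dec 0 (Im z)) as [L1|L1]; destruct (Rle_dec 0 (Im w)) as [L2|L2].
- exact HA.
- exfalso. unfold Rabs in Hi2. repeat destruct Rcase_abs; lra.
- exfalso. unfold Rabs in Hi2. repeat destruct Rcase_abs; lra.
- rewrite <- Rabs_Ropp. match goal with |- Rabs ?A < _ => match type of HA with Rabs ?B < _ => replace A with B by ring end end. exact HA.
Qed.

Lemma Clog_continuous w : Im w <> 0 -> forall eps, 0 < eps -> exists d, 0 < d /\
  forall z, Cmod (z - w) < d -> Cmod (Clog z - Clog w) < eps.
Proof.
intros H eps He. assert (N : w <> 0) by (intros E; rewrite E in H; apply H; reflexivity).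
assert (P := proj1 (Cmod_gt_0 w) N).
assert (A1 : ccont (fun z => ln (Cmod z)) w).
{ apply (ccont_comp ln Cmod); [apply ccont_Cmod|]. apply derivable_continuous_pt.
  exists (/ Cmod w). now apply derivable_pt_lim_ln. }
destruct (proj1 (ccont_eps _ _) A1 (eps / 2)) as [d1 [D1 H1]]; [lra|].
destruct (proj1 (ccont_eps _ _) (ccont_Carg w H) (eps / 2)) as [d2 [D2 H2]]; [lra|].
exists (Rmin d1 d2). split; [now apply Rmin_pos|]. intros z Hz.
specialize (H1 z (Rlt_le_trans _ _ _ Hz (Rmin_l _ _))). specialize (H2 z (Rlt_le_trans _ _ _ Hz (Rmin_r _ _))).
eapply Rle_lt_trans; [apply Cmod_le_abs|]. unfold Cminus. rewrite re_plus, im_plus, re_opp, im_opp.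
unfold Clog, Re at 1 2, Im at 1 2; simpl. unfold Rminus in *. lra.
Qed.

(* [Clog] is a continuous right inverse of [Cexp]. *)
Lemma cder_Clog w : Im w <> 0 -> cder Clog w (/ w)%C.
Proof.
intros H eps He. assert (N : w <> 0) by (intros E; rewrite E in H; apply H; reflexivity).
assert (P := proj1 (Cmod_gt_0 w) N).
(* For k = Clog z - Clog w the bound 1/2 gives |k| <= 2 |exp k - 1|, and |z - w| = |w| |exp k - 1|;
   with these the second bound leads to [eps]. *)
set (e1 := Rmin (/ 2) (eps * Cmod w / 2)).
assert (He1 : 0 < e1) by (apply Rmin_pos; [lra|]; nra).
assert (E1 : e1 <= / 2) by apply Rmin_l. assert (E2 : e1 <= eps * Cmod w / 2) by apply Rmin_r.
destruct (cder_Cexp_0 e1 He1) as [d1 [D1 H1]].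
destruct (Clog_continuous w H d1 D1) as [d2 [D2 H2]].
exists (Rmin d2 (Rabs (Im w))). split; [apply Rmin_pos; [exact D2|now apply Rabs_pos_lt]|].
intros z Hz. specialize (H2 z (Rlt_le_trans _ _ _ Hz (Rmin_l _ _))).
assert (Hi := Rlt_le_trans _ _ _ Hz (Rmin_r _ _)).
assert (Nz : z <> 0).
{ intros Ez. rewrite Ez in Hi. replace (0 - w)%C with (- w)%C in Hi by ring. rewrite Cmod_opp in Hi.
  generalize (im_le_Cmod w). lra. }
set (k := (Clog z - Clog w)%C) in *.
assert (Hk : Cmod (k - 0) < d1) by (replace (k - 0)%C with k by ring; exact H2).
specialize (H1 k Hk). rewrite Cexp_0 in H1.
replace (Cexp k - 1 - 1 * (k - 0))%C with (Cexp k - 1 - k)%C in H1 by ring.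
replace (k - 0)%C with k in H1 by ring.
assert (Ez : z = (w * Cexp k)%C).
{ rewrite <- (Cexp_Clog z Nz). replace (Clog z) with (Clog w + k)%C by (unfold k; ring).
  rewrite Cexp_plus, (Cexp_Clog w N). reflexivity. }
replace (k - / w * (z - w))%C with (- (Cexp k - 1 - k))%C by (rewrite Ez; field; exact N).
rewrite Cmod_opp.
assert (Hz2 : Cmod (z - w) = Cmod w * Cmod (Cexp k - 1)).
{ rewrite <- Cmod_mult. f_equal. rewrite Ez. ring. }
assert (Hk2 : Cmod k <= 2 * Cmod (Cexp k - 1)).
{ assert (T := Cmod_triangle_rev k (- (Cexp k - 1 - k))).
  replace (k - - (Cexp k - 1 - k))%C with (Cexp k - 1)%C in T by ring. rewrite Cmod_opp in T.
  assert (Q := Cmod_ge_0 k). nra. }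
eapply Rle_trans; [exact H1|]. rewrite Hz2.
assert (Q := Cmod_ge_0 k).
apply Rle_trans with (eps * Cmod w / 2 * (2 * Cmod (Cexp k - 1))); [|right; field].
apply Rmult_le_compat; lra.
Qed.

Lemma cder_Cpower w s : Im w <> 0 -> cder (fun z => Cpower z s) w (RtoC s * Cpower w s / w)%C.
Proof.
intros H. assert (N : w <> 0) by (intros E; rewrite E in H; apply H; reflexivity).
assert (Q := cder_comp Cexp (fun z => RtoC s * Clog z)%C w _ _ (cder_Cexp _) (cder_scal (RtoC s) _ _ _ (cder_Clog w H))).
replace (RtoC s * Cpower w s / w)%C with (RtoC s * / w * Cexp (RtoC s * Clog w))%C; [exact Q|].
unfold Cpower, Clog. field. exact N.
Qed.

(** * Derivatives of automorphy factors and slashed functions *)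

Section Slash.

Variable g : SL2Z.

Lemma autfactor_neq_0 tau : HH tau -> autfactor g tau <> 0.
Proof. intros H. destruct g as [a b c d Hdet]. apply (moebius_facts a b c d tau Hdet H). Qed.

Lemma moebius_HH tau : HH tau -> HH (moebius g tau).
Proof. intros H. destruct g as [a b c d Hdet]. apply (moebius_facts a b c d tau Hdet H). Qed.

Lemma cder_autfactor tau : cder (autfactor g) tau (RtoC (IZR (slc g))).
Proof.
unfold autfactor. generalize (cder_plus _ _ _ _ _ (cder_linear (RtoC (IZR (slc g))) tau) (cder_const (RtoC (IZR (sld g))) tau)).
now rewrite Cplus_0_r.
Qed.

Lemma cder_moebius tau : HH tau -> cder (moebius g) tau (/ (autfactor g tau * autfactor g tau))%C.
Proof.
intros H. assert (N := autfactor_neq_0 tau H). unfold moebius.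
assert (Q := cder_div _ _ _ _ _ N (cder_plus _ _ _ _ _ (cder_linear (RtoC (IZR (sla g))) tau) (cder_const (RtoC (IZR (slb g))) tau)) (cder_autfactor tau)).
cbv beta in Q.
apply (cder_eq _ _ _ _ Q).
assert (Hd := sl_det g). apply (f_equal IZR) in Hd. rewrite minus_IZR, !mult_IZR in Hd. apply (f_equal RtoC) in Hd.
rewrite RtoC_minus, !RtoC_mult in Hd.
match goal with |- (?u / _)%C = _ => replace u with (RtoC 1); [field; cnz|] end.
unfold autfactor. rewrite <- Hd. ring.
Qed.

Lemma cder_Cpower_autfactor s tau : HH tau ->
  cder (fun z => Cpower (autfactor g z) s) tau
   (RtoC s * RtoC (IZR (slc g)) * Cpower (autfactor g tau) s / autfactor g tau)%C.
Proof.
intros H. assert (N := autfactor_neq_0 tau H).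
(* If c = 0 the automorphy factor is the constant d, which may lie on the cut of the logarithm;
   otherwise it is not real on the half-plane, and [cder_Cpower] applies. *)
destruct (Z.eq_dec (slc g) 0) as [E|E].
- rewrite E. replace (RtoC s * RtoC (IZR 0) * Cpower (autfactor g tau) s / autfactor g tau)%C with (RtoC 0) by (field; exact N).
  apply (cder_ext (fun _ => Cpower (RtoC (IZR (sld g))) s)); [|apply cder_const].
  intros z. unfold autfactor. rewrite E. f_equal. ring.
- assert (Hi : Im (autfactor g tau) <> 0).
  { unfold autfactor. rewrite im_plus, im_scal_l, im_RtoC. apply not_0_IZR in E. unfold HH in H. nra. }
  assert (Q := cder_comp (fun z => Cpower z s) (autfactor g) tau _ _ (cder_Cpower _ s Hi) (cder_autfactor tau)).
  apply (cder_eq _ _ _ _ Q).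
  field. exact N.
Qed.

(** The term proportional to c/(c tau + d) is the defect of equivariance of D; in [serre_slash] the
    anomaly of [E2] cancels it. *)
Lemma cder_slash k f tau l : HH tau -> cder f (moebius g tau) l ->
  cder (slash k g f) tau
   (slash (k + 2) g (fun _ => l) tau
    - RtoC k * RtoC (IZR (slc g)) / autfactor g tau * slash k g f tau)%C.
Proof.
intros H Hf. assert (N := autfactor_neq_0 tau H).
assert (Q := cder_mult _ _ _ _ _ (cder_Cpower_autfactor (- k) tau H) (cder_comp f (moebius g) tau _ _ Hf (cder_moebius tau H))).
unfold slash at 1. cbv beta in Q.
apply (cder_eq _ _ _ _ Q).
unfold slash. rewrite Cpower_sub_2 by exact N. rewrite RtoC_opp. field. exact N.
Qed.

End Slash.

(** * Higher Serre derivatives *)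

Definition hol (f : C -> C) : Prop := holomorphic_on HH f.

Lemma hol_cder f : hol f <-> forall tau, HH tau -> exists l, cder f tau l.
Proof.
split.
- intros H tau Ht. destruct (H tau Ht) as [l Hl]. exists l. now apply cder_is_derive.
- intros H tau Ht. destruct (H tau Ht) as [l Hl]. exists l. now apply cder_is_derive.
Qed.

Lemma Dcder f tau : hol f -> HH tau -> cder f tau (twopii * Defs.D f tau)%C.
Proof.
intros H Ht. replace (twopii * Defs.D f tau)%C with (C_derive f tau).
- apply cder_derive, H, Ht.
- unfold Defs.D. fold twopii. assert (N := twopii_neq_0). field; cnz.
Qed.

Lemma D_unique f tau l : cder f tau (twopii * l)%C -> Defs.D f tau = l.
Proof.
intros H. unfold Defs.D. rewrite (cder_unique _ _ _ H). fold twopii. assert (N := twopii_neq_0). field; cnz.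
Qed.

Lemma cder_HH_ext f g tau l : (forall z, HH z -> f z = g z) -> HH tau -> cder f tau l -> cder g tau l.
Proof.
intros E Ht. destruct (HH_open tau Ht) as [d [Hd H]]. apply cder_ext_loc.
exists d. split; [exact Hd|]. intros z Hz. apply E, H, Hz.
Qed.

Lemma hol_ext f g : (forall z, HH z -> f z = g z) -> hol f -> hol g.
Proof.
rewrite !hol_cder. intros E H tau Ht. destruct (H tau Ht) as [l Hl]. exists l.
now apply (cder_HH_ext f g).
Qed.

Lemma D_ext f g tau : (forall z, HH z -> f z = g z) -> hol f -> HH tau -> Defs.D f tau = Defs.D g tau.
Proof.
intros E H Ht. symmetry. apply D_unique. apply (cder_HH_ext f g tau); auto using Dcder.
Qed.

Lemma hol_const c : hol (fun _ => c).
Proof. apply hol_cder. intros. exists (RtoC 0). apply cder_const. Qed.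

Lemma hol_plus f g : hol f -> hol g -> hol (fun z => f z + g z)%C.
Proof.
rewrite !hol_cder. intros H1 H2 tau Ht. destruct (H1 tau Ht) as [l Hl]. destruct (H2 tau Ht) as [m Hm].
eexists. apply cder_plus; eassumption.
Qed.

Lemma hol_mult f g : hol f -> hol g -> hol (fun z => f z * g z)%C.
Proof.
rewrite !hol_cder. intros H1 H2 tau Ht. destruct (H1 tau Ht) as [l Hl]. destruct (H2 tau Ht) as [m Hm].
eexists. apply cder_mult; eassumption.
Qed.

Lemma hol_minus f g : hol f -> hol g -> hol (fun z => f z - g z)%C.
Proof.
rewrite !hol_cder. intros H1 H2 tau Ht. destruct (H1 tau Ht) as [l Hl]. destruct (H2 tau Ht) as [m Hm].
eexists. apply cder_minus; eassumption.
Qed.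

Lemma hol_pow f n : hol f -> hol (fun z => f z ^ n)%C.
Proof.
intros H. induction n as [|n IH]; [exact (hol_const 1)|]. exact (hol_mult _ _ H IH).
Qed.

Lemma hol_Csum (f : nat -> C -> C) n : (forall i, (i < n)%nat -> hol (f i)) -> hol (fun z => Csum (fun i => f i z) n).
Proof.
induction n as [|n IH]; intros H; [exact (hol_const 0)|]. simpl. apply hol_plus; [apply IH; auto|apply H; lia].
Qed.

Lemma hol_D f : hol f -> hol (Defs.D f).
Proof.
intros H. apply hol_cder. intros tau Ht. destruct (HH_open tau Ht) as [d [Hd Hb]].
destruct (cder_derive_ball f tau d) as [l Hl].
- intros z Hz. apply hol_cder; [exact H|]. apply Hb, Hz.
- exact Hd.
- eexists. unfold Defs.D. apply (cder_ext (fun z => / (RtoC (2 * PI) * Ci) * C_derive f z)%C).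
  + intros z. unfold Cdiv. ring.
  + apply cder_scal, Hl.
Qed.

Lemma hol_E2 : hol E2.
Proof. apply hol_cder. intros tau Ht. eexists. apply (D_E2 tau Ht). Qed.

(** Ramanujan's equation writes E4 as E2^2 - 12 D E2, so holomorphy is inherited from [E2]. *)
Lemma hol_E4 : hol E4.
Proof.
apply (hol_ext (fun z => E2 z * E2 z - 12 * Defs.D E2 z)%C).
- intros z Hz. rewrite (proj2 (D_E2 z Hz)). field; cnz.
- apply hol_minus; [apply hol_mult; apply hol_E2|]. apply hol_mult; [apply hol_const|apply hol_D, hol_E2].
Qed.

Lemma hol_slash k g f : hol f -> hol (slash k g f).
Proof.
rewrite !hol_cder. intros H tau Ht. destruct (H _ (moebius_HH g tau Ht)) as [l Hl].
eexists. exact (cder_slash g k f tau l Ht Hl).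
Qed.

Lemma hol_serre j f : hol f -> hol (serre j f).
Proof.
intros H. apply hol_minus; [now apply hol_D|]. apply hol_mult; [|exact H].
apply hol_mult; [apply hol_const|apply hol_E2].
Qed.

Lemma nat_ind2 (P : nat -> Prop) : P 0%nat -> P 1%nat -> (forall m, P m -> P (S m) -> P (S (S m))) -> forall m, P m.
Proof.
intros H0 H1 H m. assert (P m /\ P (S m)) as [X _]; [|exact X].
induction m as [|m [IH1 IH2]]; auto.
Qed.

Lemma higher_serre_SS k m f tau : higher_serre k (S (S m)) f tau =
  (serre (k + 2 * INR (S m)) (higher_serre k (S m) f) tau
   - RtoC (INR (S m) * (INR (S m) + k - 1) / 144) * E4 tau * higher_serre k m f tau)%C.
Proof. reflexivity. Qed.

Lemma hol_higher_serre k f m : hol f -> hol (higher_serre k m f).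
Proof.
intros H. induction m as [| |m IH1 IH2] using nat_ind2.
- exact H.
- now apply hol_serre.
- apply (hol_ext (fun tau => serre (k + 2 * INR (S m)) (higher_serre k (S m) f) tau
   - RtoC (INR (S m) * (INR (S m) + k - 1) / 144) * E4 tau * higher_serre k m f tau)%C); [reflexivity|].
  apply hol_minus; [now apply hol_serre|].
  apply hol_mult; [|exact IH1]. apply hol_mult; [apply hol_const|apply hol_E4].
Qed.

Lemma serre_ext j f g tau : (forall z, HH z -> f z = g z) -> hol f -> HH tau -> serre j f tau = serre j g tau.
Proof. intros E H Ht. unfold serre. rewrite (D_ext f g tau), E; auto. Qed.

Lemma kappa_eq : kappa = (12 / twopii)%C.
Proof.
unfold kappa, twopii. assert (N := RtoC_PI_neq_0). rewrite RtoC_mult. field; cnz.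
Qed.

Lemma serre_slash k g f tau : hol f -> HH tau ->
  serre k (slash k g f) tau = slash (k + 2) g (serre k f) tau.
Proof.
intros H Ht. assert (N := autfactor_neq_0 g tau Ht). assert (N2 := twopii_neq_0).
assert (Hd := cder_slash g k f tau _ Ht (Dcder f _ H (moebius_HH g tau Ht))).
unfold serre.
rewrite (D_unique _ _ (slash (k + 2) g (Defs.D f) tau - RtoC k * RtoC (IZR (slc g)) / (twopii * autfactor g tau) * slash k g f tau)%C).
- unfold slash. rewrite (E2_quasimodular g tau Ht), kappa_eq, Cpower_sub_2 by exact N.
  rewrite RtoC_div by lra. field; cnz.
- match type of Hd with cder _ _ ?l => match goal with |- cder _ _ ?m => replace m with l; [exact Hd|] end end.
  unfold slash. field; cnz.
Qed.

(** The law of [E2] is differentiated on both sides. In E2^2 - 12 D E2 the anomalies of the square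
    and of the derivative cancel. *)
Lemma E4_modular g tau : HH tau ->
  E4 (moebius g tau) = (autfactor g tau * autfactor g tau * (autfactor g tau * autfactor g tau) * E4 tau)%C.
Proof.
intros Ht. assert (N := autfactor_neq_0 g tau Ht). assert (N2 := twopii_neq_0).
assert (Hm := moebius_HH g tau Ht).
destruct (D_E2 tau Ht) as [_ R1]. destruct (D_E2 _ Hm) as [_ R2].
assert (C1 := cder_comp E2 (moebius g) tau _ _ (Dcder E2 _ hol_E2 Hm) (cder_moebius g tau Ht)).
assert (J := cder_autfactor g tau).
assert (C2 := cder_plus _ _ _ _ _ (cder_mult _ _ _ _ _ (cder_mult _ _ _ _ _ J J) (Dcder E2 _ hol_E2 Ht))
   (cder_scal (kappa * RtoC (IZR (slc g)))%C _ _ _ J)).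
cbv beta in C2.
assert (C3 : cder (fun z => E2 (moebius g z)) tau
   ((RtoC (IZR (slc g)) * autfactor g tau + autfactor g tau * RtoC (IZR (slc g))) * E2 tau +
        autfactor g tau * autfactor g tau * (twopii * Defs.D E2 tau) + kappa * RtoC (IZR (slc g)) * RtoC (IZR (slc g)))%C).
{ refine (cder_HH_ext _ _ tau _ _ Ht C2). intros z Hz. symmetry. now apply E2_quasimodular. }
assert (E := eq_trans (eq_sym (cder_unique _ _ _ C1)) (cder_unique _ _ _ C3)).
set (j := autfactor g tau) in *. set (c := RtoC (IZR (slc g))) in *.
assert (D1 : Defs.D E2 (moebius g tau) = (j * j * (j * j * Defs.D E2 tau + (2 * c * j * E2 tau + kappa * c * c) / twopii))%C).
{ replace (Defs.D E2 (moebius g tau)) with (j * j / twopii * (/ (j * j) * (twopii * Defs.D E2 (moebius g tau))))%C by (field; cnz).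
  rewrite E. field; cnz. }
assert (X : E4 (moebius g tau) = (E2 (moebius g tau) * E2 (moebius g tau) - 12 * Defs.D E2 (moebius g tau))%C)
  by (rewrite R2; field; cnz).
assert (Y : E4 tau = (E2 tau * E2 tau - 12 * Defs.D E2 tau)%C) by (rewrite R1; field; cnz).
rewrite X, Y, D1, (E2_quasimodular g tau Ht), kappa_eq. fold j c. field; cnz.
Qed.

Lemma higher_serre_slash k g f m : hol f -> forall tau, HH tau ->
  higher_serre k m (slash k g f) tau = slash (k + 2 * INR m) g (higher_serre k m f) tau.
Proof.
intros H. induction m as [| |m IH1 IH2] using nat_ind2; intros tau Ht.
- simpl. now rewrite Rmult_0_r, Rplus_0_r.
- simpl. rewrite Rmult_1_r. now apply serre_slash.
- assert (N := autfactor_neq_0 g tau Ht).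
  rewrite higher_serre_SS, IH1 by exact Ht.
  rewrite (serre_ext _ _ _ tau IH2); [|apply hol_higher_serre, hol_slash, H|exact Ht].
  rewrite serre_slash by (try apply hol_higher_serre; assumption).
  unfold slash at 1 2 3. rewrite higher_serre_SS, (E4_modular g tau Ht).
  replace (k + 2 * INR (S (S m))) with (k + 2 * INR (S m) + 2) by (rewrite (S_INR (S m)); ring).
  replace (Cpower (autfactor g tau) (- (k + 2 * INR m)))
    with (Cpower (autfactor g tau) (- (k + 2 * INR (S m) + 2)) * (autfactor g tau * autfactor g tau * (autfactor g tau * autfactor g tau)))%C.
  + ring.
  + rewrite Cpower_sub_2 by exact N.
    replace (k + 2 * INR (S m)) with (k + 2 * INR m + 2) by (rewrite (S_INR m); ring).
    rewrite Cpower_sub_2 by exact N. field; cnz.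
Qed.

(** * Expansion of the powers of [D] in higher Serre derivatives *)

Definition serre_binom (k : R) (r j : nat) : R := Binomial.C (r + j) j * rising (k + INR r) j.

Lemma rising_S_l x j : rising x (S j) = x * rising (x + 1) j.
Proof.
induction j as [|j IH]; [simpl; ring|].
change (rising x (S (S j))) with (rising x (S j) * (x + INR (S j))). rewrite IH.
change (rising (x + 1) (S j)) with (rising (x + 1) j * (x + 1 + INR j)). rewrite S_INR. ring.
Qed.

Lemma binom_eq r j : Binomial.C (r + j) j = INR (fact (r + j)) / (INR (fact j) * INR (fact r)).
Proof. unfold Binomial.C. do 3 f_equal. f_equal. lia. Qed.

Lemma fact_S n : INR (fact (S n)) = (INR n + 1) * INR (fact n).
Proof. rewrite fact_simpl, mult_INR, S_INR. reflexivity. Qed.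

Lemma serre_binom_0 k r : serre_binom k r 0 = 1.
Proof.
unfold serre_binom. rewrite binom_eq, Nat.add_0_r. simpl. field. apply INR_fact_neq_0.
Qed.

Lemma serre_binom_first k m : serre_binom k 0 (S m) = serre_binom k 0 m * (k + INR m).
Proof.
unfold serre_binom. rewrite !binom_eq. simpl Nat.add. rewrite Rplus_0_r.
change (rising k (S m)) with (rising k m * (k + INR m)). simpl (fact 0). simpl (INR 1).
assert (A := INR_fact_neq_0 m). assert (B := INR_fact_neq_0 (S m)). field. auto.
Qed.

(** The recursion imposed by D^(m+1) = D D^m, with e = E2/12: differentiating e^j contributes j, the
    weight of theta^[s+1] contributes k + 2(s + 1), and the last term comes from raising theta^[s]
    to theta^[s+1]. *)
Lemma serre_binom_pascal k s j : serre_binom k (S s) (S j) = serre_binom k (S s) j * (INR j + k + 2 * INR (S s)) + serre_binom k s (S j).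
Proof.
unfold serre_binom. rewrite !binom_eq.
replace (S s + S j)%nat with (S (S (s + j))) by lia. replace (S s + j)%nat with (S (s + j)) by lia.
replace (s + S j)%nat with (S (s + j)) by lia.
rewrite (rising_S_l (k + INR s)).
change (rising (k + INR (S s)) (S j)) with (rising (k + INR (S s)) j * (k + INR (S s) + INR j)).
rewrite !fact_S, !S_INR, plus_INR. replace (k + INR s + 1) with (k + (INR s + 1)) by ring.
assert (A := INR_fact_neq_0 s). assert (B := INR_fact_neq_0 j).
assert (Ps := pos_INR s). assert (Pj := pos_INR j). field. repeat split; auto; lra.
Qed.

(** Balances the two sources of E4/144 in front of theta^[r]: the derivative of e^(j+1) gives -(j +
    1), that of theta^[r+1] gives (r + 1)(r + k). *)
Lemma serre_binom_cancel k r j : (INR j + 1) * serre_binom k r (S j) = (INR r + 1) * (k + INR r) * serre_binom k (S r) j.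
Proof.
unfold serre_binom. rewrite !binom_eq.
replace (S r + j)%nat with (S (r + j)) by lia. replace (r + S j)%nat with (S (r + j)) by lia.
rewrite (rising_S_l (k + INR r)). rewrite !fact_S, !S_INR, plus_INR. replace (k + INR r + 1) with (k + (INR r + 1)) by ring.
assert (A := INR_fact_neq_0 r). assert (B := INR_fact_neq_0 j).
assert (Ps := pos_INR r). assert (Pj := pos_INR j). field. repeat split; auto; lra.
Qed.

Lemma cder_Csum (f : nat -> C -> C) (l : nat -> C) z n :
  (forall i, (i < n)%nat -> cder (f i) z (l i)) -> cder (fun w => Csum (fun i => f i w) n) z (Csum l n).
Proof.
induction n as [|n IH]; intros H; [exact (cder_const 0 z)|]. simpl. apply cder_plus; [apply IH; auto|apply H; lia].
Qed.

Definition E2_over_12 (tau : C) : C := (E2 tau / 12)%C.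

Lemma cder_E2_over_12_pow p tau : HH tau ->
  cder (fun z => E2_over_12 z ^ p)%C tau (twopii * (RtoC (INR p) * E2_over_12 tau ^ (p - 1) * (E2_over_12 tau * E2_over_12 tau - E4 tau / 144)))%C.
Proof.
intros Ht. destruct (D_E2 tau Ht) as [H1 H2].
assert (He : cder E2_over_12 tau (twopii * (E2_over_12 tau * E2_over_12 tau - E4 tau / 144))%C).
{ unfold E2_over_12. apply (cder_ext (fun z => / 12 * E2 z)%C); [intros; field; cnz|].
  replace (twopii * (E2 tau / 12 * (E2 tau / 12) - E4 tau / 144))%C with (/ 12 * (twopii * Defs.D E2 tau))%C
   by (rewrite H2; field; cnz).
  now apply cder_scal. }
destruct p as [|p].
- simpl. replace (twopii * (0 * 1 * (E2_over_12 tau * E2_over_12 tau - E4 tau / 144)))%C with (RtoC 0) by ring. apply cder_const.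
- replace (S p - 1)%nat with p by lia.
  assert (Q := cder_comp (fun z => z ^ S p)%C E2_over_12 tau _ _ (cder_pow p (E2_over_12 tau)) He).
  apply (cder_eq _ _ _ _ Q). ring.
Qed.

(* For [r = 0] the truncated index [r - 1] is harmless: its coefficient vanishes. *)
Lemma D_higher_serre k r f tau : hol f -> HH tau ->
  Defs.D (higher_serre k r f) tau =
  (higher_serre k (S r) f tau + RtoC (k + 2 * INR r) * E2_over_12 tau * higher_serre k r f tau
   + RtoC (INR r * (INR r + k - 1) / 144) * E4 tau * higher_serre k (r - 1) f tau)%C.
Proof.
intros H Ht. destruct r as [|r].
- simpl. unfold serre, E2_over_12. rewrite RtoC_div by lra.
  replace (k + 2 * 0) with k by ring. replace (0 * (0 + k - 1) / 144) with 0 by field. field; cnz.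
- rewrite higher_serre_SS. replace (S r - 1)%nat with r by lia. unfold serre, E2_over_12. rewrite (RtoC_div _ 12) by lra. field; cnz.
Qed.

Lemma iter_D_expansion k f m : hol f -> forall tau, HH tau ->
  Nat.iter m Defs.D f tau =
  Csum (fun r => RtoC (serre_binom k r (m - r)) * E2_over_12 tau ^ (m - r) * higher_serre k r f tau)%C (S m).
Proof.
intros H. induction m as [|m IH]; intros tau Ht.
- simpl. rewrite serre_binom_0. ring.
- change (Nat.iter (S m) Defs.D f tau) with (Defs.D (Nat.iter m Defs.D f) tau).
  set (h := fun r => higher_serre k r f tau). set (e := E2_over_12 tau). set (E := E4 tau).
  (* [A] gains a power of e and [B] raises the order of theta; [G] and [T] carry E4, from the powers
     of e and from theta. [G] cancels against [T] shifted by one; where a truncated subtraction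
     distorts an exponent or an index, the coefficient is 0. *)
  set (A := fun r => (RtoC (serre_binom k r (m - r) * (INR (m - r) + k + 2 * INR r)) * e ^ (S m - r) * h r)%C).
  set (B := fun r => (RtoC (serre_binom k r (m - r)) * e ^ (m - r) * h (S r))%C).
  set (G := fun r => (- (RtoC (serre_binom k r (m - r) * INR (m - r) / 144) * e ^ (m - r - 1) * E * h r))%C).
  set (T := fun r => (RtoC (serre_binom k r (m - r) * (INR r * (INR r + k - 1)) / 144) * e ^ (m - r) * E * h (r - 1)%nat)%C).
  assert (Hd : Defs.D (Nat.iter m Defs.D f) tau = Csum (fun r => A r + B r + (G r + T r))%C (S m)).
  { apply D_unique. rewrite <- Csum_scal.
    apply (cder_HH_ext (fun z => Csum (fun r => RtoC (serre_binom k r (m - r)) * E2_over_12 z ^ (m - r) * higher_serre k r f z)%C (S m))); auto.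
    { intros z Hz. symmetry. now apply IH. }
    apply cder_Csum. intros r Hr.
    assert (Q := cder_mult _ _ _ _ _ (cder_scal (RtoC (serre_binom k r (m - r))) _ _ _ (cder_E2_over_12_pow (m - r) tau Ht))
       (Dcder _ _ (hol_higher_serre k f r H) Ht)). cbv beta in Q.
    apply (cder_eq _ _ _ _ Q).
    rewrite (D_higher_serre k r f tau H Ht).
    unfold A, B, G, T. fold (h r) (h (S r)) (h (r - 1)%nat) e E.
    destruct (Nat.eq_dec r m) as [->|Hrm].
    - rewrite Nat.sub_diag. replace (S m - m)%nat with 1%nat by lia. simpl (INR 0). simpl Cpow.
      replace (serre_binom k m 0 * 0 / 144) with 0 by field.
      rewrite !(RtoC_div _ 144), !RtoC_mult, !RtoC_plus, !RtoC_mult by lra. field; cnz.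
    - replace (S m - r)%nat with (S (S (m - r - 1))) by lia. replace (m - r)%nat with (S (m - r - 1)) by lia.
      replace (S (m - r - 1) - 1)%nat with (m - r - 1)%nat by lia. simpl Cpow.
      rewrite !(RtoC_div _ 144), !RtoC_mult, !RtoC_plus, !RtoC_mult by lra. field; cnz. }
  rewrite Hd, Csum_plus, Csum_plus, Csum_plus.
  assert (GT : (Csum G (S m) + Csum T (S m) = 0)%C).
  { rewrite (Csum_S_l T). cbn [Csum].
    assert (G m = 0) as ->.
    { unfold G. rewrite Nat.sub_diag. simpl (INR 0). replace (serre_binom k m 0 * 0 / 144) with 0 by field. ring. }
    assert (T 0%nat = 0) as ->.
    { unfold T. simpl (INR 0). replace (serre_binom k 0 (m - 0) * (0 * (0 + k - 1)) / 144) with 0 by field. ring. }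
    replace (Csum G m + 0 + (0 + Csum (fun i => T (S i)) m))%C with (Csum G m + Csum (fun i => T (S i)) m)%C by ring.
    rewrite <- Csum_plus. rewrite (Csum_ext _ (fun _ => RtoC 0)); [apply Csum_0|].
    intros r Hr. unfold G, T. replace (S r - 1)%nat with r by lia.
    replace (m - r)%nat with (S (m - S r)) by lia. replace (S (m - S r) - 1)%nat with (m - S r)%nat by lia.
    replace (serre_binom k r (S (m - S r)) * INR (S (m - S r)) / 144) with (serre_binom k (S r) (m - S r) * (INR (S r) * (INR (S r) + k - 1)) / 144).
    - ring.
    - rewrite !S_INR. assert (X := serre_binom_cancel k r (m - S r)).
      replace (serre_binom k r (S (m - S r)) * (INR (m - S r) + 1)) with ((INR r + 1) * (k + INR r) * serre_binom k (S r) (m - S r)) by (rewrite <- X; ring).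
      field. }
  rewrite GT, Cplus_0_r.
  rewrite (Csum_S_l (fun r => RtoC (serre_binom k r (S m - r)) * E2_over_12 tau ^ (S m - r) * higher_serre k r f tau)%C).
  rewrite (Csum_S_l A). cbn [Csum].
  fold e. replace (A 0%nat) with (RtoC (serre_binom k 0 (S m - 0)) * e ^ (S m - 0) * higher_serre k 0 f tau)%C.
  2:{ unfold A. rewrite !Nat.sub_0_r, serre_binom_first. fold (h 0%nat). simpl (INR 0).
      replace (INR m + k + 2 * 0) with (k + INR m) by ring. reflexivity. }
  replace (B m) with (RtoC (serre_binom k (S m) (S m - S m)) * e ^ (S m - S m) * higher_serre k (S m) f tau)%C.
  2:{ unfold B. rewrite !Nat.sub_diag, !serre_binom_0. reflexivity. }
  rewrite <- Cplus_assoc. f_equal. rewrite Cplus_assoc. f_equal. rewrite <- Csum_plus.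
  apply Csum_ext. intros r Hr. unfold A, B. fold (h (S r)).
  replace (S m - S r)%nat with (S (m - S r)) by lia. replace (m - r)%nat with (S (m - S r)) by lia.
  rewrite serre_binom_pascal, RtoC_plus. ring.
Qed.

(** * Modular differential operators *)

Lemma sum_n_Csum (u : nat -> C) n : sum_n u n = Csum u (S n).
Proof.
induction n as [|n IH].
- rewrite sum_O. simpl. now rewrite Cplus_0_l.
- rewrite sum_Sn, IH. reflexivity.
Qed.

Lemma Csum_triangle (F : nat -> nat -> C) N :
  Csum (fun m => Csum (fun r => F r (m - r)%nat) (S m)) N = Csum (fun r => Csum (fun j => F r j) (N - r)) N.
Proof.
induction N as [|N IH]; [reflexivity|].
cbn [Csum] in *. rewrite IH, Cplus_assoc, <- Csum_plus.
replace (S N - N)%nat with 1%nat by lia. rewrite Nat.sub_diag. f_equal; [|simpl; ring].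
apply Csum_ext. intros r Hr. replace (S N - r)%nat with (S (N - r)) by lia. reflexivity.
Qed.

Lemma Csum_extend u m n : (m <= n)%nat -> (forall i, (m <= i)%nat -> u i = RtoC 0) -> Csum u n = Csum u m.
Proof.
intros H Hu. replace n with (m + (n - m))%nat by lia. rewrite Csum_add.
rewrite (Csum_ext (fun i => u (m + i)%nat) (fun _ => RtoC 0)).
- rewrite Csum_0. ring.
- intros i _. apply Hu. lia.
Qed.

Lemma dcoef_Csum k n a r tau : dcoef k n a r tau =
  Csum (fun j => RtoC (serre_binom k r j) * E2_over_12 tau ^ j * a (r + j)%nat tau)%C (S n).
Proof. unfold dcoef. apply sum_n_Csum. Qed.

Section Expansion.

Variables (k : R) (n : nat) (a : nat -> C -> C).
Hypothesis a_zero : forall (r : nat) (tau : C), (n < r)%nat -> HH tau -> a r tau = RtoC 0.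

Lemma diffop_expansion f tau : hol f -> HH tau ->
  diffop n a f tau = Csum (fun r => dcoef k n a r tau * higher_serre k r f tau)%C (S n).
Proof.
intros H Ht. unfold diffop. rewrite sum_n_Csum.
set (F := fun r j => (RtoC (serre_binom k r j) * E2_over_12 tau ^ j * a (r + j)%nat tau * higher_serre k r f tau)%C).
transitivity (Csum (fun m => Csum (fun r => F r (m - r)%nat) (S m)) (S n)).
- apply Csum_ext. intros m _. rewrite (iter_D_expansion k f m H tau Ht), <- Csum_scal.
  apply Csum_ext. intros r Hr. unfold F. replace (r + (m - r))%nat with m by lia. ring.
- rewrite Csum_triangle. apply Csum_ext. intros r Hr.
  rewrite dcoef_Csum, Cmult_comm, <- Csum_scal.
  (* [dcoef] sums over all j <= n, the rearranged triangle only over j <= n - r; the other terms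
     contain some a_(r+j) with r + j > n. *)
  rewrite (Csum_extend (fun i => (higher_serre k r f tau * (RtoC (serre_binom k r i) * E2_over_12 tau ^ i * a (r + i)%nat tau))%C) (S n - r) (S n)); [|lia|].
  + apply Csum_ext. intros j _. unfold F. ring.
  + intros i Hi. rewrite a_zero by (auto; lia). ring.
Qed.

End Expansion.

(* [(z - z0) ^ s] isolates the coefficient of index [s] at [z0]. *)
Fixpoint monomial_coef (s j : nat) : C :=
  match j with O => RtoC 1 | S i => (monomial_coef s i * RtoC (INR (s - i)) / twopii)%C end.

Lemma monomial_coef_neq_0 s j : (j <= s)%nat -> monomial_coef s j <> 0.
Proof.
induction j as [|j IH]; intros H; [apply C1_nz|]. simpl. unfold Cdiv. apply Cmult_neq_0.
- apply Cmult_neq_0; [apply IH; lia|]. apply RtoC_neq_0, not_0_INR. lia.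
- intros E. assert (N := twopii_neq_0). assert (X := Cinv_r _ N). rewrite E, Cmult_0_r in X. symmetry in X. exact (C1_nz X).
Qed.

Lemma monomial_coef_0 s j : (s < j)%nat -> monomial_coef s j = 0.
Proof.
induction j as [|j IH]; intros H; [lia|]. simpl. destruct (Nat.eq_dec s j) as [->|N].
- rewrite Nat.sub_diag. simpl. unfold Cdiv. ring.
- rewrite IH by lia. unfold Cdiv. ring.
Qed.

Lemma iter_D_monomial z0 s j z : Nat.iter j Defs.D (fun w => (w - z0) ^ s)%C z = (monomial_coef s j * (z - z0) ^ (s - j))%C.
Proof.
revert z. induction j as [|j IH]; intros z.
- simpl. rewrite Nat.sub_0_r. ring.
- simpl Nat.iter. apply D_unique.
  apply (cder_ext (fun w => monomial_coef s j * (w - z0) ^ (s - j))%C); [intros w; symmetry; apply IH|].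
  assert (N := twopii_neq_0). simpl monomial_coef.
  destruct (s - j)%nat as [|p] eqn:E.
  + simpl. replace (twopii * (monomial_coef s j * 0 / twopii * (z - z0) ^ (s - S j)))%C with (monomial_coef s j * 0)%C by (field; exact N).
    apply cder_scal, cder_const.
  + replace (s - S j)%nat with p by lia.
    replace (twopii * (monomial_coef s j * RtoC (INR (S p)) / twopii * (z - z0) ^ p))%C
      with (monomial_coef s j * ((1 - 0) * (RtoC (INR (S p)) * (z - z0) ^ p)))%C by (field; exact N).
    apply cder_scal. apply (cder_comp (fun w => w ^ S p)%C (fun w => w - z0)%C); [apply cder_pow|].
    apply cder_minus; [apply cder_id|apply cder_const].
Qed.

Lemma test_function z0 s : exists f, hol f /\ (forall j, j <> s -> Nat.iter j Defs.D f z0 = 0) /\ Nat.iter s Defs.D f z0 <> 0.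
Proof.
exists (fun w => (w - z0) ^ s)%C. split; [|split].
- apply hol_pow, hol_cder. intros tau _. eexists. apply cder_minus; [apply cder_id|apply cder_const].
- intros j Hj. rewrite iter_D_monomial. destruct (le_lt_dec j s) as [L|L].
  + replace (s - j)%nat with (S (s - j - 1)) by lia. simpl. ring.
  + rewrite monomial_coef_0 by exact L. ring.
- rewrite iter_D_monomial, Nat.sub_diag. simpl. rewrite Cmult_1_r. apply monomial_coef_neq_0. lia.
Qed.

(** The expansion of D^m has leading coefficient 1, and the lower theta^[r] f vanish at the point by
    induction. *)
Lemma higher_serre_test k f z0 s : hol f -> HH z0 -> (forall j, (j < s)%nat -> Nat.iter j Defs.D f z0 = 0) ->
  forall m, (m <= s)%nat -> higher_serre k m f z0 = Nat.iter m Defs.D f z0.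
Proof.
intros H Hz Hs m. induction m as [m IH] using lt_wf_ind. intros Hm.
rewrite (iter_D_expansion k f m H z0 Hz). cbn [Csum].
rewrite (Csum_ext _ (fun _ => RtoC 0)).
- rewrite Csum_0, Nat.sub_diag, serre_binom_0. simpl. ring.
- intros r Hr. rewrite IH, Hs by lia. ring.
Qed.

Lemma diffop_coef_unique (X : nat -> C) n z0 : HH z0 ->
  (forall f, hol f -> Csum (fun r => X r * Nat.iter r Defs.D f z0)%C (S n) = 0) ->
  forall r, (r <= n)%nat -> X r = 0.
Proof.
intros Hz H r Hr. destruct (test_function z0 r) as [f [Hf [H1 H2]]].
assert (E := H f Hf).
assert (G : forall m, Csum (fun i => X i * Nat.iter i Defs.D f z0)%C m = if le_lt_dec m r then RtoC 0 else (X r * Nat.iter r Defs.D f z0)%C).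
{ induction m as [|m IH]; [reflexivity|]. cbn [Csum]. rewrite IH.
  destruct (le_lt_dec m r) as [L|L]; destruct (le_lt_dec (S m) r) as [L'|L']; try lia.
  - rewrite (H1 m) by lia. ring.
  - replace m with r by lia. ring.
  - rewrite (H1 m) by lia. ring. }
rewrite G in E. destruct le_lt_dec; [lia|].
replace (X r) with (X r * Nat.iter r Defs.D f z0 * / Nat.iter r Defs.D f z0)%C by (field; exact H2).
rewrite E. ring.
Qed.

(** The test function of the highest index annihilates all lower theta^[r] at the point, so the top
    coefficient is removed first and the order goes down. *)
Lemma serre_coef_unique k (X : nat -> C) n z0 : HH z0 ->
  (forall f, hol f -> Csum (fun r => X r * higher_serre k r f z0)%C (S n) = 0) ->
  forall r, (r <= n)%nat -> X r = 0.
Proof.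
intros Hz. induction n as [|n IH]; intros H.
- assert (E : X 0%nat = 0).
  { assert (E := H (fun _ => RtoC 1) (hol_const 1)). simpl in E. rewrite Cplus_0_l, Cmult_1_r in E. exact E. }
  intros r Hr. now replace r with 0%nat by lia.
- assert (E : X (S n) = 0).
  { destruct (test_function z0 (S n)) as [f [Hf [H1 H2]]].
    assert (T := higher_serre_test k f z0 (S n) Hf Hz ltac:(intros; apply H1; lia)).
    assert (E := H f Hf). remember (S n) as p. cbn [Csum] in E.
    rewrite (Csum_ext _ (fun _ => RtoC 0)) in E.
    - rewrite Csum_0, Cplus_0_l, T in E by lia.
      replace (X p) with (X p * Nat.iter p Defs.D f z0 * / Nat.iter p Defs.D f z0)%C by (field; exact H2).
      rewrite E. ring.
    - intros r Hr. rewrite T, H1 by lia. ring. }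
  intros r Hr. destruct (Nat.eq_dec r (S n)) as [->|N]; [exact E|].
  apply IH; [|lia]. intros f Hf. specialize (H f Hf).
  change (Csum (fun r => X r * higher_serre k r f z0)%C (S (S n))) with
   (Csum (fun r => X r * higher_serre k r f z0) (S n) + X (S n) * higher_serre k (S n) f z0)%C in H.
  rewrite <- H, E. ring.
Qed.

(** * Holomorphy at the cusp *)

Lemma cusp_ext f g : (forall z, HH z -> f z = g z) -> holomorphic_at_cusp f -> holomorphic_at_cusp g.
Proof. intros E [F [H1 H2]]. exists F. split; [exact H1|]. intros tau Ht. rewrite <- E; auto. Qed.

Lemma cusp_const c : holomorphic_at_cusp (fun _ => c).
Proof.
exists (fun _ => c). split; [|reflexivity]. intros z _. exists (RtoC 0). apply cder_is_derive, cder_const.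
Qed.

Lemma cusp_plus f g : holomorphic_at_cusp f -> holomorphic_at_cusp g -> holomorphic_at_cusp (fun z => f z + g z)%C.
Proof.
intros [F [F1 F2]] [G [G1 G2]]. exists (fun q => F q + G q)%C. split.
- intros z Hz. destruct (F1 z Hz) as [l Hl]. destruct (G1 z Hz) as [m Hm].
  exists (l + m)%C. apply cder_is_derive. apply cder_plus; now apply cder_is_derive.
- intros tau Ht. now rewrite F2, G2.
Qed.

Lemma cusp_mult f g : holomorphic_at_cusp f -> holomorphic_at_cusp g -> holomorphic_at_cusp (fun z => f z * g z)%C.
Proof.
intros [F [F1 F2]] [G [G1 G2]]. exists (fun q => F q * G q)%C. split.
- intros z Hz. destruct (F1 z Hz) as [l Hl]. destruct (G1 z Hz) as [m Hm].
  exists (l * G z + F z * m)%C. apply cder_is_derive. apply cder_mult; now apply cder_is_derive.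
- intros tau Ht. now rewrite F2, G2.
Qed.

Lemma cusp_pow f n : holomorphic_at_cusp f -> holomorphic_at_cusp (fun z => f z ^ n)%C.
Proof.
intros H. induction n as [|n IH]; [exact (cusp_const 1)|]. exact (cusp_mult _ _ H IH).
Qed.

Lemma cusp_Csum (f : nat -> C -> C) n : (forall i, (i < n)%nat -> holomorphic_at_cusp (f i)) ->
  holomorphic_at_cusp (fun z => Csum (fun i => f i z) n).
Proof.
induction n as [|n IH]; intros H; [exact (cusp_const 0)|]. simpl. apply cusp_plus; [apply IH; auto|apply H; lia].
Qed.

Lemma cusp_E2_over_12 : holomorphic_at_cusp E2_over_12.
Proof.
apply (cusp_mult E2 (fun _ => / 12)%C); [|apply cusp_const].
exists E2q. split; [|exact E2_eq]. intros q Hq. destruct (cder_E2q q Hq) as [DS [_ [l [Hl _]]]].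
exists l. now apply cder_is_derive.
Qed.

Lemma hol_E2_over_12 : hol E2_over_12.
Proof. exact (hol_mult E2 (fun _ => / 12)%C hol_E2 (hol_const _)). Qed.

(** * Equivariance and modularity of the coefficients *)

Section Main.

Variables (k : R) (K : Z) (n : nat) (a : nat -> C -> C).
Hypothesis a_holo : forall r : nat, (r <= n)%nat -> holomorphic_on HH (a r).
Hypothesis a_zero : forall (r : nat) (tau : C), (n < r)%nat -> HH tau -> a r tau = RtoC 0.

Lemma a_hol r : hol (a r).
Proof.
destruct (le_lt_dec r n) as [L|L]; [now apply a_holo|].
apply (hol_ext (fun _ => RtoC 0)); [|apply hol_const]. intros z Hz. symmetry. now apply a_zero.
Qed.

Lemma cusp_beyond r : (n < r)%nat -> holomorphic_at_cusp (a r).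
Proof.
intros L. apply (cusp_ext (fun _ => RtoC 0)); [|apply cusp_const]. intros z Hz. symmetry. now apply a_zero.
Qed.

Lemma dcoef_hol r : hol (dcoef k n a r).
Proof.
apply (hol_ext (fun tau => Csum (fun j => RtoC (serre_binom k r j) * E2_over_12 tau ^ j * a (r + j)%nat tau)%C (S n))).
{ intros z _. symmetry. apply dcoef_Csum. }
apply (hol_Csum (fun j tau => RtoC (serre_binom k r j) * E2_over_12 tau ^ j * a (r + j)%nat tau)%C). intros j _.
apply hol_mult; [|apply a_hol]. apply hol_mult; [apply hol_const|apply hol_pow, hol_E2_over_12].
Qed.

Lemma dcoef_cusp r : (forall i, holomorphic_at_cusp (a i)) -> holomorphic_at_cusp (dcoef k n a r).
Proof.
intros H. apply (cusp_ext (fun tau => Csum (fun j => RtoC (serre_binom k r j) * E2_over_12 tau ^ j * a (r + j)%nat tau)%C (S n))).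
{ intros z _. symmetry. apply dcoef_Csum. }
apply (cusp_Csum (fun j tau => RtoC (serre_binom k r j) * E2_over_12 tau ^ j * a (r + j)%nat tau)%C). intros j _.
apply cusp_mult; [|apply H]. apply cusp_mult; [apply cusp_const|apply cusp_pow, cusp_E2_over_12].
Qed.

Lemma a_cusp_of_dcoef : (forall r, (r <= n)%nat -> holomorphic_at_cusp (dcoef k n a r)) ->
  forall r, holomorphic_at_cusp (a r).
Proof.
(* Descending induction on r, with [i] counting the steps down from beyond n: d_r is a_r plus terms
   that contain only a_(r+j) with j > 0. *)
intros H. assert (X : forall i r, (n < r + i)%nat -> holomorphic_at_cusp (a r)).
{ induction i as [|i IH]; intros r Hr; [apply cusp_beyond; lia|].
  destruct (le_lt_dec r n) as [L|L]; [|now apply cusp_beyond].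
  apply (cusp_ext (fun tau => dcoef k n a r tau
    + RtoC (-1) * Csum (fun j => RtoC (serre_binom k r (S j)) * E2_over_12 tau ^ S j * a (r + S j)%nat tau)%C n)%C).
  - intros z _. rewrite dcoef_Csum, Csum_S_l, serre_binom_0, Nat.add_0_r. simpl Cpow. ring.
  - apply cusp_plus; [now apply H|]. apply cusp_mult; [apply cusp_const|].
    apply (cusp_Csum (fun j tau => RtoC (serre_binom k r (S j)) * E2_over_12 tau ^ S j * a (r + S j)%nat tau)%C). intros j _.
    apply cusp_mult; [|apply IH; lia]. apply cusp_mult; [apply cusp_const|apply cusp_pow, cusp_E2_over_12]. }
intros r. apply (X (S n)). lia.
Qed.

(** [is_MLDO] only provides some coefficients, perhaps of another order, that are holomorphic at the
    cusp. The monomial test functions identify them with the given ones on the half-plane. *)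
Lemma a_cusp_of_MLDO l : is_MLDO k l (diffop n a) -> forall r, holomorphic_at_cusp (a r).
Proof.
intros [[n' [a' [Ha' HL]]] _] r.
destruct (le_lt_dec r n) as [Hr|Hr]; [|now apply cusp_beyond].
(* Padding by zeros brings the two coefficient lists to the common length [max n n']; values beyond
   the stated order are arbitrary for [a']. *)
set (b := fun (m : nat) (c : nat -> C -> C) (i : nat) (tau : C) => if le_lt_dec i m then c i tau else RtoC 0).
assert (Eb : forall m c N f tau, (m <= N)%nat ->
   diffop m c f tau = Csum (fun i => b m c i tau * Nat.iter i Defs.D f tau)%C (S N)).
{ intros m c N f tau HN. unfold diffop. rewrite sum_n_Csum.
  rewrite (Csum_extend (fun i => b m c i tau * Nat.iter i Defs.D f tau)%C (S m) (S N)); [|lia|].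
  - apply Csum_ext. intros i Hi. unfold b. destruct le_lt_dec; [reflexivity|lia].
  - intros i Hi. unfold b. destruct le_lt_dec; [lia|ring]. }
assert (E : forall tau, HH tau -> a r tau = b n' a' r tau).
{ intros tau Ht. apply Ceq_minus.
  replace (a r tau) with (b n a r tau) by (unfold b; destruct le_lt_dec; [reflexivity|lia]).
  apply (diffop_coef_unique (fun i => b n a i tau - b n' a' i tau)%C (max n n') tau Ht); [|lia].
  intros f Hf. specialize (HL f tau Hf Ht).
  rewrite (Eb n a (max n n')), (Eb n' a' (max n n')) in HL by lia.
  apply Ceq_minus in HL. rewrite <- HL.
  rewrite (Csum_ext _ (fun i => b n a i tau * Nat.iter i Defs.D f tau + RtoC (-1) * (b n' a' i tau * Nat.iter i Defs.D f tau))%C).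
  - rewrite Csum_plus, Csum_scal. ring.
  - intros i _. ring. }
apply (cusp_ext (b n' a' r)); [intros; symmetry; auto|].
unfold b. destruct (le_lt_dec r n'); [now apply Ha'|apply cusp_const].
Qed.

Lemma Cpower_split (j : C) r :
  Cpower j (- (k + IZR K)) = (Cpower j (- (k + 2 * INR r)) * Cpower j (- IZR (K - 2 * Z.of_nat r)))%C.
Proof.
rewrite <- Cpower_plus. f_equal. rewrite minus_IZR, mult_IZR, <- INR_IZR_INZ. ring.
Qed.

(** Here and in the next lemma the two sides of equivariance become combinations of the same values
    theta^[r] f at the moved point, so only their coefficients need comparing. *)
Lemma slash_diffop f g tau : hol f -> HH tau ->
  slash (k + IZR K) g (diffop n a f) tau =
  Csum (fun r => slash (IZR (K - 2 * Z.of_nat r)) g (dcoef k n a r) tau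
                 * (Cpower (autfactor g tau) (- (k + 2 * INR r)) * higher_serre k r f (moebius g tau)))%C (S n).
Proof.
intros Hf Ht. unfold slash at 1. rewrite (diffop_expansion k n a a_zero f _ Hf (moebius_HH g tau Ht)), <- Csum_scal.
apply Csum_ext. intros r _. unfold slash. rewrite (Cpower_split _ r). ring.
Qed.

Lemma diffop_slash f g tau : hol f -> HH tau ->
  diffop n a (slash k g f) tau =
  Csum (fun r => dcoef k n a r tau
                 * (Cpower (autfactor g tau) (- (k + 2 * INR r)) * higher_serre k r f (moebius g tau)))%C (S n).
Proof.
intros Hf Ht. rewrite (diffop_expansion k n a a_zero _ _ (hol_slash k g f Hf) Ht).
apply Csum_ext. intros r _. rewrite higher_serre_slash by assumption. reflexivity.
Qed.

Lemma MLDO_iff_modular : is_MLDO k (k + IZR K) (diffop n a) <->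
  (forall r : nat, (r <= n)%nat -> modular_form (K - 2 * Z.of_nat r) (dcoef k n a r)).
Proof.
split.
- intros HL r Hr. split; [apply dcoef_hol|]. split; [|apply dcoef_cusp; now apply (a_cusp_of_MLDO _ HL)].
  intros g tau Ht. destruct HL as [_ HL]. symmetry. apply Ceq_minus.
  set (Y := fun r => (dcoef k n a r tau - slash (IZR (K - 2 * Z.of_nat r)) g (dcoef k n a r) tau)%C).
  assert (X : (Y r * Cpower (autfactor g tau) (- (k + 2 * INR r)))%C = 0).
  (* The coefficients are separated at [moebius g tau], where f is evaluated, although they are
     themselves functions of [tau]. *)
  { apply (serre_coef_unique k (fun r => Y r * Cpower (autfactor g tau) (- (k + 2 * INR r)))%C n (moebius g tau) (moebius_HH g tau Ht)); [|exact Hr].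
    intros f Hf. specialize (HL f g tau Hf Ht). rewrite slash_diffop, diffop_slash in HL by assumption.
    apply Ceq_minus in HL. rewrite <- HL. unfold Cminus at 1.
    replace (- Csum (fun r0 => slash (IZR (K - 2 * Z.of_nat r0)) g (dcoef k n a r0) tau
      * (Cpower (autfactor g tau) (- (k + 2 * INR r0)) * higher_serre k r0 f (moebius g tau)))%C (S n))%C
     with (RtoC (-1) * Csum (fun r0 => slash (IZR (K - 2 * Z.of_nat r0)) g (dcoef k n a r0) tau
      * (Cpower (autfactor g tau) (- (k + 2 * INR r0)) * higher_serre k r0 f (moebius g tau)))%C (S n))%C by ring.
    rewrite <- Csum_scal, <- Csum_plus. apply Csum_ext. intros i _. unfold Y. ring. }
  fold (Y r). assert (N := Cpower_neq_0 (autfactor g tau) (- (k + 2 * INR r))).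
  replace (Y r) with (Y r * Cpower (autfactor g tau) (- (k + 2 * INR r)) * / Cpower (autfactor g tau) (- (k + 2 * INR r)))%C by (field; exact N).
  rewrite X. ring.
- intros H. split.
  + exists n, a. split; [|reflexivity]. intros r Hr. split; [now apply a_holo|].
    apply a_cusp_of_dcoef. intros i Hi. apply (H i Hi).
  + intros f g tau Hf Ht. rewrite slash_diffop, diffop_slash by assumption.
    apply Csum_ext. intros r Hr. f_equal. symmetry. apply (H r); [lia|exact Ht].
Qed.

End Main.

Theorem theorem4 (k : R) (K : Z) (n : nat) (a : nat -> C -> C)
  (a_holo : forall r : nat, (r <= n)%nat -> holomorphic_on HH (a r))
  (a_zero : forall (r : nat) (tau : C), (n < r)%nat -> HH tau -> a r tau = RtoC 0) :
  (is_MLDO k (k + IZR K) (diffop n a) <->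
   (forall r : nat, (r <= n)%nat ->
      modular_form (K - 2 * Z.of_nat r) (dcoef k n a r))) /\
  (is_MLDO k (k + IZR K) (diffop n a) ->
   forall (f : C -> C) (tau : C), holomorphic_on HH f -> HH tau ->
     diffop n a f tau
     = sum_n (fun r => (dcoef k n a r tau * higher_serre k r f tau)%C) n).
Proof.
split.
- exact (MLDO_iff_modular k K n a a_holo a_zero).
- intros _ f tau Hf Ht. rewrite (sum_n_Csum (fun r => dcoef k n a r tau * higher_serre k r f tau)%C).
  exact (diffop_expansion k n a a_zero f tau Hf Ht).
Qed.
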